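(* Let $G$ be a finite simple graph with minimum degree $\delta(G)\ge 2$ and at most three vertices of degree $2$. Then $G$ contains a cycle whose length is divisible by $3$ if and only if $G$ is not an exceptional graph.
   Context: Let $V_2(H)$ denote the set of vertices of degree $2$ of a graph $H$. Let $r$ be a vertex of degree $2$ of a graph $G$. $G$ is called an exceptional graph with root $r$ if there is a sequence $(G_0,x_0,y_0),\ldots,(G_n,x_n,y_n)$ for some integer $n\ge 0$ such that $G_0=K_{2,3}$, $G_n=G$, for each $i$ the vertices $r,x_i,y_i$ are distinct degree-$2$ vertices of $G_i$, and for each $i<n$: (1) if $x_iy_i\notin E(G_i)$, then $G_{i+1}$ is obtained from $G_i$ by adding a new path of length $3$ joining $x_i$ and $y_i$ (with two new internal vertices); (2) if $x_iy_i\in E(G_i)$, then $G_{i+1}$ is obtained from $G_i$ either by adding a new vertex $v$ with $N_{G_{i+1}}(v)=N_{G_i}(w)$ for some $w\in\{x_i,y_i\}$, or by adding a new $4$-cycle $abcda$ together with the edges $ax_i$ and $cy_i$. A graph is exceptional if it is an exceptional graph with root $r$ for some vertex $r$. *)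

(* Defs.v *)
From mathcomp Require Import all_boot.
Set Implicit Arguments. Unset Strict Implicit. Unset Printing Implicit Defensive.

Definition simple_graph (T : finType) (e : rel T) : Prop :=
  symmetric e /\ irreflexive e.

Definition deg (T : finType) (e : rel T) (v : T) : nat := #|[set u | e v u]|.

Definition is_cycle (T : finType) (e : rel T) (s : seq T) : Prop :=
  [/\ 3 <= size s, uniq s & cycle e s].

(* A graph is a pair (n, E) with E : rel nat; the constructions below keep
   E supported on vertices < n. *)
Definition ndeg (n : nat) (E : rel nat) (v : nat) : nat := count (E v) (iota 0 n).

Definition ndeg2 (n : nat) (E : rel nat) (v : nat) : bool := (v < n) && (ndeg n E v == 2).

Definition sedge (a b : nat) : rel nat :=
  fun u v => ((u == a) && (v == b)) || ((u == b) && (v == a)).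

Definition K23 : rel nat :=
  fun u v => ((u < 2) && (2 <= v < 5)) || ((v < 2) && (2 <= u < 5)).

Definition add_path3 (n : nat) (E : rel nat) (x y : nat) : rel nat :=
  fun u v => [|| E u v, sedge x n u v, sedge n n.+1 u v | sedge n.+1 y u v].

Definition add_twin (n : nat) (E : rel nat) (w : nat) : rel nat :=
  fun u v => [|| E u v, (u == n) && E w v | (v == n) && E w u].

Definition add_C4 (n : nat) (E : rel nat) (x y : nat) : rel nat :=
  fun u v => [|| E u v, sedge n n.+1 u v, sedge n.+1 n.+2 u v,
                 sedge n.+2 n.+3 u v, sedge n.+3 n u v,
                 sedge n x u v | sedge n.+2 y u v].

Definition adm (n : nat) (E : rel nat) (r x y : nat) : Prop :=
  [/\ ndeg2 n E r, ndeg2 n E x, ndeg2 n E y & [/\ r != x, r != y & x != y]].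

(* excg n E r : (n,E) is some G_i of a sequence as in the definition, with root r *)
Inductive excg (r : nat) : nat -> rel nat -> Prop :=
| excg_base : ndeg2 5 K23 r -> excg r 5 K23
| excg_path : forall n E x y, excg r n E -> adm n E r x y -> ~~ E x y ->
    excg r n.+2 (add_path3 n E x y)
| excg_twin : forall n E x y w, excg r n E -> adm n E r x y -> E x y ->
    (w = x \/ w = y) -> excg r n.+1 (add_twin n E w)
| excg_C4 : forall n E x y, excg r n E -> adm n E r x y -> E x y ->
    excg r n.+4 (add_C4 n E x y).

Definition giso (T : finType) (e : rel T) (n : nat) (E : rel nat) (f : T -> nat) : Prop :=
  [/\ injective f, (forall u, f u < n), (forall k, k < n -> exists u, f u = k)
    & (forall u v, e u v = E (f u) (f v))].

(* G is exceptional with root r: G (up to isomorphism) = G_n, where the last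
   graph also has distinct degree-2 vertices r, x_n, y_n. *)
Definition exceptional_root (T : finType) (e : rel T) (r : T) : Prop :=
  exists n E f, [/\ giso e n E f, excg (f r) n E &
                    exists x y, adm n E (f r) x y].

Definition exceptional (T : finType) (e : rel T) : Prop :=
  exists r, exceptional_root e r.

(* Main.v *)
(* A zero cycle is a cycle of length 0 modulo 3. Every stage of the construction consists
   of a core, an induced subgraph with the root and two terminals, possibly with a few
   vertices attached to the terminals. Induction over cores determines which residues
   modulo 3 occur as lengths of paths between the root and the terminals; in particular
   cores contain no zero cycle, which settles one direction.

   For the converse, consider more generally graphs without zero cycles, without vertices
   of degree 1 and with at most three vertices of degree 2, isolated vertices being
   ignored. The proof is by induction on the number of nonisolated vertices. The basic
   reduction deletes a set D and joins a vertex z to a set B, where z and the elements of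
   B are joined through D by paths of length 1 modulo 3 and the elements of B among
   themselves by paths of length 2 modulo 3; no zero cycle arises. Whenever degrees allow,
   the reduced graph is exceptional by induction, and its three vertices of degree 2 and
   the residues of its paths either exhibit the original graph as exceptional or give it
   a zero cycle. This treats in turn adjacent vertices of degree 2, twins of degree 2,
   vertices of degree 2 with a neighbour of degree at least 4 and vertices of degree 2
   with a common neighbour. In the remaining case the three vertices of degree 2 have six
   distinct cubic neighbours, and no such graph exists: contracting a path of length 3
   around a vertex of degree 2 shows that some vertex of degree 2 lies on a 4-cycle, and
   such 4-cycles are excluded by further reductions. *)
Require Import Defs.
From mathcomp Require Import all_boot.
From Stdlib Require Import Classical.
From mathcomp Require Import zify.
Set Implicit Arguments. Unset Strict Implicit. Unset Printing Implicit Defensive.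

(** * Paths and cycles modulo 3 *)

(** A reduced graph is another relation on the same type [T], in which the deleted vertices are
    isolated; this is why isolated vertices are ignored and why the size of the support is the
    measure. Two mechanisms end the cases. Most end by counting: an exceptional graph has exactly
    three vertices of degree 2, so a reduction that leaves at most two candidates is impossible. The
    others end by residues: the terminals of a core with [b] false are joined by paths of residues 1
    and 2 but never 0, those of a core with [b] true by paths of residue 2 and, except for the
    initial path, 0, but never 1; a detour of complementary residue through the deleted vertices
    then closes a zero cycle. The basic reduction includes the contraction of a path of length 3,
    which cannot be noticed modulo 3, and the replacement of a path of length 4 or 7 by an edge. If
    no vertex of degree 2 is available to start a reduction, an edge is deleted instead. *)

Lemma mod3_cases i j : i = j.+1 %[mod 3] \/ i = j.+2 %[mod 3] \/ i = j.+3 %[mod 3].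
Proof.
rewrite -(addn3 j) -(addn2 j) -(addn1 j).
rewrite -(modnDml j 1) -(modnDml j 2) -(modnDml j 3).
have : i %% 3 < 3 by rewrite ltn_mod.
have : j %% 3 < 3 by rewrite ltn_mod.
by case: (i %% 3) (j %% 3) => [|[|[|?]]] [|[|[|?]]] // _ _; auto.
Qed.

Definition nozero (T : finType) (e : rel T) : Prop :=
  forall s, is_cycle e s -> ~~ (3 %| size s).

(** Only the residue of the length is kept. The confinement to [A] is what allows two paths to be
    joined, or closed outside [A], without repeating a vertex. *)
Definition linked (T : finType) (e : rel T) (A : {set T}) (u v : T) (k : nat) : Prop :=
  exists p, [/\ path e u p, last u p = v, uniq (u :: p), {subset u :: p <= A}
              & size p = k %[mod 3]].

Section Linked.
Variables (T : finType) (e : rel T).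
Hypothesis esym : symmetric e.
Implicit Types (A B : {set T}) (u v : T).

Lemma linked_refl A u : u \in A -> linked e A u u 0.
Proof. by move=> uA; exists [::]; split=> // x; rewrite inE => /eqP->. Qed.

Lemma linked_mod A u v k k' : k' = k %[mod 3] -> linked e A u v k -> linked e A u v k'.
Proof. by move=> E [p [h1 h2 h3 h4 h5]]; exists p; split; rewrite // E. Qed.

Lemma linked_sub A B u v k : A \subset B -> linked e A u v k -> linked e B u v k.
Proof.
move=> /subsetP AB [p [h1 h2 h3 h4 h5]]; exists p; split=> // x /h4; exact: AB.
Qed.

Lemma linked_in A u v k : linked e A u v k -> (u \in A) && (v \in A).
Proof.
case=> p [_ <- _ h _]; rewrite !h ?mem_head //; exact: mem_last.
Qed.

Lemma linked_sym A u v k : linked e A u v k -> linked e A v u k.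
Proof.
case=> p [h1 h2 h3 h4 h5]; have Ev : rev (belast u p) = behead (v :: rev (belast u p)) by [].
have E : v :: rev (belast u p) = rev (u :: p) by rewrite [u :: p]lastI h2 rev_rcons.
exists (rev (belast u p)); split.
- by rewrite -h2 rev_path; apply: sub_path h1 => x y; rewrite esym.
- rewrite -[last _ _]/(last v (v :: rev (belast u p))) E.
  by rewrite rev_cons last_rcons.
- by rewrite E rev_uniq.
- by move=> x; rewrite E mem_rev; apply: h4.
- by rewrite size_rev size_belast.
Qed.

(* The list [w] is the part of a path from [u] to [v] that precedes its last vertex. *)
Lemma linked_pre A B u w v v' k k' :
  linked e A v v' k -> path e u (rcons w v) -> uniq (u :: w) ->
  all (fun x => x \notin A) (u :: w) -> A \subset B -> {subset u :: w <= B} ->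
  k' = (size w + k).+1 %[mod 3] -> linked e B u v' k'.
Proof.
case=> p [h1 h2 h3 h4 h5] pw uw wA AB wB Ek.
exists (rcons w v ++ p); split.
- by rewrite cat_path pw last_rcons.
- by rewrite last_cat last_rcons.
- rewrite cat_rcons -cat_cons cat_uniq uw h3 andbT -all_predC.
  by apply/allP => x /h4 xA; apply/negP => /(allP wA); rewrite xA.
- move=> x; rewrite cat_rcons -cat_cons mem_cat => /orP[/wB //|/h4].
  by apply: (subsetP AB).
- rewrite size_cat size_rcons Ek; lia.
Qed.

Lemma linked_post A B u w v v' k k' :
  linked e A v' v k -> path e v (rcons w u) -> uniq (rcons w u) ->
  all (fun x => x \notin A) (rcons w u) -> A \subset B -> {subset rcons w u <= B} ->
  k' = (size w + k).+1 %[mod 3] -> linked e B v' u k'.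
Proof.
move=> /linked_sym L pw uw wA AB wB Ek; apply: linked_sym.
have E : u :: rev w = rev (rcons w u) by rewrite rev_rcons.
apply: (linked_pre (w := rev w) L) => //.
- have := rev_path e v (rcons w u).
  rewrite last_rcons belast_rcons rev_cons => ->.
  by apply: sub_path pw => x y; rewrite esym.
- by rewrite E rev_uniq.
- by rewrite E all_rev.
- by move=> x; rewrite E mem_rev; apply: wB.
- by rewrite size_rev.
Qed.

Lemma linked_edge A u v : e u v -> u != v -> u \in A -> v \in A -> linked e A u v 1.
Proof.
move=> uv nuv uA vA; exists [:: v]; split; rewrite //= ?uv // ?inE ?nuv //.
by move=> x; rewrite !inE => /orP[] /eqP->.
Qed.

(** The path and the detour [w] form a cycle of length [(k + size w).+1] modulo 3. Degenerate
    lengths 1 and 2 take care of themselves, as a positive multiple of 3 is at least 3. *)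
Lemma nozero_close A u v w k : nozero e -> linked e A u v k ->
  path e v (rcons w u) -> uniq w -> all (fun x => x \notin A) w ->
  (k + size w).+1 %% 3 <> 0.
Proof.
move=> nz [p [h1 h2 h3 h4 h5]] pw uw wA E0.
apply: (negP (nz (w ++ u :: p) _)); last first.
  by rewrite size_cat /=; lia.
split.
- rewrite size_cat /=; lia.
- rewrite cat_uniq uw h3 andbT -all_predC; apply/allP => x /h4 xA.
  by apply/negP => /(allP wA); rewrite xA.
- rewrite -(rot_cycle (size w)) rot_size_cat /= rcons_cat cat_path h1 h2 /=.
  exact: pw.
Qed.
End Linked.

Lemma linked_rel (T : finType) (e e' : rel T) (A : {set T}) u v k :
  {in A &, subrel e e'} -> linked e A u v k -> linked e' A u v k.
Proof.
move=> sub [p [h1 h2 h3 h4 h5]]; exists p; split=> //.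
elim: p u h1 {h2 h3 h5} h4 => //= y p IH u /andP[uy py] h4.
rewrite sub ?IH ?h4 ?inE ?eqxx ?orbT // => x xp; apply: h4.
by rewrite inE xp orbT.
Qed.

Lemma linked_join (T : finType) (e : rel T) (A B : {set T}) u w1 p q w2 v k k' :
  symmetric e -> linked e A p q k ->
  path e u (rcons w1 p) -> path e q (rcons w2 v) ->
  uniq (u :: w1 ++ rcons w2 v) ->
  all (fun x => x \notin A) (u :: w1 ++ rcons w2 v) ->
  A \subset B -> all (fun x => x \in B) (u :: w1 ++ rcons w2 v) ->
  k' = (size w1 + size w2 + k).+2 %[mod 3] -> linked e B u v k'.
Proof.
move=> esym L p1 p2; rewrite -cat_cons cat_uniq !all_cat.
case/and3P=> u1 h u2 /andP[a1 a2] AB /andP[b1 b2] Ek.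
set C := A :|: [set x in u :: w1].
have LC : linked e C u q (size w1 + k).+1.
  apply: (linked_pre L p1 u1 a1) => //; first exact: subsetUl.
  by move=> x xw; rewrite !inE; rewrite inE in xw; rewrite xw orbT.
apply: (linked_post esym LC p2) => //.
- apply/allP=> x xw; rewrite in_setU negb_or (allP a2) //= inE.
  by apply: contra h => xw1; apply/hasP; exists x.
- rewrite subUset AB /=; apply/subsetP => x; rewrite inE; exact: (allP b1).
- exact: (allP b2).
- rewrite Ek; lia.
Qed.

Ltac rew_hyps := repeat match goal with
  | H : is_true ?b |- context [?b] => progress rewrite H
  | H : is_true (~~ ?b) |- context [?b] => progress rewrite (negPf H)
  end.
Ltac mem := rewrite ?inE ?eqxx /=; rew_hyps; rewrite ?orbT ?andbT ?andbF //=.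
Ltac contra_hyp := match goal with
  | H : is_true (?x \notin ?S), H' : is_true (?x \in ?S) |- _ => by rewrite H' in H
  | H : is_true (?x \notin ?S), H' : (?x \in ?S) = true |- _ => by rewrite H' in H
  | H : is_true (?x != ?x) |- _ => by rewrite eqxx in H
  | I : irreflexive ?e, H : is_true (?e ?x ?x) |- _ => by rewrite I in H
  | H : is_true (~~ ?b), H' : is_true ?b |- _ => by rewrite H' in H
  end.
Ltac neq := first
  [ assumption | by rewrite eq_sym | apply/eqP => ?; subst; contra_hyp
  | done | by apply/eqP => ?; subst; mem].
Ltac allneq := rewrite /= ?inE ?negb_or ?andbT;
  repeat (apply/andP; split); try solve [neq | mem].

Ltac eqcase a b := case: (boolP (a == b)) => [/eqP ?|?].

(** * Cores *)

(* [core e r b S p q] describes the graph induced by [e] on [S], one stage of the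
   construction with root [r]. If [b] is false, [p] and [q] are nonadjacent twins of
   degree 2, a pair to be used by the next step; if [b] is true, a step has been started
   on such a pair (or [S] is a path through [r]), and the stage is completed by attaching
   twins to both [p] and [q]. [core_pendr] and [core_pendl] then stand for a path of
   length 3 followed by a twin, [core_C4] for a path of length 3 followed by a 4-cycle. *)
Inductive core (T : finType) (e : rel T) (r : T) : bool -> {set T} -> T -> T -> Prop :=
| core_base p q : p != q -> r != p -> r != q -> e r p -> e r q -> ~~ e p q ->
    core e r true [set p; q; r] p q
| core_twins S p q x y : core e r true S p q ->
    x \notin S -> y \notin S -> x != y -> ~~ e x y ->
    {in S, forall v, e x v = (v == p) || (v == q)} ->
    {in S, forall v, e y v = (v == p) || (v == q)} ->
    core e r false (x |: (y |: S)) x y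
| core_pendr S p q y : core e r false S p q -> y \notin S ->
    {in S, forall v, e y v = (v == q)} -> core e r true (y |: S) p y
| core_pendl S p q x : core e r false S p q -> x \notin S ->
    {in S, forall v, e x v = (v == p)} -> core e r true (x |: S) x q
| core_C4 S p q x y a c : core e r false S p q ->
    x \notin S -> y \notin S -> a \notin S -> c \notin S -> uniq [:: x; y; a; c] ->
    {in S, forall v, e x v = (v == p)} -> {in S, forall v, e y v = (v == q)} ->
    {in S, forall v, e a v = false} -> {in S, forall v, e c v = false} ->
    e x y -> e a x -> e c y -> ~~ e a y -> ~~ e c x -> ~~ e a c ->
    core e r true (x |: (y |: (a |: (c |: S)))) a c.

Section Core.
Variables (T : finType) (e : rel T).
Hypotheses (esym : symmetric e) (eirr : irreflexive e).
Implicit Types (S : {set T}) (r p q : T).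

Lemma core_in r b S p q : core e r b S p q ->
  [/\ p \in S, q \in S & r \in S] /\ [/\ p != q, r != p & r != q].
Proof.
elim=> {b S p q}.
- by move=> p q ? ? ? *; split; split; mem.
- by move=> S p q x y _ [[? ? ?] [? ? ?]] *; split; split; try solve [neq | mem].
- by move=> S p q y _ [[? ? ?] [? ? ?]] *; split; split; try solve [neq | mem].
- by move=> S p q y _ [[? ? ?] [? ? ?]] *; split; split; try solve [neq | mem].
- move=> S p q x y a c _ [[? ? ?] [? ? ?]] ? ? ? ? /=; rewrite !inE !negb_or.
  move=> /and4P[/and3P[? ? ?] /andP[? ?] ? _] *.
  by split; split; try solve [neq | mem].
Qed.

Lemma core_swap r b S p q : core e r b S p q -> core e r b S q p.
Proof.
elim=> {b S p q}.
- move=> p q h1 h2 h3 h4 h5 h6; rewrite [[set p; q]]setUC.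
  by apply: core_base; rewrite // 1?eq_sym // esym.
- move=> S p q x y _ h1 *; rewrite setUCA; apply: core_twins h1 _ _ _ _ _ _ => //.
  + by rewrite eq_sym.
  + by rewrite esym.
  + by move=> v vS; rewrite orbC; auto.
  + by move=> v vS; rewrite orbC; auto.
- by move=> S p q y _ h1 *; apply: core_pendl h1 _ _.
- by move=> S p q y _ h1 *; apply: core_pendr h1 _ _.
- move=> S p q x y a c _ h1 h2 h3 h4 h5 h6 *.
  have -> : x |: (y |: (a |: (c |: S))) = y |: (x |: (c |: (a |: S))).
    by apply/setP=> v; rewrite !inE; case: (v == x) (v == y) (v == a) (v == c) => [] [] [] [].
  apply: core_C4 h1 _ _ _ _ _ _ _ _ _ _ _ _ _ _ _ => //.
  + move: h6; rewrite /= !inE !negb_or => /and4P[/and3P[? ? ?] /andP[? ?] ? _].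
    by allneq.
  + by rewrite esym.
  + by rewrite esym.
Qed.

Lemma core_ext r (e' : rel T) b S p q : core e r b S p q ->
  {in S &, e =2 e'} -> core e' r b S p q.
Proof.
elim=> {b S p q}.
- move=> p q ? ? ? h1 h2 h3 H.
  by apply: core_base => //; rewrite -?H //; mem.
- move=> S p q x y h0 IH xS yS nxy h1 h2 h3 H.
  have [[pS qS _] _] := core_in h0.
  apply: core_twins (IH _) _ _ _ _ _ _ => //.
  + by move=> u v uS vS; apply: H; mem.
  + by rewrite -H //; mem.
  + by move=> v vS; rewrite -H ?h2 //; mem.
  + by move=> v vS; rewrite -H ?h3 //; mem.
- move=> S p q x h0 IH xS h2 H.
  apply: core_pendr (IH _) _ _ => //.
  + by move=> u v uS vS; apply: H; mem.
  + by move=> v vS; rewrite -H ?h2 //; mem.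
- move=> S p q x h0 IH xS h2 H.
  apply: core_pendl (IH _) _ _ => //.
  + by move=> u v uS vS; apply: H; mem.
  + by move=> v vS; rewrite -H ?h2 //; mem.
- move=> S p q x y a c h0 IH ? ? ? ? ? h1 h2 h3 h4 ? ? ? ? ? ? H.
  apply: core_C4 (IH _) _ _ _ _ _ _ _ _ _ _ _ _ _ _ _ => //;
    try by rewrite -H //; mem.
  + by move=> u v uS vS; apply: H; mem.
  + by move=> v vS; rewrite -H ?h1 //; mem.
  + by move=> v vS; rewrite -H ?h2 //; mem.
  + by move=> v vS; rewrite -H ?h3 //; mem.
  + by move=> v vS; rewrite -H ?h4 //; mem.
Qed.

(** Attaching twins adds 2 to a path between the terminals and offers a new one of length 2 through
    a single old terminal, so residue 2 becomes 1 and 2. A pendant adds 1, which turns 1 and 2 into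
    2 and 0. The 4-cycle step adds 4 and offers the path [a x y c] of length 3. The initial path
    lacks residue 0, hence the alternative about [r]. *)
Lemma core_len r b S p q : core e r b S p q ->
  if b then linked e S p q 2 /\ ((e r p /\ e r q) \/ linked e S p q 0)
  else linked e S p q 1 /\ linked e S p q 2.
Proof.
elim=> {b S p q}.
- move=> p q h1 h2 h3 h4 h5 h6; split; last by left.
  exists [:: r; q]; split => //=; first by rewrite esym h4 h5.
    by allneq.
  by move=> v; rewrite !inE => /or3P[] /eqP->; mem.
- move=> S p q x y h0 [L _] xS yS nxy h1 h2 h3.
  have [[pS qS _] [npq _ _]] := core_in h0.
  have exp : e x p by rewrite h2 // eqxx.
  have eyp : e y p by rewrite h3 // eqxx.
  have eqy : e q y by rewrite esym h3 // eqxx orbT.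
  split.
    apply: (linked_join (w1 := [::]) (w2 := [::]) esym L) => //=.
    + by rewrite exp.
    + by rewrite eqy.
    + by allneq.
    + by allneq.
    + by apply/subsetP=> v vS; mem.
    + by allneq.
  exists [:: p; y]; split => //=; first by rewrite exp esym eyp.
    by allneq.
  by move=> v; rewrite !inE => /or3P[] /eqP->; mem.
- move=> S p q y h0 [L1 L2] yS h.
  have [[pS qS _] [npq _ _]] := core_in h0.
  have eqy : e q y by rewrite esym h // eqxx.
  split; [|right].
    apply: (linked_post (w := [::]) esym L1) => //=.
    + by rewrite eqy.
    + by allneq.
    + by apply/subsetP=> v vS; mem.
    + by move=> v; rewrite !inE => ->.
  apply: (linked_post (w := [::]) esym L2) => //=.
  + by rewrite eqy.
  + by allneq.
  + by apply/subsetP=> v vS; mem.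
  + by move=> v; rewrite !inE => ->.
- move=> S p q x h0 [L1 L2] xS h.
  have [[pS qS _] [npq _ _]] := core_in h0.
  have exp : e x p by rewrite h // eqxx.
  split; [|right].
    apply: (linked_pre (w := [::]) L1) => //=.
    + by rewrite exp.
    + by allneq.
    + by apply/subsetP=> v vS; mem.
    + by move=> v; rewrite !inE => ->.
  apply: (linked_pre (w := [::]) L2) => //=.
  + by rewrite exp.
  + by allneq.
  + by apply/subsetP=> v vS; mem.
  + by move=> v; rewrite !inE => ->.
- move=> S p q x y a c h0 [L1 L2] ? ? ? ?.
  rewrite /= !inE !negb_or => /and4P[/and3P[? ? ?] /andP[? ?] ? _].
  move=> h1 h2 _ _ exy eax ecy _ _ _.
  have [[pS qS _] [npq _ _]] := core_in h0.
  have exp : e x p by rewrite h1 // eqxx.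
  have eqy : e q y by rewrite esym h2 // eqxx.
  have eyc : e y c by rewrite esym.
  split; [|right].
    apply: (linked_join (w1 := [:: x]) (w2 := [:: y]) esym L1) => //=.
    + by rewrite eax exp.
    + by rewrite eqy eyc.
    + by allneq.
    + by allneq.
    + by apply/subsetP=> v vS; mem.
    + by allneq.
  exists [:: x; y; c]; split => //=; first by rewrite eax exy eyc.
    by allneq.
  by move=> v; rewrite !inE => /or4P[] /eqP->; mem.
Qed.

Definition passes S p q v := exists s,
  [/\ path e p s, last p s = q, uniq (p :: s), {subset p :: s <= S} & v \in p :: s].

Lemma passes_sym S p q v : passes S p q v -> passes S q p v.
Proof.
case=> s [h1 h2 h3 h4 h5].
have E : q :: rev (belast p s) = rev (p :: s) by rewrite [p :: s]lastI h2 rev_rcons.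
exists (rev (belast p s)); split.
- by rewrite -h2 rev_path; apply: sub_path h1 => x y; rewrite esym.
- by rewrite -[last _ _]/(last q (q :: rev (belast p s))) E rev_cons last_rcons.
- by rewrite E rev_uniq.
- by move=> x; rewrite E mem_rev; apply: h4.
- by rewrite E mem_rev.
Qed.

Lemma passes_pre (A B : {set T}) u w v v' z z' :
  passes A v v' z -> path e u (rcons w v) -> uniq (u :: w) ->
  all (fun x => x \notin A) (u :: w) -> A \subset B -> {subset u :: w <= B} ->
  z' \in z :: u :: w -> passes B u v' z'.
Proof.
case=> p [h1 h2 h3 h4 h5] pw uw wA AB wB zz.
exists (rcons w v ++ p); split.
- by rewrite cat_path pw last_rcons.
- by rewrite last_cat last_rcons.
- rewrite cat_rcons -cat_cons cat_uniq uw h3 andbT -all_predC.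
  by apply/allP => x /h4 xA; apply/negP => /(allP wA); rewrite xA.
- move=> x; rewrite cat_rcons -cat_cons mem_cat => /orP[/wB //|/h4].
  by apply: (subsetP AB).
- rewrite cat_rcons -cat_cons mem_cat.
  by move: zz; rewrite inE => /orP[/eqP->|->//]; rewrite h5 orbT.
Qed.

Lemma core_passes r b S p q z : core e r b S p q -> z \in S -> passes S p q z.
Proof.
move=> h; elim: h z => {b S p q}.
- move=> p q h1 h2 h3 h4 h5 h6 z; rewrite !inE => zS.
  exists [:: r; q]; split=> //=; first by rewrite esym h4 h5.
  + by allneq.
  + by move=> v; rewrite /= !inE => /or3P[] /eqP->; mem.
  + by move: zS; rewrite !inE => /orP[/orP[]|] /eqP->; mem.
- move=> S p q x y h0 IH xS yS nxy h1 h2 h3 z zS'.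
  have [[pS qS _] [npq _ _]] := core_in h0.
  have exp : e x p by rewrite h2 // eqxx.
  have eyq : e y q by rewrite h3 // eqxx orbT.
  have P1 z1 : z1 \in S -> passes (x |: S) q x z1.
    move=> /IH P; apply/passes_sym/(passes_pre (w := [::]) P) => //=.
    + by rewrite exp.
    + by allneq.
    + by apply/subsetP=> v vS; mem.
    + by move=> v; rewrite !inE => ->.
    + by rewrite inE eqxx.
  have P2 z1 : z1 \in x |: S -> passes (x |: S) q x z1.
    rewrite inE => /orP[|/P1 //]; rewrite inE => /eqP->.
    have [s [s1 s2 s3 s4 _]] := P1 p pS.
    by exists s; split=> //; rewrite -s2; apply: mem_last.
  have [z2 z2S zz] : exists2 z2, z2 \in x |: S & z \in [:: z2; y].
    move: zS'; rewrite !inE => /or3P[/eqP->|/eqP->|zS].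
    - by exists x; mem.
    - by exists x; mem.
    - by exists z; mem.
  apply: passes_sym; rewrite setUCA.
  apply: (passes_pre (w := [::]) (P2 _ z2S)) => //=.
  + by rewrite eyq.
  + by allneq.
  + by apply/subsetP=> v vS; rewrite !inE in vS *; rewrite vS orbT.
  + by move=> v; rewrite !inE => ->.
- move=> S p q y h0 IH yS h z zS'.
  have [[pS qS _] [npq _ _]] := core_in h0.
  have eyq : e y q by rewrite h // eqxx.
  have [z2 z2S zz] : exists2 z2, z2 \in S & z \in [:: z2; y].
    move: zS'; rewrite !inE => /orP[/eqP->|zS].
    - by exists p; mem.
    - by exists z; mem.
  apply/passes_sym/(passes_pre (w := [::]) (passes_sym (IH _ z2S))) => //=.
  + by rewrite eyq.
  + by allneq.
  + by apply/subsetP=> v vS; mem.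
  + by move=> v; rewrite !inE => ->.
- move=> S p q y h0 IH yS h z zS'.
  have [[pS qS _] [npq _ _]] := core_in h0.
  have eyq : e y p by rewrite h // eqxx.
  have [z2 z2S zz] : exists2 z2, z2 \in S & z \in [:: z2; y].
    move: zS'; rewrite !inE => /orP[/eqP->|zS].
    - by exists p; mem.
    - by exists z; mem.
  apply/(passes_pre (w := [::]) (IH _ z2S)) => //=.
  + by rewrite eyq.
  + by allneq.
  + by apply/subsetP=> v vS; mem.
  + by move=> v; rewrite !inE => ->.
- move=> S p q x y a c h0 IH ? ? ? ?.
  rewrite /= !inE !negb_or => /and4P[/and3P[? ? ?] /andP[? ?] ? _].
  move=> h1 h2 _ _ exy eax ecy _ _ _ z zS'.
  have [[pS qS _] [npq _ _]] := core_in h0.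
  have exp : e x p by rewrite h1 // eqxx.
  have eyq : e y q by rewrite h2 // eqxx.
  have [z2 z2S zz] : exists2 z2, z2 \in x |: (a |: S) & z \in [:: z2; c; y].
    move: zS'; rewrite !inE => /or4P[/eqP->|/eqP->|/eqP->|/orP[/eqP->|zS]].
    - by exists x; mem.
    - by exists x; mem.
    - by exists a; mem.
    - by exists x; mem.
    - by exists z; mem.
  have [z3 z3S zz3] : exists2 z3, z3 \in S & z2 \in [:: z3; a; x].
    move: z2S; rewrite !inE => /or3P[/eqP->|/eqP->|zS].
    - by exists p; mem.
    - by exists p; mem.
    - by exists z2; mem.
  have P1 : passes (x |: (a |: S)) q a z2.
    apply/passes_sym/(passes_pre (w := [:: x]) (IH _ z3S)) => //=.
    + by rewrite eax exp.
    + by allneq.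
    + by allneq.
    + by apply/subsetP=> v vS; mem.
    + by move=> v; rewrite !inE => /orP[]/eqP->; mem.
  apply: passes_sym; apply: (passes_pre (w := [:: y]) P1) => //=.
  + by rewrite ecy eyq.
  + by allneq.
  + by allneq.
  + apply/subsetP=> v; rewrite !inE => /or3P[/eqP->|/eqP->|->]; mem.
  + by move=> v; rewrite !inE => /orP[]/eqP->; mem.
Qed.

(** A terminal path through [v] is cut at [v]. Each half avoids the opposite terminal, which stays
    free for closing cycles outside the core. *)
Lemma core_split r b S p q v : core e r b S p q -> v \in S -> v != p -> v != q ->
  exists j k, [/\ linked e (S :\ q) v p j, linked e (S :\ p) v q k
                & linked e S p q (j + k)].
Proof.
move=> h vS nvp nvq; have [s [h1 h2 h3 h4]] := core_passes h vS.
rewrite inE (negPf nvp) /= => vs; case/splitPr: vs h1 h2 h3 h4 => s1 s2.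
rewrite cat_path last_cat /= => /and3P[p1 ev p2] l2 u h4.
have E : p :: s1 ++ v :: s2 = (p :: rcons s1 v) ++ s2 by rewrite /= cat_rcons.
have [u1 u2] : uniq (p :: rcons s1 v) /\ all (predC (mem (p :: rcons s1 v))) s2.
  have: uniq (p :: s1 ++ v :: s2) by [].
  by rewrite E cat_uniq all_predC => /and3P[].
have nq : q \notin p :: rcons s1 v.
  case: s2 l2 u2 {p2 h4 u E} => [/= l2 _|x s2 l2 u2].
    by rewrite l2 eqxx in nvq.
  by apply: (allP u2 q); rewrite -l2; exact: (mem_last x s2).
have L1 : linked e (S :\ q) p v (size s1).+1.
  exists (rcons s1 v); split.
  - by rewrite rcons_path p1 ev.
  - by rewrite last_rcons.
  - by [].
  - move=> x xs; rewrite !inE h4 ?andbT; first by apply: contraNneq nq => <-.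
    move: xs; rewrite !inE mem_rcons mem_cat inE.
    by case/or3P=> Hx; rewrite !(inE, mem_cat) Hx ?orbT.
  - by rewrite size_rcons.
have L2 : linked e (S :\ p) v q (size s2).
  exists s2; split=> //.
  - by move/andP: u => [_]; rewrite cat_uniq => /and3P[].
  - move=> x xs; rewrite !inE h4 ?andbT.
      apply: contraTneq xs => ->.
      by move/andP: u => []; rewrite mem_cat negb_or => /andP[].
    by rewrite inE mem_cat xs !orbT.
exists (size s1).+1, (size s2); split=> //; first exact: linked_sym.
exists (s1 ++ v :: s2); split=> //.
- by rewrite cat_path p1 /= ev p2.
- by rewrite last_cat.
- by rewrite size_cat /= addSnnS.
Qed.

Lemma reach_twins r S p q x y k : p \in S -> q \in S -> x \notin S -> y \notin S ->
  p != q -> x != y -> e x p -> e y p -> e x q -> e y q -> linked e (S :\ q) r p k ->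
  linked e (x |: (y |: S)) r x k.+1 /\ linked e (x |: (y |: S)) r x k.+3.
Proof.
move=> pS qS xS yS np nx e1 e2 e3 e4 L.
split.
  apply: (linked_post (w := [::]) esym L) => //=.
  + by rewrite esym e1.
  + by allneq.
  + by apply/subsetP=> v; rewrite !inE => /andP[_ ->]; rewrite !orbT.
  + by move=> v; rewrite !inE => ->.
apply: (linked_post (w := [:: y; q]) esym L) => //=.
+ by rewrite esym e2 e4 esym e3.
+ by allneq.
+ by allneq.
+ by apply/subsetP=> v; rewrite !inE => /andP[_ ->]; rewrite !orbT.
+ by move=> v; rewrite /= !inE => /or3P[] /eqP->; mem.
Qed.

(** Two consecutive residues at one terminal become all three residues at both twins by
    [reach_twins]; since the round trip uses the other terminal, avoiding it belongs to the
    invariant. The exception is the initial path, whose completion is the graph $K_{2,3}$. *)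
Lemma core_reach r b S p q : core e r b S p q ->
  if b then [/\ S = [set p; q; r], e r p, e r q & ~~ e p q] \/
    exists j, (linked e (S :\ q) r p j /\ linked e (S :\ q) r p j.+1) \/
              (linked e (S :\ p) r q j /\ linked e (S :\ p) r q j.+1)
  else [/\ linked e S r p 1, linked e S r p 2, linked e S r q 1, linked e S r q 2
        & (core e p false S r q /\ core e q false S p r) \/
          (linked e S r p 0 /\ linked e S r q 0)].
Proof.
elim=> {b S p q}.
- by move=> *; left.
- move=> S p q x y h0 IH xS yS nxy h1 h2 h3.
  have [[pS qS rS] [npq nrp nrq]] := core_in h0.
  have exp : e x p by rewrite h2 // eqxx.
  have eyp : e y p by rewrite h3 // eqxx.
  have exq : e x q by rewrite h2 // eqxx orbT.
  have eyq : e y q by rewrite h3 // eqxx orbT.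
  have nyx : y != x by rewrite eq_sym.
  have nqp : q != p by rewrite eq_sym.
  have sw : y |: (x |: S) = x |: (y |: S) by rewrite setUCA.
  have all3 j (z : T) : linked e (x |: (y |: S)) r z j.+1 ->
      linked e (x |: (y |: S)) r z j.+2 -> linked e (x |: (y |: S)) r z j.+3 ->
      forall i, linked e (x |: (y |: S)) r z i.
    move=> a1 a2 a3 i.
    case: (mod3_cases i j) => [E|[E|E]].
    - exact: linked_mod E a1.
    - exact: linked_mod E a2.
    - exact: linked_mod E a3.
  case: IH => [[ES erp erq nepq]|[j IH]].
  + have K1 : linked e (S :\ q) r p 1 by apply: linked_edge => //; allneq.
    have [A1 A2] := reach_twins pS qS xS yS npq nxy exp eyp exq eyq K1.
    have [] := reach_twins pS qS yS xS npq nyx eyp exp eyq exq K1.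
    rewrite sw => B1 B2.
    have nerx : e x r = false by rewrite h2 // (negPf nrp) (negPf nrq).
    have nery : e y r = false by rewrite h3 // (negPf nrp) (negPf nrq).
    have nry : r != y by neq.
    split=> //.
    (* In $K_{2,3}$ with sides [p], [q] and [r], [x], [y], each vertex of the larger side can serve
       as the middle of the initial path. *)
    left; split.
      have -> : x |: (y |: S) = r |: (y |: [set p; q; x]).
        apply/setP=> v; rewrite ES !inE.
        by case: (v == x) (v == y) (v == r) (v == p) (v == q) => [] [] [] [] [].
      apply: core_twins.
      * by apply: core_base => //; neq.
      * by allneq.
      * by allneq.
      * by [].
      * by rewrite esym nery.
      * move=> v; rewrite !inE => /orP[/orP[]|] /eqP->; rewrite ?erp ?erq ?eqxx ?orbT //.
        by rewrite esym nerx; symmetry; apply/norP; split; neq.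
      * move=> v; rewrite !inE => /orP[/orP[]|] /eqP->; rewrite ?eyp ?eyq ?eqxx ?orbT //.
        by rewrite esym (negPf h1); symmetry; apply/norP; split; neq.
    have -> : x |: (y |: S) = x |: (r |: [set p; q; y]).
      apply/setP=> v; rewrite ES !inE.
      by case: (v == x) (v == y) (v == r) (v == p) (v == q) => [] [] [] [] [].
    apply: core_twins.
    * by apply: core_base => //; neq.
    * by allneq.
    * by allneq.
    * by neq.
    * by rewrite nerx.
    * move=> v; rewrite !inE => /orP[/orP[]|] /eqP->; rewrite ?exp ?exq ?eqxx ?orbT //.
      by rewrite (negPf h1); symmetry; apply/norP; split; neq.
    * move=> v; rewrite !inE => /orP[/orP[]|] /eqP->; rewrite ?erp ?erq ?eqxx ?orbT //.
      by rewrite esym nery; symmetry; apply/norP; split; neq.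
  + suff H : forall i, linked e (x |: (y |: S)) r x i /\ linked e (x |: (y |: S)) r y i.
      have [? ?] := H 0; have [? ?] := H 1; have [? ?] := H 2.
      by split=> //; right.
    have [p' [q' [P1 Q1 np e1 [e2 e3 e4 L1 L2]]]] : exists p' q',
      [/\ p' \in S, q' \in S, p' != q', e x p' &
       [/\ e y p', e x q', e y q', linked e (S :\ q') r p' j & linked e (S :\ q') r p' j.+1]].
      by case: IH => [[L1 L2]|[L1 L2]]; [exists p, q|exists q, p].
    have [A1 A3] := reach_twins P1 Q1 xS yS np nxy e1 e2 e3 e4 L1.
    have [A2 _] := reach_twins P1 Q1 xS yS np nxy e1 e2 e3 e4 L2.
    have [] := reach_twins P1 Q1 yS xS np nyx e2 e1 e4 e3 L1.
    have [] := reach_twins P1 Q1 yS xS np nyx e2 e1 e4 e3 L2.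
    by rewrite sw => B2 _ B1 B3 i; split; apply: (all3 j).
(* The paths of residues 1 and 2 from [r] to [p] stay in [S] and therefore avoid the new terminal
   [y]. *)
- move=> S p q y h0 [L1 L2 _ _ _] yS h; right; exists 1; left.
  have sub : S \subset (y |: S) :\ y.
    apply/subsetP=> v vS; rewrite !inE vS orbT andbT; neq.
  by split; [apply: linked_sub L1|apply: linked_sub L2].
- move=> S p q x h0 [_ _ L1 L2 _] xS h; right; exists 1; right.
  have sub : S \subset (x |: S) :\ x.
    apply/subsetP=> v vS; rewrite !inE vS orbT andbT; neq.
  by split; [apply: linked_sub L1|apply: linked_sub L2].
(* The paths of residues 1 and 2 to [p], prolonged by [x] and [a], get residues 0 and 1. *)
- move=> S p q x y a c h0 [L1 L2 _ _ _] ? ? ? ?.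
  rewrite /= !inE !negb_or => /and4P[/and3P[? ? ?] /andP[? ?] ? _].
  move=> h1 h2 _ _ exy eax ecy _ _ _; right; exists 0; left.
  have [[pS qS _] [npq _ _]] := core_in h0.
  have exp : e p x by rewrite esym h1 // eqxx.
  have exa : e x a by rewrite esym.
  have sub : S \subset (x |: (y |: (a |: (c |: S)))) :\ c.
    by apply/subsetP=> v vS; rewrite !inE vS !orbT andbT; neq.
  split.
  + apply: (linked_post (w := [:: x]) esym L1) => //=.
    * by rewrite exp exa.
    * by allneq.
    * by allneq.
    * by move=> v; rewrite !inE => /orP[] /eqP->; mem; neq.
  + apply: (linked_post (w := [:: x]) esym L2) => //=.
    * by rewrite exp exa.
    * by allneq.
    * by allneq.
    * by move=> v; rewrite !inE => /orP[] /eqP->; mem; neq.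
Qed.
End Core.

(** * Degrees in cores *)

Definition dg (T : finType) (e : rel T) (S : {set T}) (v : T) : nat :=
  \sum_(u in S) e v u.

Section Degree.
Variables (T : finType) (e : rel T).
Hypotheses (esym : symmetric e) (eirr : irreflexive e).
Implicit Types (S : {set T}) (r p q x : T).

Lemma deg_dg v : deg e v = dg e setT v.
Proof.
rewrite /deg /dg -sum1_card big_mkcond [RHS]big_mkcond /=.
by apply: eq_bigr => u _; rewrite !inE; case: (e v u).
Qed.

Lemma dgU1 S x v : x \notin S -> dg e (x |: S) v = e v x + dg e S v.
Proof. by move=> xS; rewrite /dg big_setU1. Qed.

Lemma dg_subset S (A : {set T}) v : S \subset A ->
  (forall u, u \in A -> e v u -> u \in S) -> dg e A v = dg e S v.
Proof.
move=> /subsetP sub H; rewrite /dg big_mkcond [RHS]big_mkcond; apply: eq_bigr => u _.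
have := sub u; have := H u; case: (u \in S) (u \in A) (e v u) => [] [] [] //.
  by move=> _ /(_ isT).
by move=> /(_ isT isT).
Qed.

Lemma dg_mem0 S x : {in S, forall v, e x v = false} -> dg e S x = 0.
Proof. by move=> h; rewrite /dg big1 // => v vS; rewrite h. Qed.

Lemma dg_mem1 S x p : p \in S -> {in S, forall v, e x v = (v == p)} -> dg e S x = 1.
Proof.
move=> pS h; rewrite /dg (bigD1 p) //= h // eqxx big1 // => v /andP[vS vp].
by rewrite h // (negPf vp).
Qed.

Lemma dg_mem2 S x p q : p \in S -> q \in S -> p != q ->
  {in S, forall v, e x v = (v == p) || (v == q)} -> dg e S x = 2.
Proof.
move=> pS qS npq h; rewrite /dg (bigD1 p) //= (bigD1 q) /= 1?eq_sym ?npq ?qS //.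
rewrite !h // !eqxx orbT big1 // => v /andP[/andP[vS vp] vq].
by rewrite h // (negPf vp) (negPf vq).
Qed.

(** New vertices are attached to terminals only. A terminal of a finished stage ends with degree 3
    if a pendant is put on it; a terminal of a started stage gains the two twins, and reaches degree
    4 exactly when it already had degree 2. *)
Lemma core_dg r b S p q : core e r b S p q -> {in S, forall v,
  if v == r then dg e S v == 2 else
  if (v == p) || (v == q) then (if b then 1 <= dg e S v <= 2 else dg e S v == 2)
  else 3 <= dg e S v <= 4}.
Proof.
elim=> {b S p q}.
- move=> p q npq nrp nrq erp erq nepq v vS.
  have D u : dg e [set p; q; r] u = e u p + (e u q + e u r).
    have -> : [set p; q; r] = p |: (q |: [set r]) by rewrite setUA.
    rewrite !dgU1; try by allneq.
    by rewrite /dg big_set1.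
  rewrite !D; move: vS; rewrite !inE => /orP[/orP[]|] /eqP->.
  + by rewrite eirr (negPf nepq) [p == r]eq_sym (negPf nrp) eqxx esym erp.
  + by rewrite eirr esym (negPf nepq) [q == r]eq_sym (negPf nrq) eqxx orbT esym erq.
  + by rewrite eqxx eirr erp erq.
- move=> S p q x y h0 IH xS yS nxy h1 h2 h3 v vS.
  have [[pS qS rS] [npq nrp nrq]] := core_in h0.
  have nxr : x != r by neq.
  have nyr : y != r by neq.
  rewrite !dgU1; try by allneq.
  move: vS; rewrite !inE => /or3P[/eqP->|/eqP->|vS].
  + by rewrite eirr (negPf h1) eqxx (negPf nxr) (dg_mem2 pS qS npq h2).
  + by rewrite eirr esym (negPf h1) eqxx (negPf nyr) orbT (dg_mem2 pS qS npq h3).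
  + have -> : v == x = false by apply/negbTE; neq.
    have -> : v == y = false by apply/negbTE; neq.
    rewrite esym h2 // esym h3 //=; have := IH v vS.
    case: eqP => [->|_]; first by rewrite (negPf nrp) (negPf nrq).
    by case: (v == p) (v == q) => [] [] /=; clear; lia.
- move=> S p q y h0 IH yS h v vS.
  have [[pS qS rS] [npq nrp nrq]] := core_in h0.
  have nyr : y != r by neq.
  rewrite !dgU1 //; move: vS; rewrite !inE => /orP[/eqP->|vS].
  + by rewrite eirr eqxx orbT (negPf nyr) (dg_mem1 qS h).
  + have -> : v == y = false by apply/negbTE; neq.
    rewrite esym h // orbF; have := IH v vS.
    case: eqP => [->|_]; first by rewrite (negPf nrq).
    case: eqP => [->|_] /=; first by rewrite (negPf npq) => /eqP->.
    by case: eqP => _ /=; clear; lia.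
- move=> S p q y h0 IH yS h v vS.
  have [[pS qS rS] [npq nrp nrq]] := core_in h0.
  have nyr : y != r by neq.
  rewrite !dgU1 //; move: vS; rewrite !inE => /orP[/eqP->|vS].
  + by rewrite eirr eqxx (negPf nyr) (dg_mem1 pS h).
  + have -> : v == y = false by apply/negbTE; neq.
    rewrite esym h //=; have := IH v vS.
    case: eqP => [->|_]; first by rewrite (negPf nrp).
    rewrite orbC; case: eqP => [->|_] /=; first by rewrite [q == p]eq_sym (negPf npq) => /eqP->.
    by case: eqP => _ /=; clear; lia.
- move=> S p q x y a c h0 IH xS yS aS cS.
  rewrite /= !inE !negb_or => /and4P[/and3P[nxy nxa nxc] /andP[nya nyc] nac _].
  move=> h1 h2 h3 h4 exy eax ecy neay necx neac v vS.
  have [[pS qS rS] [npq nrp nrq]] := core_in h0.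
  have nr u : u \notin S -> (u == r) = false by move=> uS; apply/negbTE; neq.
  rewrite !dgU1; try by allneq.
  move: vS; rewrite !inE => /or4P[/eqP->|/eqP->|/eqP->|/orP[/eqP->|vS]].
  + rewrite eirr exy esym eax [e x c]esym (negPf necx) (dg_mem1 pS h1) nr //.
    by rewrite (negPf nxa) (negPf nxc).
  + rewrite eirr esym exy [e y a]esym (negPf neay) esym ecy (dg_mem1 qS h2) nr //.
    by rewrite (negPf nya) (negPf nyc).
  + by rewrite eirr eax (negPf neay) (negPf neac) (dg_mem0 h3) nr // eqxx.
  + rewrite eirr (negPf necx) ecy [e c a]esym (negPf neac) (dg_mem0 h4) nr //.
    by rewrite eqxx orbT.
  + have -> : v == a = false by apply/negbTE; neq.
    have -> : v == c = false by apply/negbTE; neq.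
    rewrite !(esym v) h1 // h2 // h3 // h4 //; have := IH v vS.
    case: eqP => [->|_]; first by rewrite (negPf nrp) (negPf nrq).
    case: eqP => [->|_] /=; first by rewrite (negPf npq); clear; lia.
    by case: eqP => _ /=; clear; lia.
Qed.
End Degree.

(* The residues with which a terminal [s] reaches the neighbours of a vertex [z] of degree
   4: they show that [z] is not the result of the contraction in [merge_exc]. *)
Definition fan (T : finType) (e : rel T) (S : {set T}) (s z : T) : Prop :=
  exists p q u1 u2 k, [/\ uniq [:: p; q; u1; u2],
    {in S, forall v, e z v = (v \in [:: p; q; u1; u2])},
    linked e (S :\ z) s p k /\ linked e (S :\ z) s p k.+2,
    linked e (S :\ z) s q k /\ linked e (S :\ z) s q k.+2 &
    linked e (S :\ z) s u1 k /\ linked e (S :\ z) s u2 k.+2].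

Section Fan.
Variables (T : finType) (e : rel T).
Hypotheses (esym : symmetric e) (eirr : irreflexive e).
Implicit Types (S : {set T}) (r p q x : T).

Lemma core_false_inv r S x y : core e r false S x y -> exists S0 p q,
  [/\ S = x |: (y |: S0), core e r true S0 p q, x \notin S0, y \notin S0 &
  [/\ x != y, ~~ e x y, {in S0, forall v, e x v = (v == p) || (v == q)}
    & {in S0, forall v, e y v = (v == p) || (v == q)}]].
Proof.
move E: false => b h; case: h E => // S0 p q x' y' *.
by exists S0, p, q.
Qed.

(** A pendant, or a terminal made by the 4-cycle step, has degree 1, and so have the ends of the
    initial path. A terminal of degree 2 is thus an old twin whose partner received the pendant
    [q]. *)
Lemma core_true_inv r S p q : core e r true S p q -> dg e S p = 2 ->
  exists S0 t, [/\ S = q |: S0, core e r false S0 p t, q \notin S0 &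
                   {in S0, forall v, e q v = (v == t)}].
Proof.
move E: true => b h; have := core_dg esym eirr h; have := core_in h.
case: h E => //.
- move=> p' q' n1 n2 n3 e1 e2 e3 _ _ _.
  have -> : [set p'; q'; r] = p' |: (q' |: [set r]) by rewrite setUA.
  rewrite !dgU1; try by allneq.
  by rewrite eirr (negPf e3) /dg big_set1; case: (e p' r).
- by move=> S0 p' q' y h0 yS h _ _ _ _; exists S0, q'.
- move=> S0 p' q' x h0 xS h _ _ _.
  have [[pS _ _] _] := core_in h0.
  by rewrite dgU1 // eirr (dg_mem1 pS h).
- move=> S0 p' q' x y a c h0 xS yS aS cS.
  rewrite /= !inE !negb_or => /and4P[/and3P[nxy nxa nxc] /andP[nya nyc] nac _].
  move=> h1 h2 h3 h4 exy eax ecy neay necx neac _ _ _.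
  rewrite !dgU1; try by allneq.
  by rewrite eax (negPf neay) eirr (negPf neac) (dg_mem0 h3).
Qed.

(** Prolonging all paths at their start shifts every residue by the same amount, so the pattern of a
    fan survives with another [k]. *)
Lemma fan_shift S S' s s' w z : fan e S s z -> z \in S -> S \subset S' ->
  (forall v, v \in S' -> v \notin S -> e z v = false) ->
  path e s' (rcons w s) -> uniq (s' :: w) -> all (fun x => x \in S' :\: S) (s' :: w) ->
  fan e S' s' z.
Proof.
move=> [p [q [u1 [u2 [j [U N [p1 p2] [q1 q2] [a1 a2]]]]]]] zS SS H pw uw aw.
set k := (size w).+1.
have sh g i : linked e (S :\ z) s g i -> linked e (S' :\ z) s' g (k + i).
  move=> L; apply: (linked_pre L pw uw).
  - apply/allP=> x /(allP aw); rewrite !inE => /andP[h _].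
    by rewrite (negPf h) andbF.
  - exact: setSD.
  - move=> x /(allP aw); rewrite !inE => /andP[h ->]; rewrite andbT.
    by apply: contraNneq h => ->.
  - by rewrite addSn.
exists p, q, u1, u2, (k + j); split=> //.
- move=> v vS'; case vS: (v \in S); first exact: N.
  rewrite H ?vS //; symmetry; apply/negbTE; apply: contraFN vS => v4.
  have G g i : linked e (S :\ z) s g i -> g \in S.
    by case/linked_in/andP => _; rewrite inE => /andP[].
  move: v4; rewrite !inE => /or4P[]/eqP->; [exact: (G _ _ p1)|exact: (G _ _ q1)|
    exact: (G _ _ a1)|exact: (G _ _ a2)].
- by rewrite -!addnS; split; apply: sh.
- by rewrite -!addnS; split; apply: sh.
- by rewrite -!addnS; split; apply: sh.
Qed.

Lemma fan_sub S S' s z : fan e S s z -> z \in S -> S \subset S' ->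
  (forall v, v \in S' -> v \notin S -> e z v = false) -> fan e S' s z.
Proof.
move=> [p [q [u1 [u2 [j [U N [p1 p2] [q1 q2] [a1 a2]]]]]]] zS SS H.
have sh g i : linked e (S :\ z) s g i -> linked e (S' :\ z) s g i.
  by apply: linked_sub; apply: setSD.
exists p, q, u1, u2, j; split=> //; try by split; apply: sh.
move=> v vS'; case vS: (v \in S); first exact: N.
rewrite H ?vS //; symmetry; apply/negbTE; apply: contraFN vS => v4.
have G g i : linked e (S :\ z) s g i -> g \in S.
  by case/linked_in/andP => _; rewrite inE => /andP[].
move: v4; rewrite !inE => /or4P[]/eqP->; [exact: (G _ _ p1)|exact: (G _ _ q1)|
  exact: (G _ _ a1)|exact: (G _ _ a2)].
Qed.

(** This is where degree 4 is created: [p] was a twin with neighbours [p0], [q0] and now also gets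
    [x], [y]. Starting from [x] and avoiding [p], the residue is 0 at [x] itself and 2 at [y]
    through [q]. The vertex [p0] is reached along [x q t p0] with residue 0, and along [x q t q0]
    followed by a path of the inner core with residue 2; likewise [q0]. *)
Lemma fan_twins r S p q x y : core e r true S p q -> dg e S p = 2 ->
  x \notin S -> y \notin S -> x != y -> ~~ e x y ->
  {in S, forall v, e x v = (v == p) || (v == q)} ->
  {in S, forall v, e y v = (v == p) || (v == q)} ->
  fan e (x |: (y |: S)) x p.
Proof.
move=> h0 d2 xS yS nxy exy h1 h2.
have [S0 [t [ES h3 qS0 hq]]] := core_true_inv h0 d2.
have [S1 [p0 [q0 [ES0 h4 pS1 tS1 [npt ept h5 h6]]]]] := core_false_inv h3.
have [[pS qS rS] [npq nrp nrq]] := core_in h0.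
have [[p0S q0S rS1] [np0 _ _]] := core_in h4.
have [L0 _] := core_len esym h4.
have M v : v \in S1 -> v \in S by rewrite ES ES0 !inE => ->; rewrite !orbT.
have xS1 : x \notin S1 by apply: contra xS; exact: M.
have tS : t \in S by rewrite ES ES0 !inE eqxx !orbT.
have tS0 : t \in S0 by rewrite ES0 !inE eqxx orbT.
have qS1 : q \notin S1 by apply: contra qS0; rewrite ES0 !inE => ->; rewrite !orbT.
have exp : e x p by rewrite h1 // eqxx.
have eyp : e y p by rewrite h2 // eqxx.
have exq : e x q by rewrite h1 // eqxx orbT.
have eyq : e y q by rewrite h2 // eqxx orbT.
have eqt : e q t by rewrite hq // eqxx.
have etp0 : e t p0 by rewrite h6 // eqxx.
have etq0 : e t q0 by rewrite h6 // eqxx orbT.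
have p0S' := M _ p0S.
have q0S' := M _ q0S.
have short g : g \in S1 -> e t g -> linked e ((x |: (y |: S)) :\ p) x g 0.
  move=> gS etg; have gS' := M _ gS.
  exists [:: q; t; g]; split=> //=.
  - by rewrite exq eqt etg.
  - by allneq.
  - by move=> v; rewrite !inE => /or4P[] /eqP->; allneq.
have long g g' : e t g -> linked e S1 g g' 2 -> linked e ((x |: (y |: S)) :\ p) x g' 2.
  move=> etg L; apply: (linked_pre (w := [:: q; t]) L) => //=.
  - by rewrite exq eqt etg.
  - by allneq.
  - by allneq.
  - apply/subsetP=> v vS1; have vS := M _ vS1; allneq.
  - by move=> v; rewrite !inE => /or3P[] /eqP->; allneq.
exists p0, q0, x, y, 0; split.
- by allneq.
- move=> v; rewrite !inE => /or3P[/eqP->|/eqP->|].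
  + by rewrite esym exp eqxx !orbT.
  + by rewrite esym eyp eqxx !orbT.
  + move=> vS; have -> : v == x = false by apply/negbTE; neq.
    have -> : v == y = false by apply/negbTE; neq.
    rewrite !orbF; move: vS; rewrite ES ES0 !inE => /or4P[/eqP->|/eqP->|/eqP->|vS1].
    * rewrite esym hq ?ES0 ?inE ?eqxx // (negPf npt).
      by symmetry; apply/norP; split; neq.
    * by rewrite eirr; symmetry; apply/norP; split; neq.
    * by rewrite (negPf ept); symmetry; apply/norP; split; neq.
    * by rewrite h5.
- split; first by apply: short.
  by apply: (long q0) => //; apply: linked_sym.
- split; first by apply: short.
  by apply: (long p0).
- split; first by apply: linked_refl; allneq.
  exists [:: q; y]; split=> //=.
  - by rewrite exq esym eyq.
  - by allneq.
  - by move=> v; rewrite !inE => /or3P[] /eqP->; allneq.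
Qed.

(** A vertex gets degree 4 only when twins are attached to a terminal of degree 2. Later steps take
    place at the terminals and merely lengthen the paths of its fan. *)
Lemma core_fan r b S s t z : core e r b S s t -> z \in S -> z != s -> z != t ->
  dg e S z = 4 -> fan e S s z /\ fan e S t z.
Proof.
move=> h; elim: h z => {b S s t}.
- move=> p q n1 n2 n3 h1 h2 h3 z.
  rewrite !inE => /orP[/orP[]|] /eqP->; rewrite ?eqxx // => _ _.
  have h : core e r true [set p; q; r] p q by apply: core_base.
  have := core_dg esym eirr h; move/(_ r); rewrite eqxx => H.
  by rewrite (eqP (H _)) // !inE eqxx orbT.
- move=> S p q x y h0 IH xS yS nxy exy h1 h2 z.
  have [[pS qS rS] [npq nrp nrq]] := core_in h0.
  have sw : y |: (x |: S) = x |: (y |: S) by rewrite setUCA.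
  have nyx : y != x by rewrite eq_sym.
  have eyx : ~~ e y x by rewrite esym.
  rewrite !inE => /or3P[-> //|-> //|zS] nzx nzy.
  rewrite !dgU1; try by allneq.
  rewrite esym h1 // esym h2 //; case: (eqVneq z p) => [->|nzp].
    move=> d4.
    have d2 : dg e S p = 2 by move: d4 => /=; clear; lia.
    split; first exact: fan_twins h0 d2 _ _ _ _ _ _.
    by rewrite -sw; apply: fan_twins h0 d2 _ _ _ _ _ _.
  case: (eqVneq z q) => [->|nzq].
    move=> d4.
    have d2 : dg e S q = 2 by move: d4 => /=; clear; lia.
    have h0' := core_swap esym h0.
    have h1' : {in S, forall v, e x v = (v == q) || (v == p)}.
      by move=> v vS; rewrite orbC h1.
    have h2' : {in S, forall v, e y v = (v == q) || (v == p)}.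
      by move=> v vS; rewrite orbC h2.
    split; first exact: fan_twins h0' d2 _ _ _ _ _ _.
    by rewrite -sw; apply: fan_twins h0' d2 _ _ _ _ _ _.
  rewrite !add0n => d4.
  have [F _] := IH z zS nzp nzq d4.
  have exp : e x p by rewrite h1 // eqxx.
  have eyp : e y p by rewrite h2 // eqxx.
  have sub : S \subset x |: (y |: S).
    by apply/subsetP=> v vS; mem.
  have H v : v \in x |: (y |: S) -> v \notin S -> e z v = false.
    rewrite !inE => /or3P[/eqP->|/eqP->|-> //] _; rewrite esym ?h1 ?h2 //.
      by rewrite (negPf nzp) (negPf nzq).
    by rewrite (negPf nzp) (negPf nzq).
  split.
    apply: (fan_shift (w := [::]) F zS sub H) => //=; first by rewrite exp.
    by allneq.
  apply: (fan_shift (w := [::]) F zS sub H) => //=; first by rewrite eyp.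
  by allneq.
- move=> S p q y h0 IH yS h z.
  have [[pS qS rS] [npq nrp nrq]] := core_in h0.
  rewrite !inE => /orP[-> //|zS] nzp nzy.
  rewrite !dgU1 // esym h //; case: (eqVneq z q) => [->|nzq].
    have := core_dg esym eirr h0 qS.
    by rewrite eq_sym (negPf nrq) eqxx orbT => /eqP->.
  rewrite add0n => d4; have [F1 F2] := IH z zS nzp nzq d4.
  have eyq : e y q by rewrite h // eqxx.
  have sub : S \subset y |: S.
    by apply/subsetP=> v vS; mem.
  have H v : v \in y |: S -> v \notin S -> e z v = false.
    by rewrite !inE => /orP[/eqP->|-> //] _; rewrite esym h // (negPf nzq).
  split; first exact: fan_sub F1 _ _ _.
  apply: (fan_shift (w := [::]) F2 zS sub H) => //=; first by rewrite eyq.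
  by allneq.
- move=> S p q y h0 IH yS h z.
  have [[pS qS rS] [npq nrp nrq]] := core_in h0.
  rewrite !inE => /orP[-> //|zS] nzy nzq.
  rewrite !dgU1 // esym h //; case: (eqVneq z p) => [->|nzp].
    have := core_dg esym eirr h0 pS.
    by rewrite eq_sym (negPf nrp) eqxx => /eqP->.
  rewrite add0n => d4; have [F1 F2] := IH z zS nzp nzq d4.
  have eyq : e y p by rewrite h // eqxx.
  have sub : S \subset y |: S.
    by apply/subsetP=> v vS; mem.
  have H v : v \in y |: S -> v \notin S -> e z v = false.
    by rewrite !inE => /orP[/eqP->|-> //] _; rewrite esym h // (negPf nzp).
  split; last exact: fan_sub F2 _ _ _.
  apply: (fan_shift (w := [::]) F1 zS sub H) => //=; first by rewrite eyq.
  by allneq.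
- move=> S p q x y a c h0 IH xS yS aS cS.
  rewrite /= !inE !negb_or => /and4P[/and3P[nxy nxa nxc] /andP[nya nyc] nac _].
  move=> h1 h2 h3 h4 exy eax ecy neay necx neac z.
  have [[pS qS rS] [npq nrp nrq]] := core_in h0.
  rewrite !dgU1; try by allneq.
  rewrite !inE => /or4P[/eqP->|/eqP->|-> //|/orP[-> //|zS]] nza nzc.
  + by rewrite eirr exy esym eax [e x c]esym (negPf necx) (dg_mem1 pS h1).
  + by rewrite eirr esym exy [e y a]esym (negPf neay) esym ecy (dg_mem1 qS h2).
  rewrite !(esym z) h1 // h2 // h3 // h4 //.
  case: (eqVneq z p) => [->|nzp].
    have := core_dg esym eirr h0 pS.
    by rewrite eq_sym (negPf nrp) eqxx (negPf npq) => /eqP->.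
  case: (eqVneq z q) => [->|nzq].
    have := core_dg esym eirr h0 qS.
    by rewrite eq_sym (negPf nrq) eqxx orbT => /eqP->.
  rewrite !add0n => d4; have [F1 F2] := IH z zS nzp nzq d4.
  have exp : e x p by rewrite h1 // eqxx.
  have eyq : e y q by rewrite h2 // eqxx.
  have sub : S \subset x |: (y |: (a |: (c |: S))).
    by apply/subsetP=> v vS; mem.
  have H v : v \in x |: (y |: (a |: (c |: S))) -> v \notin S -> e z v = false.
    rewrite !inE => /or4P[/eqP->|/eqP->|/eqP->|/orP[/eqP->|-> //]] _; rewrite esym.
    - by rewrite h1 // (negPf nzp).
    - by rewrite h2 // (negPf nzq).
    - by rewrite h3.
    - by rewrite h4.
  split.
    apply: (fan_shift (w := [:: x]) F1 zS sub H) => //=; first by rewrite eax exp.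
      by allneq.
    by allneq.
  apply: (fan_shift (w := [:: y]) F2 zS sub H) => //=; first by rewrite ecy eyq.
    by allneq.
  by allneq.
Qed.
End Fan.

(** * Exceptional graphs up to isolated vertices *)

Definition spans (T : finType) (e : rel T) (V : {set T}) : Prop :=
  forall u v, e u v -> u \in V.

Definition supp (T : finType) (e : rel T) : {set T} := [set v | [exists u, e v u]].

(* Both predicates ignore isolated vertices of [e]. The final pair [p], [q] of the
   construction is nonadjacent in [exc_twin], and adjacent in [exc_adj]. *)
Definition exc_twin (T : finType) (e : rel T) (r p q : T) : Prop :=
  exists S s t, [/\ core e r true S s t, p \notin S, q \notin S, p != q &
    [/\ forall v, e p v = (v == s) || (v == t),
        forall v, e q v = (v == s) || (v == t) & spans e (p |: (q |: S))]].

Definition exc_adj (T : finType) (e : rel T) (r p q : T) : Prop :=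
  exists S s t, [/\ core e r false S s t, p \notin S, q \notin S, p != q &
    [/\ forall v, e p v = (v == q) || (v == s),
        forall v, e q v = (v == p) || (v == t) & spans e (p |: (q |: S))]].

Definition exc (T : finType) (e : rel T) (r p q : T) : Prop :=
  exc_twin e r p q \/ exc_adj e r p q.

Section Exc.
Variables (T : finType) (e : rel T).
Hypotheses (esym : symmetric e) (eirr : irreflexive e).
Implicit Types (S V : {set T}) (r p q x : T).

Lemma suppP v : reflect (exists u, e v u) (v \in supp e).
Proof. by rewrite inE; apply: existsP. Qed.

Lemma linked_supp A u v k : u != v -> linked e A u v k -> linked e (supp e) u v k.
Proof.
move=> nuv [p [h1 h2 h3 h4 h5]]; exists p; split=> // x.
have suppr a b : e a b -> (a \in supp e) && (b \in supp e).
  by move=> ab; apply/andP; split; apply/suppP; [exists b|exists a; rewrite esym].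
have {h3 h4 h5} all_p y s : path e y s -> {subset s <= supp e}.
  elim: s y => //= z s IH y /andP[yz pz] w; rewrite inE => /orP[/eqP->|].
    by case/andP: (suppr _ _ yz).
  exact: IH pz w.
rewrite inE => /orP[/eqP->|]; last exact: all_p h1 x.
case: p h1 h2 => [_ /= E|y p /=]; first by rewrite E eqxx in nuv.
by move=> /andP[uy _] _; case/andP: (suppr _ _ uy).
Qed.

Lemma spans_deg V v : spans e V -> deg e v = dg e V v.
Proof.
move=> sp; rewrite deg_dg; apply: dg_subset; first exact: subsetT.
by move=> u _; rewrite esym; apply: sp.
Qed.

Lemma spans_out V v : spans e V -> v \notin V -> deg e v = 0.
Proof.
move=> sp vV; rewrite deg_dg /dg big1 // => u _.
by case E: (e v u) => //; rewrite (sp _ _ E) in vV.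
Qed.

Lemma exc_twin_core r p q : exc_twin e r p q -> exists2 S, core e r false S p q & spans e S.
Proof.
case=> S [s [t [h pS qS npq [hp hq sp]]]]; have [[sS tS _] _] := core_in h.
exists (p |: (q |: S)) => //; apply: (core_twins h pS qS npq).
- by rewrite hp; apply/norP; split; neq.
- by move=> v _; apply: hp.
- by move=> v _; apply: hq.
Qed.

Lemma core_exc_twin r S p q : core e r false S p q -> spans e S -> exc_twin e r p q.
Proof.
case/core_false_inv=> S0 [s [t [ES h pS qS [npq epq hp hq]]]] sp.
have [[sS tS _] _] := core_in h.
exists S0, s, t; split=> //; rewrite -ES; split=> // v.
- case vS: (v \in S0); first exact: hp.
  have -> : v == s = false by apply: contraFF vS => /eqP->.
  have -> : v == t = false by apply: contraFF vS => /eqP->.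
  apply: contraFF vS => epv; have := sp v p; rewrite esym epv => /(_ isT).
  rewrite ES !inE => /or3P[/eqP E|/eqP E|//]; first by rewrite E eirr in epv.
  by rewrite E (negPf epq) in epv.
- case vS: (v \in S0); first exact: hq.
  have -> : v == s = false by apply: contraFF vS => /eqP->.
  have -> : v == t = false by apply: contraFF vS => /eqP->.
  apply: contraFF vS => epv; have := sp v q; rewrite esym epv => /(_ isT).
  rewrite ES !inE => /or3P[/eqP E|/eqP E|//]; last by rewrite E eirr in epv.
  by rewrite E esym (negPf epq) in epv.
Qed.

Lemma exc_swap r p q : exc e r p q -> exc e r q p.
Proof.
case=> [h|[S [s [t [h pS qS npq [hp hq sp]]]]]].
  left; have [S h1 h2] := exc_twin_core h.
  by apply: core_exc_twin (core_swap esym h1) h2.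
right; exists S, t, s; split=> //; first exact: core_swap.
  by rewrite eq_sym.
by split=> //; rewrite setUCA.
Qed.

Lemma exc_deg r p q : exc e r p q -> [/\ uniq [:: r; p; q],
  forall v, (deg e v == 2) = (v \in [:: r; p; q]) & forall v, deg e v <= 4].
Proof.
case=> [/exc_twin_core[S h sp]|[S [s [t [h pS qS npq [hp hq sp]]]]]].
  have [[pS qS rS] [npq nrp nrq]] := core_in h.
  split; first by allneq.
    move=> v; case vS: (v \in S); last first.
      rewrite (spans_out sp) ?vS // !inE; symmetry; apply/negbTE.
      by apply: contraFN vS => /or3P[] /eqP->.
    have := core_dg esym eirr h vS; rewrite (spans_deg v sp) !inE.
    case: (v == r) => /=; first by move->.
    by case: ifP => _; [move-> | clear; lia].
  move=> v; case vS: (v \in S); last by rewrite (spans_out sp) ?vS.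
  have := core_dg esym eirr h vS; rewrite (spans_deg v sp).
  case: (v == r); first by move/eqP->.
  by case: ifP => _; [move/eqP-> | case/andP].
have [[sS tS rS] [nst nrs nrt]] := core_in h.
have epq : e p q by rewrite hp eqxx.
have Dp : deg e p = 2.
  rewrite (spans_deg p sp) !dgU1; try by allneq.
  rewrite eirr epq (dg_mem1 sS) // => v vS.
  by rewrite hp; have -> : v == q = false by apply/negbTE; neq.
have Dq : deg e q = 2.
  rewrite (spans_deg q sp) !dgU1; try by allneq.
  rewrite eirr esym epq (dg_mem1 tS) // => v vS.
  by rewrite hq; have -> : v == p = false by apply/negbTE; neq.
have DS v : v \in S -> if v == r then deg e v == 2 else 3 <= deg e v <= 4.
  move=> vS; rewrite (spans_deg v sp) !dgU1; try by allneq.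
  have nvp : v == p = false by apply/negbTE; neq.
  have nvq : v == q = false by apply/negbTE; neq.
  have := core_dg esym eirr h vS; rewrite ![e v _]esym hp hq nvp nvq /=.
  case: eqP => [->|_]; first by rewrite (negPf nrs) (negPf nrt).
  case: eqP => [->|_]; first by rewrite (negPf nst) => /eqP->.
  by case: eqP => [->|_] //= /eqP->.
split; first by allneq.
- move=> v; case vS: (v \in S).
    have := DS v vS; rewrite !inE.
    have -> : v == p = false by apply/negbTE; neq.
    have -> : v == q = false by apply/negbTE; neq.
    by case: (v == r) => //=; clear; lia.
  rewrite !inE; case: (eqVneq v p) => [->|nvp]; first by rewrite Dp orbT.
  case: (eqVneq v q) => [->|nvq]; first by rewrite Dq !orbT.
  have -> : v == r = false by apply: contraFF vS => /eqP->.
  by rewrite (spans_out sp) // !inE (negPf nvp) (negPf nvq) vS.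
- move=> v; case vS: (v \in S).
    have := DS v vS; by case: (v == r) => [/eqP->|/andP[]].
  case: (eqVneq v p) => [->|nvp]; first by rewrite Dp.
  case: (eqVneq v q) => [->|nvq]; first by rewrite Dq.
  by rewrite (spans_out sp) // !inE (negPf nvp) (negPf nvq) vS.
Qed.

(* Only a root of K_{2,3} may lack a path of length 0 modulo 3 to the other
   degree-2 vertices, and there the three degree-2 vertices are interchangeable. *)
Lemma exc_links r p q : exc e r p q ->
  [/\ linked e (supp e) p q 1, linked e (supp e) r p 1, linked e (supp e) r p 2,
      linked e (supp e) r q 1 & linked e (supp e) r q 2] /\
  ((exc e p r q /\ exc e q p r) \/
   (linked e (supp e) r p 0 /\ linked e (supp e) r q 0)).
Proof.
move=> h; have [] := exc_deg h.
rewrite /= !inE !negb_or => /and3P[/andP[nrp nrq] npq _] _ _.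
have L u v A k : u != v -> linked e A u v k -> linked e (supp e) u v k.
  exact: linked_supp.
case: h => [/exc_twin_core[S h sp]|[S [s [t [h pS qS _ [hp hq sp]]]]]].
  have [L1 _] := core_len esym h.
  have [M1 M2 M3 M4 H] := core_reach esym h.
  split; first by split; apply: L; eassumption.
  case: H => [[H1 H2]|[H1 H2]]; [left|right].
    by split; left; apply: core_exc_twin; eassumption.
  by split; apply: L; eassumption.
have [M1 M2 M3 M4 _] := core_reach esym h.
have [[sS tS rS] [nst nrs nrt]] := core_in h.
have epq : e p q by rewrite hp eqxx.
have esp : e s p by rewrite esym hp eqxx orbT.
have etq : e t q by rewrite esym hq eqxx orbT.
have go a s' (k : nat) : a \notin S -> e s' a -> linked e S r s' k -> r != a ->
    linked e (supp e) r a k.+1.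
  move=> aS sa M nra; apply: (L _ _ (a |: S)) => //.
  apply: (linked_post (w := [::]) esym M) => //=; first by rewrite sa.
  + by allneq.
  + exact: subsetUr.
  + by move=> v; rewrite !inE => ->.
have go2 a b s' : a \notin S -> b \notin S -> e s' a -> e a b -> a != b ->
    linked e S r s' 2 -> r != b -> linked e (supp e) r b 4.
  move=> aS bS sa ab nab M nrb; apply: (L _ _ (a |: (b |: S))) => //.
  apply: (linked_post (w := [:: a]) esym M) => //=; first by rewrite sa ab.
  + by allneq.
  + by allneq.
  + by apply/subsetP=> v vS; mem.
  + by move=> v; rewrite !inE => /orP[] /eqP->; mem.
split; last first.
  (* Residue 0 comes from a path of residue 2 to [s] or [t] and one more edge. *)
  right; split; [exact: (linked_mod (k := 3) _ (go p s 2 _ _ _ _))|exact: (linked_mod (k := 3) _ (go q t 2 _ _ _ _))].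
have epq' : e q p by rewrite esym.
have nqp : q != p by rewrite eq_sym.
split.
- apply: (L _ _ setT) => //; apply: linked_edge => //; exact: in_setT.
- exact: (go2 q p t).
- exact: (go p s 1).
- exact: (linked_mod (k := 4) _ (go2 p q s _ _ _ _ _ _ _)).
- exact: (go q t 1).
Qed.

Lemma exc_adjE r p q : exc e r p q -> [/\ ~~ e r p, ~~ e r q & e p q -> exc_adj e r p q].
Proof.
case=> [h|h].
  have [S h1 sp] := exc_twin_core h.
  have [S0 [s [t [ES h0 pS qS [npq epq hp hq]]]]] := core_false_inv h1.
  have [[sS tS rS] [nst nrs nrt]] := core_in h0.
  rewrite !(esym r) hp // hq // (negPf nrs) (negPf nrt); split=> //.
  by rewrite (negPf epq).
have [S [s [t [h0 pS qS npq [hp hq sp]]]]] := h.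
have [[sS tS rS] [nst nrs nrt]] := core_in h0.
split=> //; rewrite esym ?hp ?hq; apply/norP; split; neq.
Qed.

(** Three names that cover the three vertices of degree 2 must be distinct. Callers turn this into a
    contradiction by repeating a name when fewer than three candidates are left. Only the root has
    to be identified, since the pair is unordered by [exc_swap]. *)
Lemma exc_perm r p q a b c : exc e r p q ->
  (forall v, deg e v == 2 -> v \in [:: a; b; c]) ->
  [/\ uniq [:: a; b; c], forall v, (deg e v == 2) = (v \in [:: a; b; c]) &
      [\/ exc e a b c, exc e b a c | exc e c a b]].
Proof.
move=> h H; have [U D _] := exc_deg h.
have sub : {subset [:: r; p; q] <= [:: a; b; c]} by move=> v; rewrite -D; apply: H.
have [_ E] := uniq_min_size U sub isT.
have U' : uniq [:: a; b; c] by rewrite -(eq_uniq _ E).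
split=> //; first by move=> v; rewrite D E.
have ra : r \in [:: a; b; c] by rewrite -E inE eqxx.
have pa : p \in [:: a; b; c] by rewrite -E !inE eqxx orbT.
have qa : q \in [:: a; b; c] by rewrite -E !inE eqxx !orbT.
move: U; rewrite /= !inE !negb_or => /and3P[/andP[nrp nrq] npq _].
have h' := exc_swap h; move: ra pa qa; rewrite !inE.
by case/or3P=> /eqP ?; case/or3P=> /eqP ?; case/or3P=> /eqP ?; subst;
  rewrite ?eqxx // in nrp nrq npq; (do [exact: Or31 | exact: Or32 | exact: Or33]).
Qed.
End Exc.

(** * Reductions *)

(* The inductive hypothesis in the proof of [nozero_exc]. *)
Definition smaller_exc (T : finType) (e : rel T) : Prop :=
  forall e' : rel T, symmetric e' -> irreflexive e' -> nozero e' ->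
    (forall v, deg e' v != 1) -> (exists v, 0 < deg e' v) ->
    #|[set v | deg e' v == 2]| <= 3 -> #|supp e'| < #|supp e| ->
    exists r p q, exc e' r p q.

(** With [B] empty, [z] is a dummy and this is the deletion of [D]. *)
Definition red (T : finType) (e : rel T) (D : seq T) (z : T) (B : seq T) : rel T :=
  fun u v => [|| [&& e u v, u \notin D & v \notin D],
                 (u == z) && (v \in B) | (v == z) && (u \in B)].

(* [k] counts the vertices in [D], so the path from [u] to [v] has length [k.+1]. *)
Definition joins (T : finType) (e : rel T) (D : seq T) (u v : T) (k : nat) : Prop :=
  exists w, [/\ path e u (rcons w v), uniq w, {subset w <= D} & size w = k %[mod 3]].

Section Red.
Variables (T : finType) (e : rel T).
Hypotheses (esym : symmetric e) (eirr : irreflexive e).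

Lemma joins_sym D u v k : joins e D u v k -> joins e D v u k.
Proof.
case=> w [h1 h2 h3 h4]; exists (rev w); split.
- have := rev_path e u (rcons w v).
  rewrite last_rcons belast_rcons rev_cons => ->.
  by apply: sub_path h1 => x y; rewrite esym.
- by rewrite rev_uniq.
- by move=> x; rewrite mem_rev; apply: h3.
- by rewrite size_rev.
Qed.

Lemma red_sym D z B : symmetric (red e D z B).
Proof.
move=> u v; rewrite /red esym; congr (_ || _); last by rewrite orbC.
by rewrite [(u \notin D) && _]andbC.
Qed.

Lemma red_irr D z B : z \notin B -> irreflexive (red e D z B).
Proof. by move=> zB u; rewrite /red eirr /= orbb; case: eqP => //= ->; apply/negbTE. Qed.

(* In a cycle through new edges, an edge from [z] to [b] is replaced by a path of length
   1 modulo 3 through [D], and two consecutive new edges by one of length 2 modulo 3. *)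
Lemma red_nozero D z B : nozero e -> z \notin D -> z \notin B ->
  {in B, forall b, b \notin D} ->
  {in B, forall b, joins e D z b 0} ->
  {in B &, forall b b', b != b' -> joins e D b b' 1} ->
  nozero (red e D z B).
Proof.
move=> nz zD zB BD J0 J1 s [s3 us cs]; apply/negP => d3.
have E0 u v : u != z -> v != z -> red e D z B u v -> [&& e u v, u \notin D & v \notin D].
  by move=> uz vz; rewrite /red (negPf uz) (negPf vz) !orbF.
case zs: (z \in s); last first.
  apply: (negP (nz s _)) => //; split=> //.
  apply: (sub_in_cycle (P := predC1 z)) cs; last first.
    by apply/allP=> x xs; apply/eqP => E; rewrite -E xs in zs.
  by move=> u v uz vz /(E0 _ _ uz vz) /and3P[].
(* All new edges meet at [z]. After rotation to [z], the rest of the cycle is a path of old edges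
   outside [D], and only the two edges at [z] need repair. *)
have [i s' Er] := rot_to zs.
have s3' : 3 <= size (z :: s') by rewrite -Er size_rot.
have d3' : 3 %| size (z :: s') by rewrite -Er size_rot.
have us' : uniq (z :: s') by rewrite -Er rot_uniq.
have : cycle (red e D z B) (z :: s') by rewrite -Er rot_cycle.
case: s' {Er} s3' d3' us' => [//|h t'] s3' d3' /andP[zs' us'].
rewrite [cycle _ _]/= rcons_path.
set l := last h t' => /and3P[ezh pt elz].
have nz' x : x \in h :: t' -> x != z by move=> xs; apply: contraNneq zs' => <-.
have [pt' tD] : path e h t' /\ {in h :: t', forall x, x \notin D}.
  have gen a r : path (red e D z B) a r -> {in a :: r, forall x, x != z} ->
      path e a r /\ (a \notin D -> {in a :: r, forall x, x \notin D}).
    elim: r a => [|b r IH] a /=; first by move=> _ _; split=> // aD x; rewrite inE => /eqP->.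
    case/andP=> ab pr w.
    have w' : {in b :: r, forall x, x != z} by move=> x xr; apply: w; rewrite inE xr orbT.
    have [h1 h2] := IH b pr w'.
    have/and3P[eab aD bD] := E0 _ _ (w a (mem_head _ _)) (w' b (mem_head _ _)) ab.
    rewrite eab h1; split=> // _ x; rewrite inE => /orP[/eqP->//|].
    exact: h2.
  have [h1 h2] := gen _ _ pt nz'; split=> //; apply: h2.
  case: t' s3' pt {d3' us' l elz zs' h1} nz' => [//|y t] _ /andP[hy _] nz'.
  have hN : h != z by apply: nz'; rewrite mem_head.
  have yN : y != z by apply: nz'; rewrite !inE eqxx orbT.
  by have/and3P[] := E0 _ _ hN yN hy.
pose A := [set x in h :: t'].
have lt : l \in t' by rewrite /l; case: (t') s3' => // y t _; apply: (mem_last y t).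
have nhl : h != l by move: us' => /andP[ht _]; apply: contraNneq ht => ->.
have LA : linked e A h l (size t').
  by exists t'; split=> // x xs; rewrite inE.
have zA : z \notin A by rewrite inE.
have DA w : {subset w <= D} -> all (fun x => x \notin A) w.
  move=> wD; apply/allP=> x xw; rewrite inE; apply: contraL (wD x xw) => xt.
  exact: tD.
have adj v : v \in h :: t' -> red e D z B z v -> e z v \/ v \in B.
  move=> vs; rewrite /red eqxx (negPf (nz' v vs)) /= orbF.
  by case/orP=> [/and3P[]|]; [left|right].
have hB := adj h (mem_head _ _) ezh.
have lB : e z l \/ l \in B.
  by apply: adj; rewrite 1?red_sym // inE lt orbT.
(* The cycle has [size t' + 2] vertices, so [t'] has residue 1, and every detour whose number of
   inner vertices is 1 modulo 3 closes a zero cycle of [e]. *)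
have close w : path e l (rcons w h) -> uniq w -> all (fun x => x \notin A) w ->
    size w = 1 %[mod 3] -> False.
  move=> p1 u1 a1 E1; apply: (nozero_close nz LA p1 u1 a1).
  move: E1 d3' => /=; move: (size w) (size t'); clear => i j; lia.
have subz w : {subset w <= D} -> z \notin w.
  by move=> wD; apply: contra zD; apply: wD.
case: hB => [zh|hB]; case: lB => [zl|lB].
- by apply: (close [:: z]); rewrite //= ?zA // esym zl zh.
- have [w [h1 h2 h3 h4]] := joins_sym (J0 l lB).
  apply: (close (rcons w z)).
  + by rewrite rcons_path h1 last_rcons.
  + by rewrite rcons_uniq subz.
  + by rewrite all_rcons zA DA.
  + by rewrite size_rcons -addn1 -modnDml h4.
- have [w [h1 h2 h3 h4]] := J0 h hB.
  apply: (close (z :: w)).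
  + by rewrite /= esym zl h1.
  + by rewrite /= subz.
  + by rewrite /= zA DA.
  + by rewrite /= -addn1 -modnDml h4.
- have nlh : l != h by rewrite eq_sym.
  have [w [h1 h2 h3 h4]] := J1 l h lB hB nlh.
  by apply: (close w) => //; apply: DA.
Qed.

Lemma count_sum (f : pred T) (X : seq T) : uniq X ->
  count f X = \sum_(u in [set: T]) (f u && (u \in X)).
Proof.
move=> uX; rewrite -sum1_count big_mkcond big_uniq //= big_mkcond [RHS]big_mkcond.
by apply: eq_bigr => u _; rewrite !inE andbC; case: (u \in X); case: (f u).
Qed.

(** The additive form avoids truncated subtraction. As [z] has no old neighbour in [B], no edge is
    counted twice. *)
Lemma red_deg D z B v : uniq D -> uniq B -> z \notin B -> {in B, forall b, ~~ e z b} ->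
  v \notin D -> {in B, forall b, b \notin D} -> z \notin D \/ B = [::] ->
  deg (red e D z B) v + count (e v) D = deg e v + (v == z) * size B + (v \in B).
Proof.
move=> uD uB zB zNB vD BD zD; rewrite !deg_dg /dg.
have -> : (v == z) * size B = \sum_(u in [set: T]) ((v == z) && (u \in B)).
  rewrite -(count_sum (fun=> v == z)) //; case: (v == z) => /=.
    by rewrite mul1n count_predT.
  by rewrite mul0n count_pred0.
have -> : (v \in B : nat) = \sum_(u in [set: T]) ((u == z) && (v \in B)).
  rewrite (bigD1 z) ?in_setT //= eqxx big1 ?addn0 // => u /andP[_ uz].
  by rewrite (negPf uz).
rewrite count_sum // -!big_split /=; apply: eq_bigr => u _.
rewrite /red vD /=; case: (eqVneq v z) => [Evz|nvz].
  have -> : v \in B = false by rewrite Evz; apply: negbTE.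
  rewrite andbF orbF; case uB': (u \in B); last by case: (e v u); case: (u \in D).
  rewrite (negPf (BD u uB')) Evz; have := zNB u uB'.
  by rewrite -Evz => /negPf->.
case: (eqVneq u z) => [Euz|nuz]; last by case: (e v u); case: (u \in D).
case vB: (v \in B); last by case: (e v u); case: (u \in D).
have zD' : z \notin D by case: zD => // EB; rewrite EB in vB.
by rewrite Euz (negPf zD') esym (negPf (zNB v vB)).
Qed.

(** Here [m] is the degree of [v] with the new edges but before the deletion: the inequality says
    that [v] keeps degree at least 2, and degree exactly 2 is allowed only at [a], [b], [c]. The
    vertex [d] makes the support shrink, and some vertex outside [D] keeps it nonempty. *)
Lemma red_exc D z B d a b c : nozero e ->
  smaller_exc e ->
  uniq D -> uniq B -> z \notin B -> {in B, forall x, ~~ e z x} ->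
  {in B, forall x, x \notin D} -> z \notin D \/ B = [::] ->
  {in B, forall x, joins e D z x 0} ->
  {in B &, forall x y, x != y -> joins e D x y 1} ->
  d \in D -> 0 < deg e d -> (exists2 v, v \notin D & 0 < deg e v) ->
  (forall v, v \notin D -> 0 < deg e v ->
     let m := deg e v + (v == z) * size B + (v \in B) in
     count (e v) D + 2 <= m /\ (m = count (e v) D + 2 -> v \in [:: a; b; c])) ->
  let e' := red e D z B in
  [/\ uniq [:: a; b; c], forall v, (deg e' v == 2) = (v \in [:: a; b; c]),
      forall v, deg e' v <= 4 &
      [\/ exc e' a b c, exc e' b a c | exc e' c a b]].
Proof.
move=> nz IH uD uB zB zNB BD zD J0 J1 dD d0 [v0 v0D v00] H e'.
have s' : symmetric e' by apply: red_sym.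
have i' : irreflexive e' by apply: red_irr.
have nz' : nozero e'.
  case: zD => [zD|EB]; first exact: red_nozero.
  move=> s [s3 us cs]; apply: nz; split=> //.
  apply: sub_cycle cs => u v; rewrite /e' /red EB !in_nil !andbF !orbF.
  by case/and3P.
have degP u : (0 < deg e u) = (u \in supp e).
  rewrite inE /deg card_gt0; apply/set0Pn/existsP => -[v]; rewrite ?inE => uv; exists v => //.
  by rewrite inE.
have degP' u : (0 < deg e' u) = (u \in supp e').
  rewrite inE /deg card_gt0; apply/set0Pn/existsP => -[v]; rewrite ?inE => uv; exists v => //.
  by rewrite inE.
have Jsupp u v k : joins e D u v k -> u \in supp e.
  case=> -[|x w] [] /= => [/andP[uv _]|/andP[uv _]] _ _ _; apply/suppP; first by exists v.
  by exists x.
have inD v : v \in D -> deg e' v = 0.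
  move=> vD; apply/eqP; rewrite -leqn0 leqNgt degP'; apply/negP => /suppP[u].
  rewrite /e' /red vD /= andbF /=; case/orP=> /andP[/eqP E vB].
    by case: zD vB => [|->//]; rewrite -E vD.
  by have := BD v vB; rewrite vD.
have sub v : v \in supp e' -> (v \in supp e) && (v \notin D).
  move=> vS; have vD : v \notin D.
    by apply/negP => /inD E; rewrite -degP' E in vS.
  rewrite vD andbT; case/suppP: vS => u; rewrite /e' /red.
  case/or3P=> [/and3P[vu _ _]|/andP[/eqP-> uB']|/andP[/eqP _ vB]].
  - by apply/suppP; exists u.
  - exact: Jsupp (J0 u uB').
  - exact: Jsupp (joins_sym (J0 v vB)).
have main v : v \notin D -> 0 < deg e v -> 2 <= deg e' v /\ (deg e' v = 2 -> v \in [:: a; b; c]).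
  move=> vD v1; have [h1 h2] := H v vD v1.
  have E := red_deg uD uB zB zNB vD BD zD.
  split; first by rewrite -(leq_add2r (count (e v) D)) E addnC.
  by move=> E2; apply: h2; rewrite -E -/e' E2 addnC.
have L2 v : deg e' v == 2 -> v \in [:: a; b; c].
  move=> /eqP E; have : v \in supp e' by rewrite -degP' E.
  by case/sub/andP; rewrite -degP => v1 vD; apply: (main v vD v1).2.
have [r [p [q ex]]] : exists r p q, exc e' r p q.
  apply: IH => //.
  - move=> v; apply/eqP => E; have : v \in supp e' by rewrite -degP' E.
    case/sub/andP; rewrite -degP => v1 vD.
    by have := (main v vD v1).1; rewrite E.
  - by exists v0; apply: leq_trans (main _ v0D v00).1.
  - apply: leq_trans (card_size [:: a; b; c]); apply: subset_leq_card.
    by apply/subsetP=> v; rewrite inE => /L2.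
  - apply: proper_card; apply/properP; split; first by apply/subsetP=> v /sub/andP[].
    by exists d; [rewrite -degP|apply/negP => /sub/andP[_]; rewrite dD].
have [U E P] := exc_perm s' i' ex L2.
have [_ _ E4] := exc_deg s' i' ex.
by split.
Qed.
End Red.

Section Nbr.
Variables (T : finType) (e : rel T).
Implicit Types (l : seq T) (u v : T).

Lemma deg_full l v : uniq l -> all (e v) l -> size l = deg e v ->
  forall u, e v u = (u \in l).
Proof.
move=> ul /allP al sl.
have sub : {subset l <= [set u | e v u]} by move=> u /al; rewrite inE.
have : l =i [set u | e v u].
  apply/subset_cardP; last exact/subsetP.
  by rewrite (card_uniqP ul) sl.
by move=> E u; rewrite E inE.
Qed.

Lemma deg_more l v : uniq l -> size l < deg e v -> exists2 c, c \notin l & e v c.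
Proof.
move=> ul sl; have : ~~ ([set u | e v u] \subset l).
  by apply: contraL sl => /subset_leq_card; rewrite (card_uniqP ul) -leqNgt.
by case/subsetPn=> c; rewrite inE => vc cl; exists c.
Qed.

Lemma deg_pos v u : e v u -> 0 < deg e v.
Proof. by move=> vu; rewrite /deg card_gt0; apply/set0Pn; exists u; rewrite inE. Qed.

Lemma deg2_ends v : deg e v = 2 ->
  exists a b, a != b /\ forall u, e v u = (u \in [:: a; b]).
Proof.
move=> d2; have [a _ va] := @deg_more [::] v isT (etrans (congr1 _ d2) (erefl true)).
have [|b ba vb] := @deg_more [:: a] v isT; first by rewrite d2.
have nab : a != b by rewrite inE eq_sym in ba.
exists a, b; split=> //; apply: deg_full; rewrite /= ?d2 ?va ?vb //.
by rewrite inE nab.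
Qed.

Lemma deg2_other v a : deg e v = 2 -> e v a ->
  exists b, a != b /\ forall u, e v u = (u \in [:: a; b]).
Proof.
move=> d2 va; have [|b ba vb] := @deg_more [:: a] v isT; first by rewrite d2.
have nab : a != b by rewrite inE eq_sym in ba.
exists b; split=> //; apply: deg_full; rewrite /= ?d2 ?va ?vb //.
by rewrite inE nab.
Qed.

Lemma deg3_others v a : deg e v = 3 -> e v a ->
  exists b c, uniq [:: a; b; c] /\ forall u, e v u = (u \in [:: a; b; c]).
Proof.
move=> d3 va; have [|b ba vb] := @deg_more [:: a] v isT; first by rewrite d3.
have nab : a != b by rewrite inE eq_sym in ba.
have [||c cl vc] := @deg_more [:: a; b] v; [by rewrite /= inE nab|by rewrite d3|].
have u3 : uniq [:: a; b; c].
  by move: cl; rewrite /= !inE !negb_or nab andbT eq_sym [c == b]eq_sym.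
exists b, c; split=> //; apply: deg_full; rewrite //= ?d3 ?va ?vb ?vc //.
Qed.

Lemma deg3_other v a b : deg e v = 3 -> e v a -> e v b -> a != b ->
  exists c, uniq [:: a; b; c] /\ forall u, e v u = (u \in [:: a; b; c]).
Proof.
move=> d3 va vb nab.
have [||c cl vc] := @deg_more [:: a; b] v; [by rewrite /= inE nab|by rewrite d3|].
have u3 : uniq [:: a; b; c].
  by move: cl; rewrite /= !inE !negb_or nab andbT eq_sym [c == b]eq_sym.
exists c; split=> //; apply: deg_full; rewrite //= ?d3 ?va ?vb ?vc //.
Qed.
End Nbr.

(** * At most two vertices of degree 2 *)

Section Few.
Variables (T : finType) (e : rel T).
Hypotheses (esym : symmetric e) (eirr : irreflexive e) (nz : nozero e).
Hypotheses (dn1 : forall v, deg e v != 1) (IH : smaller_exc e).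

Lemma no_triangle a b c : e a b -> e b c -> e c a -> False.
Proof.
move=> ab bc ca; apply: (negP (nz (s := [:: a; b; c]) _)) => //; split=> //=.
  by allneq.
by rewrite ab bc ca.
Qed.

Lemma deg_ge2 v : 0 < deg e v -> 2 <= deg e v.
Proof. by have := dn1 v; case: (deg e v) => [|[|n]]. Qed.

Lemma deg_ge3 (L : seq T) v : (forall v, deg e v == 2 -> v \in L) -> v \notin L ->
  0 < deg e v -> 3 <= deg e v.
Proof.
move=> H vL v0; rewrite ltn_neqAle deg_ge2 // andbT eq_sym.
by apply: contra vL; apply: H.
Qed.

Lemma del_exc D d a b c :
  uniq D -> d \in D -> 0 < deg e d -> (exists2 v, v \notin D & 0 < deg e v) ->
  (forall v, v \notin D -> 0 < deg e v ->
     count (e v) D + 2 <= deg e v /\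
     (deg e v = count (e v) D + 2 -> v \in [:: a; b; c])) ->
  let e' := red e D d [::] in
  [/\ uniq [:: a; b; c], forall v, (deg e' v == 2) = (v \in [:: a; b; c]),
      forall v, deg e' v <= 4 &
      [\/ exc e' a b c, exc e' b a c | exc e' c a b]].
Proof.
move=> uD dD d0 h1 h2; apply: (red_exc esym eirr nz IH (d := d)) => //; first by right.
move=> v vD v0 /=; rewrite muln0 !addn0; exact: h2.
Qed.

Lemma del_rel D d u v : red e D d [::] u v = [&& e u v, u \notin D & v \notin D].
Proof. by rewrite /red !in_nil !andbF !orbF. Qed.

Lemma red_supp D z B v : v \in D -> v != z -> v \notin B -> v \notin supp (red e D z B).
Proof.
move=> vD vz vB; apply/suppP => -[u].
by rewrite /red vD (negPf vz) (negPf vB) /= !andbF.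
Qed.

(** If [x] and [y] are adjacent and both have degree 2, deleting both leaves at most two candidates
    for degree 2. Otherwise only [x] is deleted; whichever vertex is the root, [exc_links] gives a
    path of residue 1 between the neighbours [a] and [b] of [x], and [x] closes it to a zero
    cycle. *)
Lemma few_deg2 x y : (forall v, deg e v == 2 -> v \in [:: x; y]) -> deg e x = 2 -> False.
Proof.
move=> H dx; have [a [b [nab Nx]]] := deg2_ends dx.
have exa : e x a by rewrite Nx mem_head.
have exb : e x b by rewrite Nx !inE eqxx orbT.
have g3 := deg_ge3 H.
have key c c' : c != c' -> (forall u, e x u = (u \in [:: c; c'])) -> deg e y = 2 ->
    c = y -> False.
  move=> ncc Nxc dy Ec; subst c.
  have exy : e x y by rewrite Nxc mem_head.
  have eyx : e y x by rewrite esym.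
  have exc' : e x c' by rewrite Nxc !inE eqxx orbT.
  have [d [nxd Ny]] := deg2_other dy eyx.
  have eyd : e y d by rewrite Ny !inE eqxx orbT.
  have nc'd : c' != d.
    apply/eqP => E; subst d; apply: (@no_triangle x y c') => //.
    by rewrite esym.
  have c'x : c' != x by neq.
  have dy' : d != y by neq.
  (* Only [c'] and [d] can drop to degree 2; the repeated name contradicts the distinctness that
     [del_exc] returns. *)
  have [|||||U _ _ _] := @del_exc [:: x; y] x c' d d.
  - by allneq.
  - by rewrite mem_head.
  - by rewrite dx.
  - by exists c'; [allneq|apply: (deg_pos (u := x)); rewrite esym].
  - move=> v; rewrite !inE negb_or => /andP[vx vy] v0 /=.
    rewrite addn0 ![e v _]esym Nxc Ny !inE (negPf vx) (negPf vy) /=.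
    have v3 : 3 <= deg e v by apply: g3 => //; rewrite !inE negb_or vx.
    case: (boolP (v == c')) => [/eqP E|_]; case: (boolP (v == d)) => [/eqP E'|_] /=.
    + by rewrite -E -E' eqxx in nc'd.
    + by split.
    + by split.
    + by split; [exact: ltnW|move=> E; rewrite E in v3].
  - by move: U; rewrite /= !inE eqxx andbF.
case: (boolP ((deg e y == 2) && e x y)) => [/andP[/eqP dy exy]|Hy].
  have [E|E] : a = y \/ b = y.
    by move: exy; rewrite Nx !inE => /orP[] /eqP->; [left|right].
    exact: (key a b).
  apply: (key b a) => //; first by rewrite eq_sym.
  by move=> u; rewrite Nx !inE orbC.
have n3 u : e x u -> 3 <= deg e u.
  move=> exu; have exu' : e u x by rewrite esym.
  rewrite ltn_neqAle (deg_ge2 (deg_pos exu')) andbT eq_sym; apply: contra Hy => du.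
  have := H u du; rewrite !inE => /orP[] /eqP E; subst u; last by rewrite du.
  by rewrite eirr in exu.
have [|||||U D2 _ P] := @del_exc [:: x] x y a b.
- by [].
- by rewrite mem_head.
- by rewrite dx.
- by exists a; [allneq|apply: (deg_pos (u := x)); rewrite esym].
- move=> v; rewrite !inE => vx v0 /=.
  rewrite addn0 ![e v _]esym.
  case exv: (e x v); last first.
    rewrite add0n; split; first exact: deg_ge2.
    by move/eqP/H; rewrite !inE (negPf vx) /= => ->.
  have v3 := n3 v exv; move: exv; rewrite Nx !inE => ->; rewrite orbT.
  by split.
set e' := red e [:: x] x [::] in D2 P.
have s' : symmetric e' by apply: red_sym.
have i' : irreflexive e' by apply: red_irr.
have L : linked e' (supp e') a b 1.
  by case: P => ex; have [[L1 L2 L3 L4 L5] _] := exc_links s' i' ex => //; apply: linked_sym.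
have L' : linked e (supp e') a b 1.
  by apply: linked_rel L => u v _ _; rewrite /e' del_rel => /and3P[].
apply: (nozero_close (w := [:: x]) nz L') => //=.
  by rewrite esym exb exa.
rewrite andbT; apply/suppP => -[u]; rewrite /e' del_rel inE eqxx andbF //.
Qed.
End Few.

(** * Three vertices of degree 2 *)

Section Three.
Variables (T : finType) (e : rel T).
Hypotheses (esym : symmetric e) (eirr : irreflexive e) (nz : nozero e).
Hypotheses (dn1 : forall v, deg e v != 1) (IH : smaller_exc e).

Definition trio (r x y : T) : Prop :=
  uniq [:: r; x; y] /\ forall v, (deg e v == 2) = (v \in [:: r; x; y]).

Lemma trio_rot r x y : trio r x y -> trio x y r.
Proof.
case=> u H; split=> [|v]; first by rewrite -(rot_uniq 1) in u.
by rewrite H !inE orbC -orbA.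
Qed.

Lemma trio_swap r x y : trio r x y -> trio r y x.
Proof.
case=> u H; split=> [|v]; last by rewrite H !inE [(v == x) || _]orbC.
move: u; rewrite /= !inE !negb_or => /and3P[/andP[? ?] ? _].
by allneq.
Qed.

Lemma deg_ge l v : uniq l -> all (e v) l -> size l <= deg e v.
Proof.
move=> ul /allP al; rewrite -(card_uniqP ul); apply: subset_leq_card.
by apply/subsetP => u /al; rewrite inE.
Qed.

Lemma trio_deg2 r x y v : trio r x y -> v \in [:: r; x; y] -> deg e v = 2.
Proof. by case=> _ H; rewrite -H => /eqP. Qed.

Lemma trio_ge3 r x y v u : trio r x y -> v \notin [:: r; x; y] -> e v u -> 3 <= deg e v.
Proof.
case=> _ H vL vu; apply: (deg_ge3 dn1 (L := [:: r; x; y])) => //.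
  by move=> w; rewrite H.
exact: deg_pos vu.
Qed.

Lemma count0 v (D : seq T) : (forall u, u \in D -> ~~ e v u) -> count (e v) D = 0.
Proof.
move=> h; apply/eqP; rewrite -leqn0 leqNgt -has_count; apply/hasPn => u uD.
exact: h.
Qed.

Lemma count1 v c (D : seq T) : uniq D -> c \in D -> e v c ->
  (forall u, u \in D -> e v u -> u = c) -> count (e v) D = 1.
Proof.
move=> uD cD vc h; have <- : count_mem c D = 1 by rewrite count_uniq_mem // cD.
apply: eq_in_count => u uD'; rewrite /=; apply/idP/eqP => [|->//]; exact: h.
Qed.

(* A reduction that keeps only [S], possibly together with [c], would be exceptional with
   at most two vertices of degree 2. *)
Lemma cut_vertex r x y (S : {set T}) c s a : trio r x y -> c \notin S ->
  s \in S -> 0 < deg e s ->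
  (forall u v, u \in S -> e u v -> v \in S \/ v = c) ->
  {in S, forall v, deg e v == 2 -> v = a} -> False.
Proof.
move=> tr cS sS s0 cl Ha; have [ur H2] := tr.
have ge3 v u : v \in S -> v != a -> e v u -> 3 <= deg e v.
  move=> vS va vu; rewrite ltn_neqAle (deg_ge2 dn1 (deg_pos vu)) andbT eq_sym.
  by apply: contra va => /(Ha _ vS)->.
(* Two of the three vertices of degree 2 lie outside [S] and one of them is not [c]; its deletion
   makes the support smaller in every case below. *)
have [d [dS dc d2]] : exists d, [/\ d \notin S, d != c & deg e d = 2].
  have dd z : z \in [:: r; x; y] -> deg e z = 2 by apply: trio_deg2.
  have [w1 [w2 [w1S w2S n12 [d1 d2]]]] : exists w1 w2,
      [/\ w1 \notin S, w2 \notin S, w1 != w2 & deg e w1 = 2 /\ deg e w2 = 2].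
    have dr : deg e r = 2 by apply: dd; rewrite !inE eqxx.
    have dx : deg e x = 2 by apply: dd; rewrite !inE eqxx ?orbT.
    have dy : deg e y = 2 by apply: dd; rewrite !inE eqxx ?orbT.
    move: ur; rewrite /= !inE !negb_or => /and3P[/andP[nrx nry] nxy _].
    have two u v : u != v -> deg e u = 2 -> deg e v = 2 -> (u \notin S) || (v \notin S).
      move=> nuv du dv; rewrite -negb_and; apply/negP => /andP[uS vS].
      have Eu : u = a by apply: Ha; rewrite ?du.
      have Ev : v = a by apply: Ha; rewrite ?dv.
      by rewrite Eu Ev eqxx in nuv.
    have [rS|/negPn rS] := boolP (r \notin S); last first.
      have := two _ _ nrx dr dx; have := two _ _ nry dr dy; rewrite rS /= => yS xS.
      by exists x, y.
    have := two _ _ nxy dx dy => /orP[xS|yS]; [by exists r, x|by exists r, y].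
  case: (eqVneq w1 c) => [E|n1]; last by exists w1.
  by exists w2; split=> //; rewrite -E eq_sym.
have dgd : 0 < deg e d by rewrite d2.
have zero v (D : seq T) : v \in S -> (forall u, u \in D -> u \notin S /\ u != c) ->
    count (e v) D = 0.
  move=> vS hD; apply: count0 => u /hD[uS uc]; apply/negP => /(cl _ _ vS) [uS'|E].
    by rewrite uS' in uS.
  by rewrite E eqxx in uc.
(* If [c] has no neighbour in [S], the graph on [S] can be kept unchanged. *)
case: (pickP [pred u | (u \in S) && e c u]) => [u1 /andP[/= u1S cu1]|none]; last first.
  have nc v : v \in S -> ~~ e v c.
    by move=> vS; have := none v; rewrite /= vS esym /= => ->.
  have [|||||U _ _ _] := @del_exc T e esym eirr nz IH (enum (~: S)) d a a a.
  - exact: enum_uniq.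
  - by rewrite mem_enum inE.
  - by [].
  - by exists s => //; rewrite mem_enum inE negbK.
  - move=> v; rewrite mem_enum in_setC negbK => vS v0.
    have -> : count (e v) (enum (~: S)) = 0.
      apply: count0 => u; rewrite mem_enum inE => uS; apply/negP => vu.
      by case: (cl _ _ vS vu) => [|E]; [apply/negP|case/negP: (nc v vS); rewrite -E].
    split; first exact: deg_ge2.
    by move/eqP/(Ha v vS)=> ->; rewrite !inE eqxx.
  - by move: U; rewrite /= !inE eqxx.
(* With two neighbours in [S], the vertex [c] is kept as well and still has degree at least 2. *)
case: (pickP [pred u | [&& u \in S, e c u & u != u1]]) => [u2 /and3P[/= u2S cu2 n21]|only].
  have [|||||U _ _ _] := @del_exc T e esym eirr nz IH (enum (~: (c |: S))) d a c c.
  - exact: enum_uniq.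
  - by rewrite mem_enum !inE negb_or dc.
  - by [].
  - by exists s => //; rewrite mem_enum !inE sS orbT.
  - move=> v; rewrite mem_enum in_setC negbK in_setU1 => /orP[/eqP->|vS] v0; last first.
      rewrite zero //.
        split; first exact: deg_ge2.
        by move/eqP/(Ha v vS)=> ->; rewrite inE eqxx.
      by move=> u; rewrite mem_enum !inE negb_or => /andP[-> ->].
    split; last by move=> _; rewrite !inE eqxx !orbT.
    rewrite addn2 -size_filter; apply: (@deg_ge [:: u1, u2 & filter (e c) _]).
      have nf u : u \in S -> u \notin filter (e c) (enum (~: (c |: S))).
        by move=> uS; rewrite mem_filter mem_enum in_setC in_setU1 uS orbT andbF.
      rewrite [uniq _]/= inE negb_or (nf _ u1S) (nf _ u2S) eq_sym n21 /=.
      by rewrite filter_uniq // enum_uniq.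
    by rewrite /= cu1 cu2 filter_all.
  - by move: U; rewrite /= !inE eqxx andbF.
have N1 u : u \in S -> e c u -> u = u1.
  by move=> uS cu; have := only u; rewrite /= uS cu /= => /negbFE/eqP.
have ec1 : e u1 c by rewrite esym.
have CS v : v \in S -> v != u1 -> count (e v) (enum (~: S)) = 0.
  move=> vS vu; apply: count0 => u; rewrite mem_enum inE => uS; apply/negP => vw.
  case: (cl _ _ vS vw) => [|E]; first exact/negP.
  by case/eqP: vu; apply: N1 => //; rewrite esym -E.
have C1 : count (e u1) (enum (~: S)) = 1.
  apply: (count1 (c := c)); rewrite ?enum_uniq ?mem_enum ?inE // => u.
  by rewrite mem_enum inE => uS /(cl _ _ u1S)[uS'|//]; rewrite uS' in uS.
(* With a single neighbour [u1], the vertex [c] is deleted and only [u1] loses an edge. If [u1] had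
   degree 2, it is [a] and is deleted too; its other neighbour [w] is then the only candidate for
   degree 2. *)
case: (eqVneq (deg e u1) 2) => [d1|d1]; last first.
  have d13 : 3 <= deg e u1.
    by rewrite ltn_neqAle eq_sym d1 (deg_ge2 dn1 (deg_pos ec1)).
  have [|||||U _ _ _] := @del_exc T e esym eirr nz IH (enum (~: S)) d a u1 u1.
  - exact: enum_uniq.
  - by rewrite mem_enum inE.
  - by [].
  - by exists s => //; rewrite mem_enum inE negbK.
  - move=> v; rewrite mem_enum in_setC negbK => vS v0.
    case: (eqVneq v u1) => [->|nv1]; first by rewrite C1 !inE eqxx !orbT.
    rewrite CS //; split; first exact: deg_ge2.
    by move/eqP/(Ha v vS)=> ->; rewrite !inE eqxx.
  - by move: U; rewrite /= !inE eqxx andbF.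
have E1 : u1 = a by apply: Ha; rewrite ?d1.
have [w [ncw Nu]] := deg2_other d1 ec1.
have e1w : e u1 w by rewrite Nu !inE eqxx orbT.
have wS : w \in S.
  by case: (cl _ _ u1S e1w) => // E; rewrite E eqxx in ncw.
have nw1 : w != u1 by neq.
have ew1 : e w u1 by rewrite esym.
have w3 : 3 <= deg e w by apply: (ge3 w u1); rewrite // -E1.
have [|||||U _ _ _] := @del_exc T e esym eirr nz IH (u1 :: enum (~: S)) d w w w.
- by rewrite /= enum_uniq mem_enum inE negbK u1S.
- by rewrite inE mem_enum inE dS orbT.
- by [].
- by exists w; [rewrite inE mem_enum inE negb_or nw1 negbK|exact: deg_pos ew1].
- move=> v; rewrite [v \in u1 :: _]in_cons mem_enum in_setC negb_or negbK => /andP[nv1 vS] v0.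
  rewrite /= CS // addn0; case: (eqVneq v w) => [->|nvw].
    by rewrite ew1 !inE eqxx.
  have -> : e v u1 = false.
    rewrite esym Nu !inE (negPf nvw) orbF; apply/negbTE; neq.
  split; first exact: deg_ge2.
  by move/eqP/(Ha v vS) => E; rewrite E E1 eqxx in nv1.
- by move: U; rewrite /= !inE eqxx.
Qed.
End Three.

Ltac count_goal :=
  (split; [solve [rewrite /=; (try match goal with H : is_true (3 <= _) |- _ => move: H end); clear; lia]
          | try done;
            match goal with H : is_true (3 <= _) |- _ =>
              let E := fresh in move=> E; exfalso; move: H; rewrite E //= end]).

(** * Adjacent vertices of degree 2 *)

Section Adjacent.
Variables (T : finType) (e : rel T).
Hypotheses (esym : symmetric e) (eirr : irreflexive e) (nz : nozero e).
Hypotheses (dn1 : forall v, deg e v != 1) (IH : smaller_exc e).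

Lemma core_supp (e0 : rel T) r b S p q : symmetric e0 -> irreflexive e0 ->
  core e0 r b S p q -> {subset S <= supp e0}.
Proof.
move=> s0 i0 h v vS; have := core_dg s0 i0 h vS.
have d0 : 0 < dg e0 S v -> v \in supp e0.
  rewrite /dg lt0n => H; apply/suppP; case: (pickP (e0 v)) => [u vu|none]; first by exists u.
  by case/eqP: H; apply: big1 => u _; rewrite none.
case: (v == r); first by move/eqP=> E; apply: d0; rewrite E.
case: (_ || _); last by move=> /andP[h3 _]; apply: d0; apply: leq_trans h3.
case: b {h} => [/andP[h1 _]|/eqP E]; apply: d0 => //; by rewrite E.
Qed.

Lemma trio_uniq r x y : trio e r x y -> [/\ r != x, r != y & x != y].
Proof. by case=> + _; rewrite /= !inE !negb_or => /and3P[/andP[? ?] ? _]; split. Qed.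

(** Deleting [r], [x], [y] affects only the outer neighbours [a] and [b] of this path. If they are
    distinct, no other vertex can drop to degree 2; if they coincide, that vertex separates the path
    from the rest. *)
Lemma deg2_path r x y : trio e r x y -> e x r -> e x y -> False.
Proof.
move=> tr exr exy; have [nrx nry nxy] := trio_uniq tr.
have dx : deg e x = 2 by apply: (trio_deg2 tr); rewrite !inE eqxx orbT.
have dr : deg e r = 2 by apply: (trio_deg2 tr); rewrite !inE eqxx.
have dy : deg e y = 2 by apply: (trio_deg2 tr); rewrite !inE eqxx !orbT.
have [y' [nry' Nx]] := deg2_other dx exr.
have Ey : y' = y.
  by move: exy; rewrite Nx !inE [y == r]eq_sym (negPf nry) => /eqP.
subst y'; have erx : e r x by rewrite esym.
have eyx : e y x by rewrite esym.
have [a [nxa Nr]] := deg2_other dr erx.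
have [b [nxb Ny]] := deg2_other dy eyx.
have era : e r a by rewrite Nr !inE eqxx orbT.
have eyb : e y b by rewrite Ny !inE eqxx orbT.
have nar : a != r by neq.
have nby : b != y by neq.
have nay : a != y by apply/eqP => E; subst a; apply: (no_triangle eirr nz (a:=r) (b:=x) (c:=y)) => //; rewrite esym.
have ear : e a r by rewrite esym.
have a3 : 3 <= deg e a by apply: (trio_ge3 dn1 tr _ ear); allneq.
case: (eqVneq a b) => [Eab|nab].
  subst b; have eay : e a y by rewrite esym.
  have [||c cl eac] := @deg_more T e [:: r; y] a.
  - by allneq.
  - exact: a3.
  move: cl; rewrite !inE negb_or => /andP[ncr ncy].
  have eca : e c a by rewrite esym.
  have ncx : c != x.
    by apply/eqP => E; subst c; move: eca; rewrite Nx !inE (negPf nar) (negPf nby).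
  apply: (@cut_vertex T e esym eirr nz dn1 IH r x y (~: [set r; x; y; a]) a c a tr).
  - by rewrite !inE eqxx !orbT.
  - by rewrite !inE; allneq.
  - exact: deg_pos eca.
  - move=> u v; rewrite !inE !negb_or -!andbA => /and4P[ur ux uy ua] euv.
    eqcase v r; first by move: euv; subst v; rewrite esym Nr !inE (negPf ux) (negPf ua).
    eqcase v x; first by move: euv; subst v; rewrite esym Nx !inE (negPf ur) (negPf uy).
    eqcase v y; first by move: euv; subst v; rewrite esym Ny !inE (negPf ux) (negPf ua).
    eqcase v a; [by right|by left].
  - move=> v; rewrite !inE !negb_or -!andbA => /and4P[ur ux uy ua].
    by case: tr => _ ->; rewrite !inE (negPf ur) (negPf ux) (negPf uy).
have [|||||U _ _ _] := @del_exc T e esym eirr nz IH [:: r; x; y] r a b b.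
- by allneq.
- by rewrite mem_head.
- by rewrite dr.
- by exists a; [allneq|exact: deg_pos ear].
- move=> v; rewrite !inE !negb_or => /and3P[vr vx vy] v0.
  rewrite /= addn0 ![e v _]esym Nr Nx Ny !inE (negPf vr) (negPf vx) (negPf vy) /=.
  have v3 : 3 <= deg e v.
    by apply: (deg_ge3 dn1 (L := [:: r; x; y])) => //; [move=> w; rewrite tr.2|allneq].
  eqcase v a; eqcase v b; try solve [subst; contra_hyp]; count_goal.
- by move: U; rewrite /= !inE eqxx andbF.
Qed.

(** Without [x] and [y], their outer neighbours [a] and [b] take over the role of the pair. If they
    are nonadjacent twins, then [a - x - y - b] is a path step of the construction. If they are
    adjacent, a path of residue 1 between [s] and [t] closes through [b y x a] to a zero cycle. *)
Lemma deg2_adjacent r x y : trio e r x y -> e x y -> exists r p q, exc e r p q.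
Proof.
move=> tr exy; have [nrx nry nxy] := trio_uniq tr.
have dx : deg e x = 2 by apply: (trio_deg2 tr); rewrite !inE eqxx orbT.
have dy : deg e y = 2 by apply: (trio_deg2 tr); rewrite !inE eqxx !orbT.
have eyx : e y x by rewrite esym.
have nexr : ~~ e x r by apply/negP => exr; apply: (deg2_path tr).
have neyr : ~~ e y r by apply/negP => exr; apply: (deg2_path (trio_swap tr)).
have [a [nya Nx]] := deg2_other dx exy.
have [b [nxb Ny]] := deg2_other dy eyx.
have exa : e x a by rewrite Nx !inE eqxx orbT.
have eyb : e y b by rewrite Ny !inE eqxx orbT.
have eax : e a x by rewrite esym.
have eby : e b y by rewrite esym.
have nar : a != r by apply: contraNneq nexr => <-.
have nbr : b != r by apply: contraNneq neyr => <-.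
have nab : a != b.
  by apply/eqP => E; subst b; apply: (no_triangle eirr nz (a:=x) (b:=y) (c:=a)).
have [|||||_ _ _ P] := @del_exc T e esym eirr nz IH [:: x; y] x r a b.
- by allneq.
- by rewrite mem_head.
- by rewrite dx.
- by exists a; [allneq|exact: deg_pos eax].
- move=> v; rewrite !inE !negb_or => /andP[vx vy] v0.
  rewrite /= addn0 ![e v _]esym Nx Ny !inE (negPf vx) (negPf vy) /=.
  have v2 := deg_ge2 dn1 v0.
  eqcase v r; first by subst; rewrite !(eq_sym r) (negPf nar) (negPf nbr) /=; split.
  have v3 : 3 <= deg e v.
    by apply: (deg_ge3 dn1 (L := [:: r; x; y])) => //; [move=> w; rewrite tr.2|allneq].
  eqcase v a; eqcase v b; try solve [subst; contra_hyp]; count_goal.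
set e' := red e [:: x; y] x [::] in P.
have s' : symmetric e' by apply: red_sym.
have i' : irreflexive e' by apply: red_irr.
have e'e u v : e' u v = [&& e u v, u \notin [:: x; y] & v \notin [:: x; y]].
  exact: del_rel.
have xs : x \notin supp e'.
  by apply/suppP => -[u]; rewrite e'e mem_head andbF.
have ys : y \notin supp e'.
  by apply/suppP => -[u]; rewrite e'e !inE eqxx orbT andbF.
have L0 u v : linked e' (supp e') u v 0 -> e u x -> e y v -> False.
  move=> L ux yv.
  have L' : linked e (supp e') u v 0 by apply: linked_rel L => i j _ _; rewrite e'e => /and3P[].
  apply: (nozero_close (w := [:: y; x]) nz L') => //=.
  - by rewrite esym yv eyx esym ux.
  - by rewrite inE eq_sym nxy.
  - by rewrite xs ys.
(* Root [a] or [b] would give a path of residue 0 between [a] and [b], which [x] and [y] close to a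
   zero cycle. The exception is $K_{2,3}$, where the root can be exchanged for [r]. *)
have {P} ex : exc e' r a b.
  case: P => // ex; have [_ []] := exc_links s' i' ex; try by case.
  - by case=> _ /L0; case.
  - by case=> h _; apply: exc_swap.
  - by case=> _ /(linked_sym s')/L0; case.
exists r, x, y; right; case: ex => [/exc_twin_core|].
  move=> [S h sp]; have SS := core_supp s' i' h.
  have xS : x \notin S by apply: contra xs; apply: SS.
  have yS : y \notin S by apply: contra ys; apply: SS.
  have [[aS bS _] _] := core_in h.
  exists S, a, b; split=> //.
    apply: (core_ext h) => u v uS vS; rewrite e'e.
    have uu : u \notin [:: x; y] by allneq.
    have vv : v \notin [:: x; y] by allneq.
    by rewrite uu vv !andbT.
  split.
  - by move=> v; rewrite Nx !inE.
  - by move=> v; rewrite Ny !inE.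
  - move=> u v uv; rewrite !inE.
    eqcase u x => //; eqcase u y => //.
    eqcase v x; first by subst v; move: uv; rewrite esym Nx !inE => /orP[/eqP E|/eqP->//]; subst; contra_hyp.
    eqcase v y; first by subst v; move: uv; rewrite esym Ny !inE => /orP[/eqP E|/eqP->//]; subst; contra_hyp.
    by apply: (sp u v); rewrite e'e uv !inE !negb_or; allneq.
case=> S [s [t [h aS bS _ [Na Nb sp]]]].
have [[sS tS _] _] := core_in h; have SS := core_supp s' i' h.
have xS : x \notin S by apply: contra xs; apply: SS.
have yS : y \notin S by apply: contra ys; apply: SS.
have [L _] := core_len s' h.
have L' : linked e S s t 1 by apply: linked_rel L => i j _ _; rewrite e'e => /and3P[].
case: (nozero_close (w := [:: b; y; x; a]) nz L') => //=.
- have: e' b t by rewrite Nb eqxx orbT.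
  have: e' a s by rewrite Na eqxx orbT.
  rewrite !e'e => /and3P[eas _ _] /and3P[ebt _ _].
  by rewrite esym ebt eby eyx exa eas.
- by allneq.
- by allneq.
Qed.
End Adjacent.

(** * Twins of degree 2 *)

Definition indep (T : finType) (e : rel T) (r x y : T) : bool :=
  [&& ~~ e r x, ~~ e r y & ~~ e x y].

Section Twins.
Variables (T : finType) (e : rel T).
Hypotheses (esym : symmetric e) (eirr : irreflexive e) (nz : nozero e).
Hypotheses (dn1 : forall v, deg e v != 1) (IH : smaller_exc e).

Lemma trio_ge3' r x y v : trio e r x y -> v != r -> v != x -> v != y -> 0 < deg e v ->
  3 <= deg e v.
Proof.
move=> tr vr vx vy v0; apply: (deg_ge3 dn1 (L := [:: r; x; y])) => //.
  by move=> w; rewrite tr.2.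
by allneq.
Qed.

(** The large degree of [p] means that deleting [y] leaves [r], [x], [q] as the candidates for
    degree 2. Since [x] and [q] are adjacent, they form the pair, [q] is a pendant of the core, and
    restoring [y] is the twin step. *)
Lemma twins_big r x y p q : trio e r x y -> indep e r x y -> p != q ->
  (forall u, e x u = (u \in [:: p; q])) -> (forall u, e y u = (u \in [:: p; q])) ->
  4 <= deg e p -> exists r p q, exc e r p q.
Proof.
move=> tr /and3P[nerx nery nexy] npq Nx Ny p4; have [nrx nry nxy] := trio_uniq tr.
have exp : e x p by rewrite Nx !inE eqxx.
have exq : e x q by rewrite Nx !inE eqxx orbT.
have npr : p != r by apply: contraNneq nerx => <-; rewrite esym.
have nqr : q != r by apply: contraNneq nerx => <-; rewrite esym.
have npy : p != y by apply: contraNneq nexy => <-.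
have nqy : q != y by apply: contraNneq nexy => <-.
have npx : p != x by neq.
have nqx : q != x by neq.
have dy : deg e y = 2 by apply: (trio_deg2 tr); rewrite !inE eqxx !orbT.
have [|||||_ _ _ P] := @del_exc T e esym eirr nz IH [:: y] y r x q.
- by [].
- by rewrite mem_head.
- by rewrite dy.
- by exists p; [allneq|apply: leq_trans p4].
- move=> v; rewrite !inE => vy v0; rewrite /= addn0 ![e v _]esym Ny !inE.
  eqcase v p; first by subst v; rewrite (negPf npr) (negPf npx) (negPf npq); move: p4; clear; lia.
  eqcase v r; first by subst v; rewrite /= eq_sym (negPf nqr) (deg_ge2 dn1 v0).
  eqcase v x; first by subst v; rewrite /= eq_sym (negPf nqx) (deg_ge2 dn1 v0).
  have v3 : 3 <= deg e v by apply: (trio_ge3' tr).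
  by eqcase v q; count_goal.
set e' := red e [:: y] y [::] in P.
have s' : symmetric e' by apply: red_sym.
have i' : irreflexive e' by apply: red_irr.
have e'e u v : u != y -> v != y -> e' u v = e u v.
  by move=> uy vy; rewrite /e' del_rel !inE uy vy !andbT.
have e'x u : e' x u = (u \in [:: p; q]).
  rewrite /e' del_rel Nx !inE nxy.
  by eqcase u y; [subst; rewrite !andbF !(eq_sym y) (negPf npy) (negPf nqy)|rewrite !andbT].
have ys : y \notin supp e'.
  by apply/suppP => -[u]; rewrite /e' del_rel mem_head andbF.
have exq' : e' x q by rewrite e'x !inE eqxx orbT.
have {P} ex : exc_adj e' r x q.
  case: P => ex; have [h1 h2 h3] := exc_adjE s' ex.
  - exact: h3.
  - by rewrite exq' in h2.
  - by rewrite s' exq' in h2.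
case: ex => S [s [t [h xS qS _ [N'x N'q sp]]]].
have [[sS tS rS] [nst _ _]] := core_in h.
have yS : y \notin S by apply: contra ys; apply: (core_supp s' i' h).
have Eps : p = s.
  have : e' x p by rewrite e'x mem_head.
  by rewrite N'x (negPf npq) /= => /eqP.
subst s; have hS : core e r false S p t.
  apply: (core_ext h) => u v uS vS; apply: e'e; neq.
have qN : {in S, forall v, e q v = (v == t)}.
  move=> v vS; rewrite -e'e //; last by neq.
  by rewrite N'q; have -> : v == x = false by apply/negbTE; neq.
exists r, x, y; left; apply: (core_exc_twin esym eirr (S := x |: (y |: (q |: S)))).
  apply: core_twins (core_pendr hS qS qN) _ _ nxy nexy _ _.
  - by allneq.
  - by allneq.
  - by move=> v _; rewrite Nx !inE.
  - by move=> v _; rewrite Ny !inE.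
move=> u v uv; rewrite !inE; eqcase u y; first by rewrite orbT.
eqcase v y.
  by subst v; move: uv; rewrite esym Ny !inE => /orP[]/eqP->; rewrite ?sS ?eqxx !orbT.
have := sp u v; rewrite e'e // uv !inE => /(_ isT) /or3P[->|->|->]; by rewrite ?orbT.
Qed.

(** In the generic case [x], [y], [p], [q] are deleted. The path [c p x q d] of length 4 forbids
    residue 2 between [c] and [d], yet that residue occurs in every exceptional shape except
    [exc_adj] with root [r]; restoring the four vertices is then the 4-cycle step. The other cases
    are $K_{2,3}$, a cut vertex, or too few vertices of degree 2. *)
Lemma twins_tri r x y p q c d : trio e r x y -> indep e r x y -> p != q ->
  (forall u, e x u = (u \in [:: p; q])) -> (forall u, e y u = (u \in [:: p; q])) ->
  uniq [:: x; y; c] -> uniq [:: x; y; d] ->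
  (forall u, e p u = (u \in [:: x; y; c])) -> (forall u, e q u = (u \in [:: x; y; d])) ->
  c == r \/ d != r -> exists r p q, exc e r p q.
Proof.
move=> tr /and3P[nerx nery nexy] npq Nx Ny; have [nrx nry nxy] := trio_uniq tr.
rewrite /= !inE !negb_or => /and3P[/andP[_ nxc] nyc _] /and3P[/andP[_ nxd] nyd _] Np Nq cr.
have exp : e x p by rewrite Nx !inE eqxx.
have exq : e x q by rewrite Nx !inE eqxx orbT.
have epc : e p c by rewrite Np !inE eqxx !orbT.
have eqd : e q d by rewrite Nq !inE eqxx !orbT.
have eqx : e q x by rewrite esym.
have ecp : e c p by rewrite esym.
have edq : e d q by rewrite esym.
have npc : p != c by neq.
have nqd : q != d by neq.
have npd : p != d by apply/eqP => E; subst d; apply: (no_triangle eirr nz (a:=x) (b:=p) (c:=q)); rewrite // esym.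
have nqc : q != c by apply/eqP => E; subst c; apply: (no_triangle eirr nz (a:=x) (b:=p) (c:=q)).
have nepq : ~~ e p q by rewrite Np !inE !negb_or; allneq.
have dx : deg e x = 2 by apply: (trio_deg2 tr); rewrite !inE eqxx !orbT.
have dr : deg e r = 2 by apply: (trio_deg2 tr); rewrite !inE eqxx.
case: (eqVneq c d) => [Ecd|ncd].
  subst d; case: (eqVneq c r) => [Ecr|ncr]; last first.
    have c3 : 3 <= deg e c.
      by apply: (trio_ge3' tr) => //; rewrite 1?eq_sym //; apply: deg_pos ecp.
    have [||s sl ecs] := @deg_more T e [:: p; q] c.
    - by allneq.
    - exact: c3.
    move: sl; rewrite !inE negb_or => /andP[nsp nsq].
    have esc : e s c by rewrite esym.
    have nsx : s != x.
      by apply/eqP => E; subst s; move: esc; rewrite Nx !inE !(eq_sym c) (negPf npc) (negPf nqc).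
    have nsy : s != y.
      by apply/eqP => E; subst s; move: esc; rewrite Ny !inE !(eq_sym c) (negPf npc) (negPf nqc).
    exfalso; apply: (@cut_vertex T e esym eirr nz dn1 IH r x y (~: [set x; y; p; q; c]) c s r tr).
    - by rewrite !inE eqxx !orbT.
    - by rewrite !inE; allneq.
    - exact: deg_pos esc.
    - move=> u v; rewrite !inE !negb_or -!andbA => /and5P[ux uy up uq uc] euv.
      eqcase v x; first by move: euv; subst v; rewrite esym Nx !inE (negPf up) (negPf uq).
      eqcase v y; first by move: euv; subst v; rewrite esym Ny !inE (negPf up) (negPf uq).
      eqcase v p; first by move: euv; subst v; rewrite esym Np !inE (negPf ux) (negPf uy) (negPf uc).
      eqcase v q; first by move: euv; subst v; rewrite esym Nq !inE (negPf ux) (negPf uy) (negPf uc).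
      eqcase v c; [by right|by left].
    - move=> v; rewrite !inE !negb_or -!andbA => /and5P[ux uy up uq uc].
      by case: tr => _ ->; rewrite !inE (negPf ux) (negPf uy) !orbF => /eqP.
  subst c; have Nr u : e r u = (u \in [:: p; q]).
    apply: deg_full; rewrite ?dr //=; first by allneq.
    by rewrite ecp edq.
  (* These five vertices form a component $K_{2,3}$. Were there another nonisolated vertex, deleting
     them would leave a graph without vertices of degree 2. *)
  case: (pickP [pred v | (v \notin [:: x; y; p; q; r]) && (0 < deg e v)]) => [v /andP[/= vD v0]|none].
    have [|||||U _ _ _] := @del_exc T e esym eirr nz IH [:: x; y; p; q; r] x x x x.
    - by allneq.
    - by rewrite mem_head.
    - by rewrite dx.
    - by exists v.
    - move=> w; rewrite !inE !negb_or => /and5P[wx wy wp wq wr] w0.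
      rewrite /= ![e w _]esym Nx Ny Np Nq Nr !inE.
      have v3 : 3 <= deg e w by apply: (trio_ge3' tr).
      rewrite (negPf wx) (negPf wy) (negPf wp) (negPf wq) (negPf wr) /=; count_goal.
    - by move: U; rewrite /= !inE eqxx.
  exists r, x, y; left.
  have h : core e r true [set p; q; r] p q by apply: core_base => //; neq.
  apply: (core_exc_twin esym eirr); first apply: (core_twins h (x := x) (y := y)) => //.
  - by allneq.
  - by allneq.
  - by move=> v _; rewrite Nx !inE.
  - by move=> v _; rewrite Ny !inE.
  - move=> u v uv; have := none u; rewrite /= (deg_pos uv) andbT => /negbFE.
    by rewrite !inE => /or4P[->|->|->|/orP[]->]; rewrite ?orbT.
case: (eqVneq d r) => [Edr|ndr].
  by case: cr => [/eqP E|]; [rewrite E Edr eqxx in ncd|rewrite Edr eqxx].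
have d3 : 3 <= deg e d.
  by apply: (trio_ge3' tr) => //; rewrite 1?eq_sym //; apply: deg_pos edq.
case: (eqVneq c r) => [Ecr|ncr].
  (* Since [p] leads only to [r], the vertex [r] is deleted too and its other neighbour [g] takes
     the place of [c]. *)
  subst c; have [g [npg Nr]] := deg2_other dr ecp.
  have erg : e r g by rewrite Nr !inE eqxx orbT.
  have egr : e g r by rewrite esym.
  have nqg : q != g.
    apply/eqP => E; subst g; move: egr; rewrite Nq !inE (negPf nrx) (negPf nry) /=.
    by rewrite eq_sym (negPf ndr).
  case: (eqVneq d g) => [Edg|ndg].
    subst g; have [||s sl ecs] := @deg_more T e [:: q; r] d.
    - by allneq.
    - exact: d3.
    move: sl; rewrite !inE negb_or => /andP[nsq nsr].
    have esc : e s d by rewrite esym.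
    have nsx : s != x.
      by apply/eqP => E; subst s; move: esc; rewrite Nx !inE !(eq_sym d) (negPf npd) (negPf nqd).
    have nsy : s != y.
      by apply/eqP => E; subst s; move: esc; rewrite Ny !inE !(eq_sym d) (negPf npd) (negPf nqd).
    have nsp : s != p.
      apply/eqP => E; subst s; move: esc; rewrite Np !inE !(eq_sym d) (negPf nxd) (negPf nyd) /=.
      by rewrite (negPf ncd).
    exfalso; apply: (@cut_vertex T e esym eirr nz dn1 IH r x y (~: [set x; y; p; q; r; d]) d s r tr).
    - by rewrite !inE eqxx !orbT.
    - by rewrite !inE; allneq.
    - exact: deg_pos esc.
    - move=> u v; rewrite !inE !negb_or -!andbA => /and5P[ux uy up uq /andP[ur ud]] euv.
      eqcase v x; first by move: euv; subst v; rewrite esym Nx !inE (negPf up) (negPf uq).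
      eqcase v y; first by move: euv; subst v; rewrite esym Ny !inE (negPf up) (negPf uq).
      eqcase v p; first by move: euv; subst v; rewrite esym Np !inE (negPf ux) (negPf uy) (negPf ur).
      eqcase v q; first by move: euv; subst v; rewrite esym Nq !inE (negPf ux) (negPf uy) (negPf ud).
      eqcase v r; first by move: euv; subst v; rewrite esym Nr !inE (negPf up) (negPf ud).
      eqcase v d; [by right|by left].
    - move=> v; rewrite !inE !negb_or -!andbA => /and5P[ux uy up uq /andP[ur ud]].
      by case: tr => _ ->; rewrite !inE (negPf ux) (negPf uy) (negPf ur).
  have [|||||U _ _ _] := @del_exc T e esym eirr nz IH [:: x; y; p; q; r] x d g g.
  - by allneq.
  - by rewrite mem_head.
  - by rewrite dx.
  - by exists d; [allneq|exact: deg_pos edq].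
  - move=> w; rewrite !inE !negb_or => /and5P[wx wy wp wq wr] w0.
    rewrite /= ![e w _]esym Nx Ny Np Nq Nr !inE.
    have v3 : 3 <= deg e w by apply: (trio_ge3' tr).
    rewrite (negPf wx) (negPf wy) (negPf wp) (negPf wq) (negPf wr) /=.
    eqcase w d; eqcase w g; try solve [subst; contra_hyp]; count_goal.
  - by move: U; rewrite /= !inE eqxx andbF.
have c3 : 3 <= deg e c.
  by apply: (trio_ge3' tr) => //; rewrite 1?eq_sym //; apply: deg_pos ecp.
have [|||||_ _ _ P] := @del_exc T e esym eirr nz IH [:: x; y; p; q] x r c d.
- by allneq.
- by rewrite mem_head.
- by rewrite dx.
- by exists d; [allneq|exact: deg_pos edq].
- move=> w; rewrite !inE !negb_or => /and4P[wx wy wp wq] w0.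
  rewrite /= ![e w _]esym Nx Ny Np Nq !inE.
  rewrite (negPf wx) (negPf wy) (negPf wp) (negPf wq) /=.
  eqcase w r; first by subst w; rewrite !(eq_sym r) (negPf ncr) (negPf ndr) (deg_ge2 dn1).
  have v3 : 3 <= deg e w by apply: (trio_ge3' tr).
  eqcase w c; eqcase w d; try solve [subst; contra_hyp]; count_goal.
set e' := red e [:: x; y; p; q] x [::] in P.
have s' : symmetric e' by apply: red_sym.
have i' : irreflexive e' by apply: red_irr.
have e'e u v : u \notin [:: x; y; p; q] -> v \notin [:: x; y; p; q] -> e' u v = e u v.
  by move=> uy vy; rewrite /e' del_rel uy vy !andbT.
have subr u v : e' u v -> e u v by rewrite /e' del_rel => /and3P[].
have Ds v : v \in [:: x; y; p; q] -> v \notin supp e'.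
  by move=> vD; apply/suppP => -[u]; rewrite /e' del_rel vD andbF.
have xs : x \notin supp e' by apply: Ds; rewrite !inE eqxx.
have ys : y \notin supp e' by apply: Ds; rewrite !inE eqxx !orbT.
have ps : p \notin supp e' by apply: Ds; rewrite !inE eqxx !orbT.
have qs : q \notin supp e' by apply: Ds; rewrite !inE eqxx !orbT.
have L2 : linked e' (supp e') c d 2 -> False.
  move=> L.
  have L' : linked e (supp e') c d 2 by apply: linked_rel L => i j _ _; apply: subr.
  apply: (nozero_close (w := [:: q; x; p]) nz L') => //=.
  - by rewrite edq eqx exp epc.
  - by allneq.
  - by rewrite qs xs ps.
case: P => ex; first last.
- by have [[_ _ _ _ L] _] := exc_links s' i' ex; case: L2; apply: linked_sym.
- by have [[_ _ _ _ L] _] := exc_links s' i' ex; case: L2.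
case: ex => [h|].
  have [S [s [t [_ _ _ _ _]]]] := h; have [S' h' _] := exc_twin_core h.
  have [_ L] := core_len s' h'; case: L2; apply: (linked_supp s' ncd L).
case=> S [s [t [h cS dS _ [N'c N'd sp]]]].
have [[sS tS rS] [nst _ _]] := core_in h; have SS := core_supp s' i' h.
have xS : x \notin S by apply: contra xs; apply: SS.
have yS : y \notin S by apply: contra ys; apply: SS.
have pS : p \notin S by apply: contra ps; apply: SS.
have qS : q \notin S by apply: contra qs; apply: SS.
have DS v : v \in S -> v \notin [:: x; y; p; q] by move=> vS; allneq.
have cD : c \notin [:: x; y; p; q] by allneq.
have dD : d \notin [:: x; y; p; q] by allneq.
have hS : core e r false S s t.
  by apply: (core_ext h) => u v uS vS; apply: e'e; apply: DS.
have NcS : {in S, forall v, e c v = (v == s)}.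
  move=> v vS; rewrite -(e'e _ _ cD (DS v vS)) N'c.
  by have -> : v == d = false by apply/negbTE; neq.
have NdS : {in S, forall v, e d v = (v == t)}.
  move=> v vS; rewrite -(e'e _ _ dD (DS v vS)) N'd.
  by have -> : v == c = false by apply/negbTE; neq.
have ecd : e c d by rewrite -e'e // N'c eqxx.
have h4 : core e r true (c |: (d |: (p |: (q |: S)))) p q.
  apply: (core_C4 hS) => //.
  - by allneq.
  - move=> v vS; rewrite Np !inE; apply/negbTE.
    by rewrite !negb_or; allneq.
  - move=> v vS; rewrite Nq !inE; apply/negbTE.
    by rewrite !negb_or; allneq.
  - by rewrite Np !inE !negb_or; allneq.
  - by rewrite Nq !inE !negb_or; allneq.
exists r, x, y; left.
apply: (core_exc_twin esym eirr); first apply: (core_twins h4 (x := x) (y := y)) => //.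
- by allneq.
- by allneq.
- by move=> v _; rewrite Nx !inE.
- by move=> v _; rewrite Ny !inE.
move=> u v uv; rewrite !inE.
eqcase u x => //; eqcase u y => //; eqcase u p; first by rewrite !orbT.
eqcase u q; first by rewrite !orbT.
eqcase v x; first by subst v; move: uv; rewrite esym Nx !inE => /orP[]/eqP ?; subst; contra_hyp.
eqcase v y; first by subst v; move: uv; rewrite esym Ny !inE => /orP[]/eqP ?; subst; contra_hyp.
eqcase v p.
  by subst v; move: uv; rewrite esym Np !inE => /or3P[]/eqP ?; subst; try contra_hyp; rewrite ?eqxx ?orbT.
eqcase v q.
  by subst v; move: uv; rewrite esym Nq !inE => /or3P[]/eqP ?; subst; try contra_hyp; rewrite ?eqxx ?orbT.
have := sp u v; rewrite e'e // ?uv; try by allneq.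
by move/(_ isT); rewrite !inE => /or3P[]->; rewrite ?orbT.
Qed.

Lemma deg2_twins r x y p q : trio e r x y -> indep e r x y -> p != q ->
  (forall u, e x u = (u \in [:: p; q])) -> (forall u, e y u = (u \in [:: p; q])) ->
  exists r p q, exc e r p q.
Proof.
move=> tr ind npq Nx Ny; have nqp : q != p by rewrite eq_sym.
have Nx' u : e x u = (u \in [:: q; p]) by rewrite Nx !inE orbC.
have Ny' u : e y u = (u \in [:: q; p]) by rewrite Ny !inE orbC.
case: (leqP 4 (deg e p)) => [p4|p4]; first exact: twins_big tr ind npq Nx Ny p4.
case: (leqP 4 (deg e q)) => [q4|q4]; first exact: twins_big tr ind nqp Nx' Ny' q4.
have [nrx nry nxy] := trio_uniq tr; have /and3P[nerx nery nexy] := ind.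
have exp : e x p by rewrite Nx !inE eqxx.
have exq : e x q by rewrite Nx !inE eqxx orbT.
have epx : e p x by rewrite esym.
have eqx : e q x by rewrite esym.
have epy : e p y by rewrite esym Ny !inE eqxx.
have eqy : e q y by rewrite esym Ny !inE eqxx orbT.
have npr : p != r by apply: contraNneq nerx => <-.
have nqr : q != r by apply: contraNneq nerx => <-.
have npy : p != y by apply: contraNneq nexy => <-.
have nqy : q != y by apply: contraNneq nexy => <-.
have npx : p != x by neq.
have nqx : q != x by neq.
have p3 : deg e p = 3.
  by apply/eqP; rewrite eqn_leq -ltnS p4 (trio_ge3' tr) // (deg_pos epx).
have q3 : deg e q = 3.
  by apply/eqP; rewrite eqn_leq -ltnS q4 (trio_ge3' tr) // (deg_pos eqx).
have [c [uc Np]] := deg3_other p3 epx epy nxy.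
have [d [ud Nq]] := deg3_other q3 eqx eqy nxy.
(* The remaining case [d = r], [c != r] becomes [c = r] when [p] and [q] are exchanged. *)
case: (boolP ((c == r) || (d != r))) => [/orP cr|].
  exact: twins_tri tr ind npq Nx Ny uc ud Np Nq cr.
rewrite negb_or negbK => /andP[_ dr].
by apply: twins_tri tr ind nqp Nx' Ny' ud uc Nq Np _; left.
Qed.
End Twins.

(** * Vertices of degree 2 with a neighbour of degree at least 4 *)

Definition twins (T : finType) (e : rel T) (u v : T) : Prop := e u =1 e v.

Section BigNbr.
Variables (T : finType) (e : rel T).
Hypotheses (esym : symmetric e) (eirr : irreflexive e) (nz : nozero e).
Hypotheses (dn1 : forall v, deg e v != 1) (IH : smaller_exc e).

(** All cycles close through [a - x - b]. The paths from [b] into the core and the two or three ways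
    out of it to [a] leave no admissible residue, whether the pair [y], [a] consists of twins or is
    adjacent. *)
Lemma big_nbr_aux r x y a b : trio e r x y -> indep e r x y -> ~ twins e x y -> a != b ->
  (forall u, e x u = (u \in [:: a; b])) -> exc (red e [:: x] x [::]) r y a -> False.
Proof.
move=> tr /and3P[nerx nery nexy] ntw nab Nx; have [nrx nry nxy] := trio_uniq tr.
set e' := red e [:: x] x [::].
have s' : symmetric e' by apply: red_sym.
have i' : irreflexive e' by apply: red_irr.
have e'e u v : u != x -> v != x -> e' u v = e u v.
  by move=> uy vy; rewrite /e' del_rel !inE uy vy !andbT.
have subr u v : e' u v -> e u v by rewrite /e' del_rel => /and3P[].
have xs : x \notin supp e'.
  by apply/suppP => -[u]; rewrite /e' del_rel mem_head andbF.
have exa : e x a by rewrite Nx mem_head.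
have exb : e x b by rewrite Nx !inE eqxx orbT.
have eax : e a x by rewrite esym.
have ebx : e b x by rewrite esym.
have nax : a != x by neq.
have nbx : b != x by neq.
have nbr : b != r by apply: contraNneq nerx => <-.
have nby : b != y by apply: contraNneq nexy => <-.
have neab : ~~ e a b.
  by apply/negP => eab; apply: (no_triangle eirr nz (a:=a) (b:=b) (c:=x)).
have b3 : 3 <= deg e b by apply: (trio_ge3' dn1 tr); rewrite ?(deg_pos ebx).
have [||c cl ebc] := @deg_more T e [:: x] b; [by []|exact: ltnW|].
have bs (V : {set T}) : spans e' V -> b \in V.
  move=> sp; apply: (sp b c); rewrite e'e //.
  by move: cl; rewrite inE.
case=> [[S [s [t [h yS aS _ [Ny Na sp]]]]]|[S [s [t [h yS aS _ [Ny Na sp]]]]]].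
  have [[sS tS rS] [nst nrs nrt]] := core_in h.
  have xS : x \notin S by apply: contra xs; apply: (core_supp s' i' h).
  have bS : b \in S.
    by move: (bs _ sp); rewrite !inE (negPf nby) eq_sym (negPf nab).
  have eys : e y s by apply: subr; rewrite Ny eqxx.
  have eyt : e y t by apply: subr; rewrite Ny eqxx orbT.
  have eas : e a s by apply: subr; rewrite Na eqxx.
  have eat : e a t by apply: subr; rewrite Na eqxx orbT.
  have esy : e s y by rewrite esym.
  have esa : e s a by rewrite esym.
  have ety : e t y by rewrite esym.
  have eta : e t a by rewrite esym.
  have nbs : b != s by apply: contraNneq neab => ->.
  have nbt : b != t by apply: contraNneq neab => ->.
  have [j [k [Lj Lk Ljk]]] := core_split s' h bS nbs nbt.
  have one s0 t0 i : s0 \in S -> t0 \in S -> e s0 a -> e s0 y -> e y t0 -> e t0 a ->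
      s0 != t0 -> linked e' (S :\ t0) b s0 i -> i = 2 %[mod 3].
    move=> s0S t0S s0a s0y yt0 t0a nst0 L.
    have L' : linked e (S :\ t0) b s0 i by apply: linked_rel L => u v _ _; apply: subr.
    have := nozero_close (w := [:: a; x]) nz L'; rewrite /= s0a eax exb /= inE nax /=.
    rewrite !inE (negPf aS) (negPf xS) !andbF /= => /(_ isT isT isT) H1.
    have := nozero_close (w := [:: y; t0; a; x]) nz L'.
    rewrite /= s0y yt0 t0a eax exb /= => H2.
    have {}H2 := H2 isT.
    have: (i + 4).+1 %% 3 <> 0 by apply: H2; allneq.
    by move: H1; clear; lia.
  have Ej := one s t j sS tS esa esy eyt eta nst Lj.
  have nts : t != s by rewrite eq_sym.
  have Ek := one t s k tS sS eta ety eys esa nts Lk.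
  have L' : linked e S s t (j + k) by apply: linked_rel Ljk => u v _ _; apply: subr.
  case: (nozero_close (w := [:: y]) nz L') => /=.
  - by rewrite ety eys.
  - by [].
  - by rewrite yS.
  - by move: Ej Ek; clear; lia.
have [[sS tS rS] [nst nrs nrt]] := core_in h.
have [S0 [p [q [ES h0 sS0 tS0 [_ nest Ns Nt]]]]] := core_false_inv h.
have [[pS qS rS0] [npq _ _]] := core_in h0.
have xS : x \notin S by apply: contra xs; apply: (core_supp s' i' h).
have sub v : v \in S0 -> v \in S by rewrite ES !inE => ->; rewrite !orbT.
have xS0 : x \notin S0 by apply: contra xS; apply: sub.
have yS0 : y \notin S0 by apply: contra yS; apply: sub.
have aS0 : a \notin S0 by apply: contra aS; apply: sub.
have eya : e y a by apply: subr; rewrite Ny eqxx.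
have eys : e y s by apply: subr; rewrite Ny eqxx orbT.
have eat : e a t by apply: subr; rewrite Na eqxx orbT.
have esy : e s y by rewrite esym.
have eta : e t a by rewrite esym.
have esp : e s p by apply: subr; rewrite Ns // eqxx.
have esq : e s q by apply: subr; rewrite Ns // eqxx orbT.
have etp : e t p by apply: subr; rewrite Nt // eqxx.
have etq : e t q by apply: subr; rewrite Nt // eqxx orbT.
have eps : e p s by rewrite esym.
have ept : e p t by rewrite esym.
have eqt : e q t by rewrite esym.
(* If [b = s], then [y] has the neighbours [a] and [b] and is a twin of [x]. *)
have nbs : b != s.
  apply/eqP => Eb; apply: ntw => u; rewrite Nx.
  have dy : deg e y = 2 by apply: (trio_deg2 tr); rewrite !inE eqxx !orbT.
  rewrite (@deg_full T e [:: a; b] y) //=.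
  - by rewrite inE nab.
  - by rewrite eya Eb eys.
have nbt : b != t by apply: contraNneq neab => ->.
have bS0 : b \in S0.
  move: (bs _ sp); rewrite ES !inE (negPf nby) [b == a]eq_sym (negPf nab).
  by rewrite (negPf nbs) (negPf nbt).
have [L2 _] := core_len s' h0.
have L2' : linked e S0 p q 2 by apply: linked_rel L2 => u v _ _; apply: subr.
case: (eqVneq b p) => [Ebp|nbp].
  subst b; case: (nozero_close (w := [:: t; a; x]) nz L2') => //=.
  - by rewrite eqt eta eax exb.
  - by allneq.
  - by allneq.
case: (eqVneq b q) => [Ebq|nbq].
  subst b; case: (nozero_close (w := [:: t; a; x]) nz (linked_sym esym L2')) => //=.
  - by rewrite ept eta eax exb.
  - by allneq.
  - by allneq.
have [j [k [Lj _ _]]] := core_split s' h0 bS0 nbp nbq.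
have Lj' : linked e (S0 :\ q) b p j by apply: linked_rel Lj => u v _ _; apply: subr.
(* Detours from [p] to [b] with 3, 4 and 5 inner vertices forbid every residue of [j]. *)
have H0 : (j + 3).+1 %% 3 <> 0.
  apply: (nozero_close (w := [:: t; a; x]) nz Lj') => /=.
  - by rewrite ept eta eax exb.
  - by allneq.
  - by allneq.
have H1 : (j + 4).+1 %% 3 <> 0.
  apply: (nozero_close (w := [:: s; y; a; x]) nz Lj') => /=.
  - by rewrite eps esy eya eax exb.
  - by allneq.
  - by allneq.
have H2 : (j + 5).+1 %% 3 <> 0.
  apply: (nozero_close (w := [:: s; q; t; a; x]) nz Lj') => /=.
  - by rewrite eps esq eqt eta eax exb.
  - by allneq.
  - by allneq.
by move: H0 H1 H2; clear; lia.
Qed.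

(** As [b] keeps degree at least 3 when [x] is deleted, the candidates for degree 2 are [r], [y] and
    [a]. Roots [r] and [y] are symmetric; root [a] would make [r] and [y] twins or adjacent. *)
Lemma big_nbr r x y a b : trio e r x y -> indep e r x y ->
  ~ twins e r x -> ~ twins e r y -> ~ twins e x y -> a != b ->
  (forall u, e x u = (u \in [:: a; b])) -> 4 <= deg e b -> False.
Proof.
move=> tr ind nt1 nt2 nt3 nab Nx b4; have /and3P[nerx nery nexy] := ind.
have [nrx nry nxy] := trio_uniq tr.
have exa : e x a by rewrite Nx mem_head.
have exb : e x b by rewrite Nx !inE eqxx orbT.
have eax : e a x by rewrite esym.
have ebx : e b x by rewrite esym.
have nar : a != r by apply: contraNneq nerx => <-.
have nbr : b != r by apply: contraNneq nerx => <-.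
have nay : a != y by apply: contraNneq nexy => <-.
have nby : b != y by apply: contraNneq nexy => <-.
have dx : deg e x = 2 by apply: (trio_deg2 tr); rewrite !inE eqxx !orbT.
have [|||||_ _ _ P] := @del_exc T e esym eirr nz IH [:: x] x r y a.
- by [].
- by rewrite mem_head.
- by rewrite dx.
- by exists b; [allneq|apply: leq_trans b4].
- move=> v; rewrite !inE => vx v0; rewrite /= addn0 ![e v _]esym Nx !inE.
  eqcase v r; first by subst v; rewrite !(eq_sym r) (negPf nar) (negPf nbr) (deg_ge2 dn1).
  eqcase v y; first by subst v; rewrite !(eq_sym y) (negPf nay) (negPf nby) (deg_ge2 dn1).
  have v3 : 3 <= deg e v by apply: (trio_ge3' dn1 tr).
  eqcase v b; first by subst v; rewrite (eq_sym b) (negPf nab); move: b4; clear; lia.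
  by eqcase v a; count_goal.
have s' : symmetric (red e [:: x] x [::]) by apply: red_sym.
have i' : irreflexive (red e [:: x] x [::]) by apply: red_irr.
have tr' : trio e y x r by apply: (trio_swap (trio_rot (trio_rot tr))).
case: P => ex.
- exact: (big_nbr_aux tr ind nt3 nab Nx ex).
- apply: (big_nbr_aux tr' _ _ nab Nx ex); last by move=> h; apply: nt1 => u; rewrite h.
  by rewrite /indep esym nexy esym nery esym nerx.
- have e'e u v : u != x -> v != x -> red e [:: x] x [::] u v = e u v.
    by move=> uy vy; rewrite del_rel !inE uy vy !andbT.
  have nyx : y != x by rewrite eq_sym.
  case: ex => [[S [s [t [_ _ _ _ [Nr Ny _]]]]]|[S [s [t [_ _ _ _ [Nr _ _]]]]]].
    apply: nt2 => u; eqcase u x.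
      by subst u; rewrite (negPf nerx) esym (negPf nexy).
    by rewrite -(e'e r u) // -(e'e y u) // Nr Ny.
  by move: nery; rewrite -e'e // Nr eqxx.
Qed.
End BigNbr.

(** * Vertices of degree 2 with a common neighbour *)

Section Shared.
Variables (T : finType) (e : rel T).
Hypotheses (esym : symmetric e) (eirr : irreflexive e) (nz : nozero e).
Hypotheses (dn1 : forall v, deg e v != 1) (IH : smaller_exc e).

(** The 5-cycle [x q r w u] is deleted and [d] is joined to [c1], which stands for the path
    [d q x u c1] of length 4; an old edge between them would give a 6-cycle. Only [c2] loses an edge
    in the balance, so at most [y] and [c2] have degree 2. *)
Lemma pentagon r x y q u w d c1 c2 : trio e r x y -> indep e r x y -> e u w ->
  (forall v, e x v = (v \in [:: q; u])) -> (forall v, e r v = (v \in [:: q; w])) ->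
  (forall v, e q v = (v \in [:: x; r; d])) ->
  (forall v, e u v = (v \in [:: x; w; c1])) -> (forall v, e w v = (v \in [:: r; u; c2])) ->
  uniq [:: x; r; d] -> uniq [:: x; w; c1] -> uniq [:: r; u; c2] -> u != q ->
  d != c1 -> c2 != y -> False.
Proof.
move=> tr /and3P[nerx nery nexy] euw Nx Nr Nq Nu Nw.
have [nrx nry nxy] := trio_uniq tr.
rewrite /= !inE !negb_or => /and3P[/andP[nxr nxd] nrd _] /and3P[/andP[nxw nxc] nwc _].
move=> /and3P[/andP[nru nrc2] nuc2 _] nuq ndc1 nc2y.
have exq : e x q by rewrite Nx !inE eqxx.
have exu : e x u by rewrite Nx !inE eqxx orbT.
have erq : e r q by rewrite Nr !inE eqxx.
have erw : e r w by rewrite Nr !inE eqxx orbT.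
have eqd : e q d by rewrite Nq !inE eqxx !orbT.
have euc : e u c1 by rewrite Nu !inE eqxx !orbT.
have ewc : e w c2 by rewrite Nw !inE eqxx !orbT.
have edq : e d q by rewrite esym.
have eqx : e q x by rewrite esym.
have eux : e u x by rewrite esym.
have ewr : e w r by rewrite esym.
have ecu : e c1 u by rewrite esym.
have ecw : e c2 w by rewrite esym.
have ewu : e w u by rewrite esym.
have nuw : u != w by neq.
have nwq : w != q by apply/eqP => E; subst w; apply: (no_triangle eirr nz (a:=x) (b:=q) (c:=u)).
have ncq : c1 != q by apply/eqP => E; subst c1; apply: (no_triangle eirr nz (a:=x) (b:=q) (c:=u)).
have nc1r : c1 != r.
  by apply/eqP => E; subst c1; move: ecu; rewrite Nr !inE (negPf nuq) (negPf nuw).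
have nc2x : c2 != x.
  by apply/eqP => E; subst c2; move: ecw; rewrite Nx !inE (negPf nwq) eq_sym (negPf nuw).
have ndw : d != w by apply/eqP => E; subst d; apply: (no_triangle eirr nz (a:=r) (b:=q) (c:=w)).
have ndu : d != u by apply/eqP => E; subst d; apply: (no_triangle eirr nz (a:=x) (b:=q) (c:=u)).
have nedc : ~~ e d c1.
  apply/negP => edc; apply: (negP (nz (s := [:: d; c1; u; w; r; q]) _)) => //; split=> //.
    by allneq.
  by rewrite /= edc ecu euw ewr erq eqd.
have [||||||||||||U _ _ _] := @red_exc T e esym eirr [:: x; q; r; w; u] d [:: c1] x y c2 c2 nz IH.
- by allneq.
- by [].
- by rewrite inE.
- by move=> v; rewrite inE => /eqP->.
- by move=> v; rewrite inE => /eqP->; allneq.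
- by left; allneq.
- move=> v; rewrite inE => /eqP->; exists [:: q; x; u]; split=> //=.
  + by rewrite edq eqx exu euc.
  + by allneq.
  + by move=> s; rewrite !inE => /or3P[]->; rewrite ?orbT.
- by move=> v v'; rewrite !inE => /eqP-> /eqP->; rewrite eqxx.
- by rewrite mem_head.
- exact: deg_pos exq.
- by exists d; [allneq|exact: deg_pos edq].
- move=> v; rewrite !inE !negb_or => /and5P[vx vq vr vw vu] v0.
  rewrite /= addn0 ![e v _]esym Nx Nq Nr Nw Nu !inE.
  rewrite (negPf vx) (negPf vq) (negPf vr) (negPf vw) (negPf vu) /=.
  have v2 := deg_ge2 dn1 v0.
  have nyc2 : (y == c2) = false by rewrite eq_sym (negPf nc2y).
  eqcase v y; first by subst v; rewrite nyc2; split=> //; move: v2; clear; lia.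
  have v3 : 3 <= deg e v by apply: (trio_ge3' dn1 tr).
  by case: (v == c2) => /=; (split; [move: v3; clear; lia|try done; move: v3; clear; lia]).
- by move: U; rewrite /= !inE eqxx andbF.
Qed.

(** The path [r q x u] of length 3 is contracted: [r] takes over the other neighbours [c1], [d1] of
    [u], and at most [y] and the third neighbour [d] of [q] have degree 2. If [u] and [w] are
    adjacent, the contraction would double the edge from [r] to [w], and [pentagon] is used instead.
    If [d = y], then [y] would drop to degree 1 and is deleted as well. *)
Lemma shared_nbr r x y q : trio e r x y -> indep e r x y ->
  ~ twins e r x -> ~ twins e r y -> ~ twins e x y ->
  (forall u v, deg e u = 2 -> e u v -> deg e v = 3) -> e x q -> e r q -> False.
Proof.
move=> tr ind nt1 nt2 nt3 H3 exq erq; have /and3P[nerx nery nexy] := ind.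
have [nrx nry nxy] := trio_uniq tr.
have dr : deg e r = 2 by apply: (trio_deg2 tr); rewrite !inE eqxx.
have dx : deg e x = 2 by apply: (trio_deg2 tr); rewrite !inE eqxx orbT.
have dy : deg e y = 2 by apply: (trio_deg2 tr); rewrite !inE eqxx !orbT.
have [u [nqu Nx]] := deg2_other dx exq.
have [w [nqw Nr]] := deg2_other dr erq.
have nuw : u != w.
  by apply/eqP => E; apply: nt1 => v; rewrite Nx Nr E.
have exu : e x u by rewrite Nx !inE eqxx orbT.
have erw : e r w by rewrite Nr !inE eqxx orbT.
have eqx : e q x by rewrite esym.
have eqr : e q r by rewrite esym.
have eux : e u x by rewrite esym.
have ewr : e w r by rewrite esym.
have nxr : x != r by rewrite eq_sym.
have [d [ud Nq]] := deg3_other (H3 _ _ dx exq) eqx eqr nxr.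
have := ud; rewrite /= !inE !negb_or => /and3P[/andP[_ nxd] nrd _].
have eqd : e q d by rewrite Nq !inE eqxx !orbT.
have nru : r != u by apply: contraNneq nerx => ->; rewrite esym.
have nwx : w != x by apply: contraNneq nerx => <-.
have yxtwin s t : (forall v, e y v = (v \in [:: s; t])) ->
    (forall v, e x v = (v \in [:: s; t])) -> False.
  by move=> h1 h2; apply: nt3 => v; rewrite h1 h2.
have [euw|neuw] := boolP (e u w).
  have ewu : e w u by rewrite esym.
  have nxw : x != w by rewrite eq_sym.
  have [c1 [uc1 Nu]] := deg3_other (H3 _ _ dx exu) eux euw nxw.
  have [c2 [uc2 Nw]] := deg3_other (H3 _ _ dr erw) ewr ewu nru.
  have euc : e u c1 by rewrite Nu !inE eqxx !orbT.
  have ewc : e w c2 by rewrite Nw !inE eqxx !orbT.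
  have ncc : c1 != c2.
    apply/eqP => E; subst c2; apply: (no_triangle eirr nz (a:=u) (b:=w) (c:=c1)) => //.
    by rewrite esym.
  have nuq : u != q by rewrite eq_sym.
  have nwq : w != q by rewrite eq_sym.
  have first_way : d != c1 -> c2 != y -> False.
    exact: (pentagon tr ind euw Nx Nr Nq Nu Nw ud uc1 uc2 nuq).
  have second_way : d != c2 -> c1 != y -> False.
    have tr' : trio e x r y by apply: trio_swap (trio_rot tr).
    have ind' : indep e x r y by rewrite /indep esym nerx nexy nery.
    have ud' : uniq [:: r; x; d] by move: ud; rewrite /= !inE !negb_or => /and3P[/andP[? ?] ? _]; allneq.
    have Nq' v : e q v = (v \in [:: r; x; d]) by rewrite Nq !inE orbCA.
    exact: (pentagon tr' ind' ewu Nr Nx Nq' Nw Nu ud' uc2 uc1 nwq).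
  (* The pentagon can be opened on either side. If both ways are blocked, [y] is a twin of [x] or of
     [r]. *)
  case: (eqVneq c2 y) => [Ec2|nc2y]; last first.
    case: (eqVneq d c1) => [Edc|ndc]; last exact: first_way.
    subst c1; case: (eqVneq d y) => [Edy|ndy]; last exact: second_way.
    subst d; have eyq : e y q by rewrite esym.
    have eyu : e y u by rewrite esym.
    apply: (yxtwin q u) => //; apply: deg_full; rewrite /= ?dy ?eyq ?eyu //.
    by rewrite inE nqu.
  subst c2; case: (eqVneq d y) => [Edy|ndy]; last exact: second_way.
  subst d; apply: nt2 => v; rewrite Nr; symmetry; apply: deg_full => //=.
  - by rewrite inE nqw.
  - by rewrite esym eqd esym ewc.
have [c1 [d1 [uc Nu]]] := deg3_others (H3 _ _ dx exu) eux.
have := uc; rewrite /= !inE !negb_or => /and3P[/andP[nxc nxd1] ncd _].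
have euc : e u c1 by rewrite Nu !inE eqxx !orbT.
have Bgood v : v \in [:: c1; d1] -> [/\ e u v, v != x, v != u, v != q & v != r /\ v != w].
  move=> vB; have euv : e u v by rewrite Nu in_cons vB orbT.
  have evu : e v u by rewrite esym.
  split=> //.
  - by move: vB; rewrite !inE => /orP[]/eqP->; rewrite eq_sym.
  - by neq.
  - by apply/eqP => E; subst v; apply: (no_triangle eirr nz (a:=x) (b:=q) (c:=u)).
  - split; last by apply: contraNneq neuw => <-.
    by apply/eqP => E; subst v; move: evu; rewrite Nr !inE !(eq_sym u) (negPf nqu) eq_sym (negPf nuw).
have joinB D : {subset [:: q; x; u] <= D} ->
    {in [:: c1; d1], forall b, joins e D r b 0}.
  move=> sub b /Bgood[eub _ _ _ _]; exists [:: q; x; u]; split=> //=.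
  - by rewrite erq eqx exu eub.
  - by allneq.
have joinBB D : u \in D -> {in [:: c1; d1] &, forall b b', b != b' -> joins e D b b' 1}.
  move=> uD b b' /Bgood[eub _ _ _ _] /Bgood[eub' _ _ _ _] _; exists [:: u]; split=> //=.
  - by rewrite esym eub eub'.
  - by move=> v; rewrite inE => /eqP->.
have rNB : {in [:: c1; d1], forall b, ~~ e r b}.
  move=> b /Bgood[_ _ _ bq [br bw]]; rewrite Nr !inE negb_or; exact/andP.
have rB : r \notin [:: c1; d1].
  by apply/negP => /Bgood[_ _ _ _ []]; rewrite eqxx.
have uB : uniq [:: c1; d1] by rewrite /= inE ncd.
case: (eqVneq d y) => [Edy|ndy].
  subst d; have eyq : e y q by rewrite esym.
  have [g [nqg Ny]] := deg2_other dy eyq.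
  have eyg : e y g by rewrite Ny !inE eqxx orbT.
  have ngu : g != u.
    by apply/eqP => E; subst g; apply: (yxtwin q u).
  have ngr : g != r by apply: contraNneq nery => <-; rewrite esym.
  have yB : y \notin [:: c1; d1].
    apply/negP => yB; have [euy _ _ _ _] := Bgood y yB.
    by move: euy; rewrite esym Ny !inE !(eq_sym u) (negPf nqu) (negPf ngu).
  have [||||||||||||U _ _ _] := @red_exc T e esym eirr [:: x; q; u; y] r [:: c1; d1] x g g g nz IH.
  - by allneq.
  - by [].
  - by [].
  - by [].
  - move=> b bB; have [_ bx bu bq _] := Bgood b bB; rewrite !inE !negb_or bx bu bq /=.
    by apply: contraNneq yB => <-.
  - by left; allneq.
  - by apply: joinB => v; rewrite !inE => /or3P[]->; rewrite ?orbT.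
  - by apply: joinBB; rewrite !inE eqxx !orbT.
  - by rewrite mem_head.
  - exact: deg_pos exq.
  - by exists r; [allneq|exact: deg_pos erq].
  - move=> v; rewrite !inE !negb_or => /and4P[vx vq vu vy] v0.
    rewrite /= addn0 ![e v _]esym Nx Nq Nu Ny !inE.
    rewrite (negPf vx) (negPf vq) (negPf vu) (negPf vy) /= !orbF.
    eqcase v r.
      subst v; rewrite dr [r == g]eq_sym (negPf ngr).
      by move: rB; rewrite !inE !negb_or => /andP[/negPf-> /negPf->].
    have v3 : 3 <= deg e v by apply: (trio_ge3' dn1 tr).
    by case: (v == g); case: (v == c1); case: (v == d1);
      (split; [move: v3; clear; lia|try done; move: v3; clear; lia]).
  - by move: U; rewrite /= !inE eqxx.
have [||||||||||||U _ _ _] := @red_exc T e esym eirr [:: x; q; u] r [:: c1; d1] x y d d nz IH.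
- by allneq.
- by [].
- by [].
- by [].
- by move=> b bB; have [_ bx bu bq _] := Bgood b bB; rewrite !inE !negb_or bx bu bq.
- by left; allneq.
- by apply: joinB => v; rewrite !inE => /or3P[]->; rewrite ?orbT.
- by apply: joinBB; rewrite !inE eqxx !orbT.
- by rewrite mem_head.
- exact: deg_pos exq.
- by exists r; [allneq|exact: deg_pos erq].
- move=> v; rewrite !inE !negb_or => /and3P[vx vq vu] v0.
  rewrite /= addn0 ![e v _]esym Nx Nq Nu !inE.
  rewrite (negPf vx) (negPf vq) (negPf vu) /=.
  have v2 := deg_ge2 dn1 v0.
  eqcase v r.
    subst v; rewrite dr (negPf nrd) /=.
    by move: rB; rewrite !inE !negb_or => /andP[/negPf-> /negPf->].
  eqcase v d; last first.
    eqcase v y; first by case: (v == c1); case: (v == d1);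
      (split; [move: v2; clear; lia|try done; move: v2; clear; lia]).
    have v3 : 3 <= deg e v by apply: (trio_ge3' dn1 tr).
    by case: (v == c1); case: (v == d1);
      (split; [move: v3; clear; lia|try done; move: v3; clear; lia]).
  have v3 : 3 <= deg e v by apply: (trio_ge3' dn1 tr); subst v.
  by case: (v == c1); case: (v == d1);
      (split; [move: v3; clear; lia|try done; move: v3; clear; lia]).
- by move: U; rewrite /= !inE eqxx andbF.
Qed.
End Shared.

(** * Six distinct cubic neighbours *)

Section Merge.
Variables (T : finType) (e : rel T).
Hypotheses (esym : symmetric e) (eirr : irreflexive e) (nz : nozero e).
Hypotheses (dn1 : forall v, deg e v != 1) (IH : smaller_exc e).

Definition tight (r x y : T) : Prop :=
  [/\ trio e r x y,
      forall u v, deg e u = 2 -> e u v -> deg e v = 3,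
      forall u v, deg e u = 2 -> deg e v = 2 -> ~~ e u v &
      forall u v w, deg e u = 2 -> deg e v = 2 -> e u w -> e v w -> u = v].

Definition on_C4 (v : T) : Prop := deg e v = 2 /\
  exists a b c, [/\ e v a, e v b, a != b & [/\ c != v, e c a & e c b]].

Section Data.
Variables r x y q1 q2 c1 d1 c2 d2 : T.
Hypothesis tg : tight r x y.
Hypotheses (nq12 : q1 != q2) (u1 : uniq [:: x; c1; d1]) (u2 : uniq [:: x; c2; d2]).
Hypotheses (Nx : forall v, e x v = (v \in [:: q1; q2]))
  (N1 : forall v, e q1 v = (v \in [:: x; c1; d1]))
  (N2 : forall v, e q2 v = (v \in [:: x; c2; d2])).

Lemma tight_nbr v w : w \in [:: r; y] -> e x v -> ~~ e w v.
Proof.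
have [tr H3 Hadj Hsh] := tg; have [nrx nry nxy] := trio_uniq tr.
move=> wr xv; apply/negP => wv.
have dx : deg e x = 2 by apply: (trio_deg2 tr); rewrite !inE eqxx orbT.
have dw : deg e w = 2.
  by apply: (trio_deg2 tr); move: wr; rewrite !inE => /orP[]->; rewrite ?orbT.
have Ex := Hsh _ _ _ dw dx wv xv.
by move: wr; rewrite Ex !inE eq_sym (negPf nrx) (negPf nxy).
Qed.

Hypotheses (c2c1 : c2 != c1) (c2d1 : c2 != d1) (nec : ~~ e c2 c1) (ned : ~~ e c2 d1).

(* Contracting the path c2 - q2 - x - q1 of length 3 preserves cycle lengths modulo 3. *)
Let e' := red e [:: x; q1; q2] c2 [:: c1; d1].

(** The contraction raises the degree of [c2] by one, and exceptional graphs have maximum degree 4;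
    so [c2] is cubic in [e] and has degree 4 afterwards. Only [d2] loses an edge in the balance,
    hence it is the third vertex of degree 2 and was cubic. As root it would make [r] and [y] twins
    or adjacent. *)
Lemma merge_exc : [/\ uniq [:: r; y; d2],
  forall v, (deg e' v == 2) = (v \in [:: r; y; d2]),
  exc e' y r d2 \/ exc e' r y d2, deg e' c2 = 4 &
  deg e d2 = 3 /\ {in [:: r; y], forall w, e' w =1 e w}].
Proof.
have [tr H3 Hadj Hsh] := tg; have [nrx nry nxy] := trio_uniq tr.
have dr : deg e r = 2 by apply: (trio_deg2 tr); rewrite !inE eqxx.
have dx : deg e x = 2 by apply: (trio_deg2 tr); rewrite !inE eqxx orbT.
have dy : deg e y = 2 by apply: (trio_deg2 tr); rewrite !inE eqxx !orbT.
have [nxc1 nxd1 ncd1] : [/\ x != c1, x != d1 & c1 != d1].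
  by move: u1; rewrite /= !inE !negb_or => /and3P[/andP[? ?] ? _]; split.
have [nxc2 nxd2 ncd2] : [/\ x != c2, x != d2 & c2 != d2].
  by move: u2; rewrite /= !inE !negb_or => /and3P[/andP[? ?] ? _]; split.
have ex1 : e x q1 by rewrite Nx !inE eqxx.
have ex2 : e x q2 by rewrite Nx !inE eqxx orbT.
have e1c : e q1 c1 by rewrite N1 !inE eqxx !orbT.
have e1d : e q1 d1 by rewrite N1 !inE eqxx !orbT.
have e2c : e q2 c2 by rewrite N2 !inE eqxx !orbT.
have e2d : e q2 d2 by rewrite N2 !inE eqxx !orbT.
have e2x : e q2 x by rewrite esym.
have nq21 : ~~ e q1 q2.
  by apply/negP => h; apply: (no_triangle eirr nz (a:=x) (b:=q1) (c:=q2)).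
have ryN v : v \in [:: r; y] -> [/\ v != x, v != q1, v != q2, ~~ e v q1 & ~~ e v q2].
  move=> vry; have a1 := tight_nbr vry ex1; have a2 := tight_nbr vry ex2.
  have dv : deg e v = 2.
    by apply: (trio_deg2 tr); move: vry; rewrite !inE => /orP[]->; rewrite ?orbT.
  split=> //.
  - by move: vry; rewrite !inE => /orP[]/eqP->; rewrite // eq_sym.
  - by apply: contraNneq (Hadj _ _ dx dv) => ->.
  - by apply: contraNneq (Hadj _ _ dx dv) => ->.
have not2 v q : v != x -> e x q -> e q v -> v != r /\ v != y.
  move=> vx xq qv; split.
    by apply: contraTneq qv => ->; rewrite esym; apply: tight_nbr; rewrite // mem_head.
  by apply: contraTneq qv => ->; rewrite esym; apply: tight_nbr; rewrite // !inE eqxx orbT.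
have [c1r c1y] : c1 != r /\ c1 != y by apply: (not2 _ q1); rewrite // eq_sym.
have [d1r d1y] : d1 != r /\ d1 != y by apply: (not2 _ q1); rewrite // eq_sym.
have [c2r c2y] : c2 != r /\ c2 != y by apply: (not2 _ q2); rewrite // eq_sym.
have [d2r d2y] : d2 != r /\ d2 != y by apply: (not2 _ q2); rewrite // eq_sym.
have Nb q v : e q v -> q != v by move=> qv; neq.
have c2q2 : c2 != q2 by rewrite eq_sym Nb.
have d2q2 : d2 != q2 by rewrite eq_sym Nb.
have c2q1 : c2 != q1 by apply: contraNneq nq21 => <-; rewrite esym.
have d2q1 : d2 != q1 by apply: contraNneq nq21 => <-; rewrite esym.
have uD : uniq [:: x; q1; q2] by rewrite /= !inE !negb_or Nb // Nb // nq12.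
have uB : uniq [:: c1; d1] by rewrite /= inE ncd1.
have zB : c2 \notin [:: c1; d1] by rewrite !inE negb_or c2c1.
have zNB : {in [:: c1; d1], forall b, ~~ e c2 b}.
  by move=> b; rewrite !inE => /orP[]/eqP->.
have BD : {in [:: c1; d1], forall b, b \notin [:: x; q1; q2]}.
  by move=> b; rewrite !inE => /orP[]/eqP->; rewrite !negb_or 1?eq_sym; allneq.
have zD : c2 \notin [:: x; q1; q2] by allneq.
have c23 : 3 <= deg e c2.
  by apply: (trio_ge3' dn1 tr); rewrite ?(deg_pos (u := q2)) // 1?esym // eq_sym.
have [||||U D2 D4 P] := @red_exc T e esym eirr [:: x; q1; q2] c2 [:: c1; d1] x r y d2 nz IH
    uD uB zB zNB BD (or_introl zD) _ _ (mem_head _ _) (deg_pos ex1).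
- move=> b bB; exists [:: q2; x; q1]; split=> //=.
  + have -> : e q1 b by move: bB; rewrite !inE => /orP[]/eqP->.
    by rewrite esym e2c e2x ex1.
  + by allneq.
  + by move=> v; rewrite !inE => /or3P[]->; rewrite ?orbT.
- move=> b b' bB bB' _; exists [:: q1]; split=> //=.
  + have -> : e b q1 by move: bB; rewrite !inE esym => /orP[]/eqP->.
    by have -> : e q1 b' by move: bB'; rewrite !inE => /orP[]/eqP->.
  + by move=> v; rewrite !inE => ->; rewrite orbT.
- by exists c2 => //; apply: leq_trans c23.
- move=> v; rewrite !inE !negb_or => /and3P[vx v1 v2] v0.
  rewrite /= addn0 ![e v _]esym Nx N1 N2 !inE (negPf vx) (negPf v1) (negPf v2) /=.
  eqcase v r.
    by subst v; rewrite !(eq_sym r) (negPf c1r) (negPf d1r) (negPf c2r) (negPf d2r) dr.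
  eqcase v y.
    by subst v; rewrite !(eq_sym y) (negPf c1y) (negPf d1y) (negPf c2y) (negPf d2y) dy.
  have v3 : 3 <= deg e v by apply: (trio_ge3' dn1 tr).
  eqcase v c2.
    subst v; rewrite (negPf c2c1) (negPf c2d1) (negPf ncd2) /=.
    by split; [|move=> E; exfalso]; move: c23; [|rewrite -ltnS; move: E]; clear; lia.
  case: (v == c1); case: (v == d1); case: (v == d2) => /=;
    by (split; [move: v3; clear; lia|try done; move: v3; clear; lia]).
have s' : symmetric e' by apply: red_sym.
have i' : irreflexive e' by apply: red_irr.
have Dc2 : deg e' c2 = (deg e c2).+1.
  have := red_deg esym uD uB zB zNB zD BD (or_introl zD).
  rewrite /= ![e c2 _]esym Nx N1 N2 !inE eqxx (negPf c2c1) (negPf c2d1) (negPf c2q1) (negPf c2q2).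
  rewrite [c2 == x]eq_sym (negPf nxc2) /=; rewrite -/e'; clear; lia.
have d2D : d2 \notin [:: x; q1; q2] by allneq.
have Dd2 : deg e d2 = 3.
  have E2 : deg e' d2 = 2 by apply/eqP; rewrite D2 !inE eqxx !orbT.
  have := red_deg esym uD uB zB zNB d2D BD (or_introl zD); rewrite -/e' E2.
  rewrite /= ![e d2 _]esym Nx N1 N2 !inE eqxx (negPf d2q1) (negPf d2q2).
  rewrite [d2 == x]eq_sym (negPf nxd2) [d2 == c2]eq_sym (negPf ncd2) /=.
  by case: (d2 == c1); case: (d2 == d1); clear; lia.
have Nry : {in [:: r; y], forall w, e' w =1 e w}.
  move=> w /[dup] wry /ryN[wx w1 w2 n1 n2] v; rewrite /e' /red.
  have wc2 : w != c2 by move: wry; rewrite !inE => /orP[]/eqP->; rewrite eq_sym.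
  have wB : w \notin [:: c1; d1].
    by move: wry; rewrite !inE => /orP[]/eqP->; rewrite negb_or ![_ == c1]eq_sym ![_ == d1]eq_sym; apply/andP.
  rewrite (negPf wc2) (negPf wB) andbF !orbF.
  have -> : w \notin [:: x; q1; q2] by rewrite !inE !negb_or wx w1.
  case wv: (e w v) => //=; rewrite !inE !negb_or; apply/and3P; split.
  - apply: contraTneq wv => ->; rewrite esym Nx !inE negb_or; exact/andP.
  - by apply: contraTneq wv => ->.
  - by apply: contraTneq wv => ->.
have ry : r \in [:: r; y] by rewrite mem_head.
have yy : y \in [:: r; y] by rewrite !inE eqxx orbT.
have c24 : deg e' c2 = 4 by apply/eqP; rewrite eqn_leq D4 Dc2 ltnS.
suff R : exc e' y r d2 \/ exc e' r y d2 by split.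
rewrite -/e' in P; case: P => [ex|ex|]; [by right|by left|].
case=> [[S [s [t [_ _ _ _ [Nr Ny _]]]]]|[S [s [t [_ _ _ _ [Nr _ _]]]]]].
  have ers : e r s by rewrite -Nry // Nr eqxx.
  have eys : e y s by rewrite -Nry // Ny eqxx.
  by rewrite (Hsh _ _ _ dr dy ers eys) eqxx in nry.
have := Hadj _ _ dr dy; by rewrite -Nry // Nr eqxx.
Qed.

(** If [r0] and [d2] are twins, they and their neighbours form a 4-cycle, which lies in [e] unless
    it uses [c2]. An edge between [d2] and [c2] must be new, so [d2] is adjacent to both [q1] and
    [q2], and [x] lies on a 4-cycle. If [r0] and [d2] are adjacent, either [r0 c2 q2 d2] is a
    4-cycle or [c2] is an inner vertex of degree 4, and its fan gives a contradiction. *)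
Lemma merge_C4 r0 y0 : r0 \in [:: r; y] -> exc e' y0 r0 d2 -> exists v, on_C4 v.
Proof.
move=> r0ry ex.
have [[tr H3 Hadj Hsh] [U D2 _ Dc2 [Dd2 Nry]]] := (tg, merge_exc).
have [nrx nry nxy] := trio_uniq tr.
have dx : deg e x = 2 by apply: (trio_deg2 tr); rewrite !inE eqxx orbT.
have [nxc1 nxd1 ncd1] : [/\ x != c1, x != d1 & c1 != d1].
  by move: u1; rewrite /= !inE !negb_or => /and3P[/andP[? ?] ? _]; split.
have [nxc2 nxd2 ncd2] : [/\ x != c2, x != d2 & c2 != d2].
  by move: u2; rewrite /= !inE !negb_or => /and3P[/andP[? ?] ? _]; split.
have ex1 : e x q1 by rewrite Nx !inE eqxx.
have ex2 : e x q2 by rewrite Nx !inE eqxx orbT.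
have e2c : e q2 c2 by rewrite N2 !inE eqxx !orbT.
have e2d : e q2 d2 by rewrite N2 !inE eqxx !orbT.
have e1x : e q1 x by rewrite esym.
have e2x : e q2 x by rewrite esym.
have ec2 : e c2 q2 by rewrite esym.
have ed2 : e d2 q2 by rewrite esym.
have ecd : ~~ e d2 c2.
  by apply/negP => h; apply: (no_triangle eirr nz (a:=d2) (b:=c2) (c:=q2)).
have s' : symmetric e' by apply: red_sym.
have zB : c2 \notin [:: c1; d1] by rewrite !inE negb_or c2c1.
have i' : irreflexive e' by apply: red_irr.
have dr0 : deg e r0 = 2.
  by apply: (trio_deg2 tr); move: r0ry; rewrite !inE => /orP[]->; rewrite ?orbT.
have r0d2 : r0 != d2 by apply: contra_eq_neq Dd2 => <-; rewrite dr0.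
have Nr0 u : e' r0 u = e r0 u by apply: Nry.
have sub u v : u != c2 -> v != c2 -> e' u v -> [/\ e u v, u \notin [:: x; q1; q2] & v \notin [:: x; q1; q2]].
  by move=> uc vc; rewrite /e' /red (negPf uc) (negPf vc) !orbF => /and3P[? ? ?]; split.
have d2c2 : d2 != c2 by rewrite eq_sym.
have onx : e' d2 c2 -> on_C4 x.
  rewrite /e' /red (negPf ecd) /= (negPf d2c2) eqxx /= => d2B.
  split=> //; exists q1, q2, d2; split=> //; split=> //; first by rewrite eq_sym.
  by rewrite esym N1 in_cons d2B orbT.
case: ex => [[S [s [t [h r0S d2S _ [Nr Nd sp]]]]]|[S [s [t [h r0S d2S _ [Nr Nd sp]]]]]].
  have [_ [nst _ _]] := core_in h.
  have e's : e' d2 s by rewrite Nd eqxx.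
  have e't : e' d2 t by rewrite Nd eqxx orbT.
  case: (eqVneq s c2) => [E|ns]; first by exists x; apply: onx; rewrite -E.
  case: (eqVneq t c2) => [E|nt]; first by exists x; apply: onx; rewrite -E.
  exists r0; split=> //; exists s, t, d2; rewrite -!Nr0 !Nr !eqxx orbT; split=> //.
  split; first by rewrite eq_sym.
    by have [] := sub d2 s d2c2 ns e's.
  by have [] := sub d2 t d2c2 nt e't.
have e's : e' r0 s by rewrite Nr eqxx orbT.
have e't : e' d2 t by rewrite Nd eqxx orbT.
have e'd : e' r0 d2 by rewrite Nr eqxx.
have er0d : e r0 d2 by rewrite -Nr0.
case: (eqVneq t c2) => [E|nt]; first by exists x; apply: onx; rewrite -E.
case: (eqVneq s c2) => [E|ns].
  exists r0; split=> //; exists c2, d2, q2; split=> //; first by rewrite -Nr0 -E.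
  split=> //; by apply: contraTneq e2x => ->; apply: Hadj.
have [[sS tS _] [nst _ _]] := core_in h.
have r0c2 : r0 != c2.
  by apply: contra_eq_neq Dc2 => <-; have := D2 r0; rewrite in_cons; move: r0ry;
     rewrite !inE => /orP[]->; rewrite ?orbT => /eqP->.
have c2S : c2 \in S.
  have : c2 \in r0 |: (d2 |: S).
    have : 0 < deg e' c2 by rewrite Dc2.
    rewrite /deg card_gt0 => /set0Pn[u]; rewrite inE; exact: sp.
  by rewrite !inE ![c2 == _]eq_sym (negPf r0c2) (negPf d2c2).
have d4 : dg e' S c2 = 4.
  move: Dc2; rewrite (spans_deg s' c2 sp) !dgU1 //; last first.
    by rewrite !inE negb_or r0d2.
  rewrite ![e' c2 _]s' Nr Nd [c2 == d2]eq_sym (negPf d2c2) [c2 == s]eq_sym (negPf ns).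
  by rewrite [c2 == r0]eq_sym (negPf r0c2) [c2 == t]eq_sym (negPf nt).
have ncs : c2 != s by rewrite eq_sym.
have nct : c2 != t by rewrite eq_sym.
have [_ [p [q [v1 [v2 [k [Uf Nf [p0 p2] [q0 q2'] [a0 a2]]]]]]]] :=
  core_fan s' i' h c2S ncs nct d4.
have nq21 : ~~ e q1 q2.
  by apply/negP => h'; apply: (no_triangle eirr nz (a:=x) (b:=q1) (c:=q2)).
have Bn g : g \in [:: c1; d1] -> [/\ g != x, g != q1 & g != q2].
  move=> gB; have e1g : e q1 g by rewrite N1 in_cons gB orbT.
  split; first by move: gB; rewrite !inE => /orP[]/eqP->; rewrite eq_sym.
    by neq.
  by apply: contraNneq nq21 => <-.
have Dsupp v : v \in [:: x; q1; q2] -> v \notin S.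
  move=> vD; apply/negP => vS; have := core_supp s' i' h vS; apply/negP.
  apply: red_supp => //.
  - by apply: contraTneq vD => ->; rewrite !inE !negb_or; allneq.
  - by apply: contraL vD => /Bn[g1 g2 g3]; rewrite !inE !negb_or; allneq.
have xS : x \notin S by apply: Dsupp; rewrite !inE eqxx.
have q1S : q1 \notin S by apply: Dsupp; rewrite !inE eqxx orbT.
have q2S : q2 \notin S by apply: Dsupp; rewrite !inE eqxx !orbT.
have ed2t : e d2 t by have [] := sub d2 t d2c2 nt e't.
have L0 g i : linked e' (S :\ c2) t g i -> linked e (S :\ c2) t g i.
  apply: linked_rel => u v; rewrite !inE => /andP[uc _] /andP[vc _] uv.
  by have [] := sub u v uc vc uv.
(* A neighbour of [c2] taken over from [q1] is closed to [t] with 4 inner vertices, an old one with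
   3. This forbids residue 1 for the former and 2 for the latter. *)
have K1 g i : g \in [:: c1; d1] -> linked e' (S :\ c2) t g i -> (i + 4).+1 %% 3 <> 0.
  move=> gB /L0 L; apply: (nozero_close (w := [:: q1; x; q2; d2]) nz L) => /=.
  - by rewrite esym N1 in_cons gB orbT /= e1x ex2 e2d ed2t.
  - by allneq.
  - by allneq.
have K2 g i : e c2 g -> linked e' (S :\ c2) t g i -> (i + 3).+1 %% 3 <> 0.
  move=> cg /L0 L; apply: (nozero_close (w := [:: c2; q2; d2]) nz L) => /=.
  - by rewrite esym cg ec2 e2d ed2t.
  - by allneq.
  - by allneq.
have Ne g : g \in S -> e' c2 g -> (g \in [:: c1; d1]) || e c2 g.
  move=> gS; rewrite /e' /red eqxx /= (negPf zB) andbF orbF.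
  by case/orP=> [/andP[-> _]|->]; rewrite ?orbT.
have inS g i : linked e' (S :\ c2) t g i -> g \in S.
  by case/linked_in/andP=> _; rewrite inE => /andP[].
have Nf4 g : g \in [:: p; q; v1; v2] -> g \in S -> (g \in [:: c1; d1]) || e c2 g.
  by move=> g4 gS; apply: Ne => //; rewrite Nf.
have fp := Nf4 p; have fq := Nf4 q; have fv1 := Nf4 v1; have fv2 := Nf4 v2.
have {}fp := fp (mem_head _ _) (inS _ _ p0).
have {}fq : (q \in [:: c1; d1]) || e c2 q.
  by apply: fq (inS _ _ q0); rewrite !inE eqxx orbT.
have {}fv1 : (v1 \in [:: c1; d1]) || e c2 v1.
  by apply: fv1 (inS _ _ a0); rewrite !inE eqxx !orbT.
have {}fv2 : (v2 \in [:: c1; d1]) || e c2 v2.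
  by apply: fv2 (inS _ _ a2); rewrite !inE eqxx !orbT.
have B4 g : g \in [:: c1; d1] -> g \in [:: p; q; v1; v2].
  move=> gB; have e'g : e' g c2 by rewrite /e' /red eqxx gB /= !orbT.
  rewrite -Nf 1?s' //; have := sp g c2 e'g; rewrite !inE => /or3P[/eqP E|/eqP E|//].
    by move: e'g; rewrite E Nr [c2 == d2]eq_sym (negPf d2c2) [c2 == s]eq_sym (negPf ns).
  by move: e'g; rewrite E Nd [c2 == r0]eq_sym (negPf r0c2) [c2 == t]eq_sym (negPf nt).
have F1 : ~~ [&& p \in [:: c1; d1], q \in [:: c1; d1] & v2 \in [:: c1; d1]].
  apply/negP => /and3P[h1 h2 h3].
  have U3 : uniq [:: p; q; v2].
    move: Uf; rewrite /= !inE !negb_or => /and4P[/and3P[? ? ?] /andP[? ?] ? _]; allneq.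
  suff : 3 <= 2 by [].
  apply: (uniq_leq_size U3 (s2 := [:: c1; d1])) => g; rewrite 2!in_cons inE.
  by case/or3P=> /eqP->.
have F2 : [|| p \in [:: c1; d1], q \in [:: c1; d1] | v1 \in [:: c1; d1]].
  apply/negPn/negP => /norP[h1 /norP[h2 h3]].
  have only g : g \in [:: c1; d1] -> g = v2.
    move=> gB; have := B4 g gB; rewrite in_cons => /orP[/eqP E|].
      by rewrite -E gB in h1.
    rewrite in_cons => /orP[/eqP E|]; first by rewrite -E gB in h2.
    rewrite in_cons => /orP[/eqP E|]; first by rewrite -E gB in h3.
    by rewrite inE => /eqP.
  have E1 : c1 = v2 by apply: only; rewrite mem_head.
  have E2 : d1 = v2 by apply: only; rewrite !inE eqxx orbT.
  by rewrite E1 E2 eqxx in ncd1.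
have K g i : (g \in [:: c1; d1]) || e c2 g -> linked e' (S :\ c2) t g i ->
    if g \in [:: c1; d1] then (i + 4).+1 %% 3 <> 0 else (i + 3).+1 %% 3 <> 0.
  by case: ifP => [gB _|_ /= cg]; [apply: K1|apply: K2].
(* As [p] and [q] carry both [k] and [k + 2], a vertex among them in [[:: c1; d1]] forces residue 0
   for [k] and one outside forces 1, so they lie on the same side. In the first case [v2] is outside
   with residue 2, in the second [v1] is inside with residue 1, and both are forbidden. *)
have := K _ _ fp p0; have := K _ _ fp p2; have := K _ _ fq q0; have := K _ _ fq q2'.
have := K _ _ fv1 a0; have := K _ _ fv2 a2.
move: F1 F2; clear; case: (p \in _); case: (q \in _); case: (v1 \in _); case: (v2 \in _) => //= _ _; lia.
Qed.
End Data.
End Merge.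

Section NoC4.
Variables (T : finType) (e : rel T).
Hypotheses (esym : symmetric e) (eirr : irreflexive e) (nz : nozero e).
Hypotheses (dn1 : forall v, deg e v != 1) (IH : smaller_exc e).

Lemma merge_on_C4 r x y q1 q2 c1 d1 c2 d2 : tight e r x y -> q1 != q2 ->
  uniq [:: x; c1; d1] -> uniq [:: x; c2; d2] ->
  (forall v, e x v = (v \in [:: q1; q2])) ->
  (forall v, e q1 v = (v \in [:: x; c1; d1])) ->
  (forall v, e q2 v = (v \in [:: x; c2; d2])) ->
  c2 != c1 -> c2 != d1 -> ~~ e c2 c1 -> ~~ e c2 d1 -> exists v, on_C4 e v.
Proof.
move=> tg n u1 u2 Nx N1 N2 m1 m2 m3 m4.
have [_ _ P _ _] := merge_exc esym eirr nz dn1 IH tg n u1 u2 Nx N1 N2 m1 m2 m3 m4.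
case: P => ex.
  by apply: (merge_C4 esym eirr nz dn1 IH tg n u1 u2 Nx N1 N2 m1 m2 m3 m4 _ ex); rewrite mem_head.
by apply: (merge_C4 esym eirr nz dn1 IH tg n u1 u2 Nx N1 N2 m1 m2 m3 m4 _ ex); rewrite !inE eqxx orbT.
Qed.

(** If no 4-cycle passes through [x], the contraction can start at any of [c1], [d1], [c2], [d2]
    without a neighbour in the opposite pair. If none qualifies, the bipartite graph between the
    pairs has no isolated vertex, hence a perfect matching, and [q1], [q2] complete it to a
    6-cycle. *)
Lemma tight_C4 r x y : tight e r x y -> exists v, on_C4 e v.
Proof.
move=> tg; have [tr H3 Hadj Hsh] := tg; have [nrx nry nxy] := trio_uniq tr.
have dx : deg e x = 2 by apply: (trio_deg2 tr); rewrite !inE eqxx orbT.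
have [q1 [q2 [nq Nx]]] := deg2_ends dx.
have ex1 : e x q1 by rewrite Nx !inE eqxx.
have ex2 : e x q2 by rewrite Nx !inE eqxx orbT.
have e1x : e q1 x by rewrite esym.
have e2x : e q2 x by rewrite esym.
have [c1 [d1 [u1 N1]]] := deg3_others (H3 _ _ dx ex1) e1x.
have [c2 [d2 [u2 N2]]] := deg3_others (H3 _ _ dx ex2) e2x.
have [nxc1 nxd1 ncd1] : [/\ x != c1, x != d1 & c1 != d1].
  by move: u1; rewrite /= !inE !negb_or => /and3P[/andP[? ?] ? _]; split.
have [nxc2 nxd2 ncd2] : [/\ x != c2, x != d2 & c2 != d2].
  by move: u2; rewrite /= !inE !negb_or => /and3P[/andP[? ?] ? _]; split.
have e1c : e q1 c1 by rewrite N1 !inE eqxx !orbT.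
have e1d : e q1 d1 by rewrite N1 !inE eqxx !orbT.
have e2c : e q2 c2 by rewrite N2 !inE eqxx !orbT.
have e2d : e q2 d2 by rewrite N2 !inE eqxx !orbT.
have common g : e q1 g -> e q2 g -> g != x -> exists v, on_C4 e v.
  move=> g1 g2 gx; exists x; split=> //; exists q1, q2, g; split=> //.
  by split; rewrite // esym.
case: (boolP [|| c2 == c1, c2 == d1, d2 == c1 | d2 == d1]) => [|].
  case/or4P=> /eqP E.
  - by apply: (common c1) => //; rewrite ?[c1 == x]eq_sym // -E.
  - by apply: (common d1) => //; rewrite ?[d1 == x]eq_sym // -E.
  - by apply: (common c1) => //; rewrite ?[c1 == x]eq_sym // -E.
  - by apply: (common d1) => //; rewrite ?[d1 == x]eq_sym // -E.
rewrite !negb_or => /and4P[m1 m2 m3 m4].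
have m1' : c1 != c2 by rewrite eq_sym.
have m2' : d1 != c2 by rewrite eq_sym.
have m3' : c1 != d2 by rewrite eq_sym.
have m4' : d1 != d2 by rewrite eq_sym.
have nq' : q2 != q1 by rewrite eq_sym.
have Nx' v : e x v = (v \in [:: q2; q1]) by rewrite Nx !inE orbC.
have swap3 (a b c : T) : uniq [:: a; b; c] -> uniq [:: a; c; b].
  by rewrite /= !inE !negb_or => /and3P[/andP[? ?] ? _]; allneq.
have u1' := swap3 _ _ _ u1; have u2' := swap3 _ _ _ u2.
have N1' v : e q1 v = (v \in [:: x; d1; c1]) by rewrite N1 !inE [(v == c1) || _]orbC.
have N2' v : e q2 v = (v \in [:: x; d2; c2]) by rewrite N2 !inE [(v == c2) || _]orbC.
case: (boolP (~~ e c2 c1 && ~~ e c2 d1)) => [/andP[h1 h2]|A1].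
  exact: merge_on_C4 tg nq u1 u2 Nx N1 N2 m1 m2 h1 h2.
case: (boolP (~~ e d2 c1 && ~~ e d2 d1)) => [/andP[h1 h2]|A2].
  exact: merge_on_C4 tg nq u1 u2' Nx N1 N2' m3 m4 h1 h2.
case: (boolP (~~ e c1 c2 && ~~ e c1 d2)) => [/andP[h1 h2]|A3].
  exact: merge_on_C4 tg nq' u2 u1 Nx' N2 N1 m1' m3' h1 h2.
case: (boolP (~~ e d1 c2 && ~~ e d1 d2)) => [/andP[h1 h2]|A4].
  exact: merge_on_C4 tg nq' u2 u1' Nx' N2 N1' m2' m4' h1 h2.
have nq21 : ~~ e q1 q2.
  by apply/negP => h; apply: (no_triangle eirr nz (a:=x) (b:=q1) (c:=q2)).
have hex a b a' b' : a \in [:: c1; d1] -> b \in [:: c1; d1] -> a' \in [:: c2; d2] ->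
    b' \in [:: c2; d2] -> a != b -> a' != b' -> ~~ (e a a' && e b b').
  move=> aB bB aB' bB' nab nab'; apply/negP => /andP[aa bb].
  have e1a : e q1 a by rewrite N1 in_cons aB orbT.
  have e1b : e q1 b by rewrite N1 in_cons bB orbT.
  have e2a : e q2 a' by rewrite N2 in_cons aB' orbT.
  have e2b : e q2 b' by rewrite N2 in_cons bB' orbT.
  have X u v : u \in [:: c1; d1] -> v \in [:: c2; d2] -> u != v.
    by rewrite !inE => /orP[]/eqP-> /orP[]/eqP->.
  have naa := X _ _ aB aB'; have nab2 := X _ _ aB bB'.
  have nba := X _ _ bB aB'; have nbb := X _ _ bB bB'.
  have nq2a' : q2 != a by apply: contraNneq nq21 => ->.
  have nq2b' : q2 != b by apply: contraNneq nq21 => ->.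
  have nq1a' : q1 != a' by apply: contraNneq nq21 => ->; rewrite esym.
  have nq1b' : q1 != b' by apply: contraNneq nq21 => ->; rewrite esym.
  apply: (negP (nz (s := [:: q1; a; a'; q2; b'; b]) _)) => //; split=> //.
    by allneq.
  by rewrite /= e1a aa esym e2a e2b esym bb esym e1b.
have B1 : ~~ (e c1 c2 && e d1 d2) by apply: hex; rewrite // !inE eqxx ?orbT.
have B2 : ~~ (e c1 d2 && e d1 c2).
  by apply: hex; rewrite 1?[d2 == c2]eq_sym // !inE eqxx ?orbT.
exfalso; move: A1 A2 A3 A4 B1 B2.
rewrite [e c2 c1]esym [e c2 d1]esym [e d2 c1]esym [e d2 d1]esym.
by case: (e c1 c2) (e c1 d2) (e d1 c2) (e d1 d2) => [] [] [] [].
Qed.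
End NoC4.

(** * Excluding 4-cycles through a vertex of degree 2 *)

Section C4.
Variables (T : finType) (e : rel T).
Hypotheses (esym : symmetric e) (eirr : irreflexive e) (nz : nozero e).
Hypotheses (dn1 : forall v, deg e v != 1) (IH : smaller_exc e).

Section Data.
Variables r x y q1 q2 c d1 d2 : T.
Hypothesis tg : tight e r x y.
Hypotheses (nq12 : q1 != q2) (u1 : uniq [:: x; c; d1]) (u2 : uniq [:: x; c; d2]).
Hypotheses (Nx : forall v, e x v = (v \in [:: q1; q2]))
  (N1 : forall v, e q1 v = (v \in [:: x; c; d1]))
  (N2 : forall v, e q2 v = (v \in [:: x; c; d2])).

Lemma C4_facts : [/\ [/\ e x q1, e x q2, e q1 x & e q2 x],
  [/\ e q1 c, e q2 c, e c q1 & e c q2], [/\ e q1 d1, e d1 q1, e q2 d2 & e d2 q2],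
  [/\ x != q1, x != q2, x != c & [/\ x != d1, x != d2, c != d1 & c != d2]] &
  [/\ ~~ e q1 q2, [/\ q1 != c, q2 != c, q1 != d1 & q2 != d2],
      [/\ q1 != d2, q2 != d1, ~~ e c d1, ~~ e c d2 & ~~ e c x] &
      [/\ 3 <= deg e c, 3 <= deg e d1 & 3 <= deg e d2]]].
Proof.
have [tr H3 Hadj Hsh] := tg.
have dx : deg e x = 2 by apply: (trio_deg2 tr); rewrite !inE eqxx orbT.
have [nxc nxd1 ncd1] : [/\ x != c, x != d1 & c != d1].
  by move: u1; rewrite /= !inE !negb_or => /and3P[/andP[? ?] ? _]; split.
have [_ nxd2 ncd2] : [/\ x != c, x != d2 & c != d2].
  by move: u2; rewrite /= !inE !negb_or => /and3P[/andP[? ?] ? _]; split.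
have ex1 : e x q1 by rewrite Nx !inE eqxx.
have ex2 : e x q2 by rewrite Nx !inE eqxx orbT.
have e1c : e q1 c by rewrite N1 !inE eqxx !orbT.
have e1d : e q1 d1 by rewrite N1 !inE eqxx !orbT.
have e2c : e q2 c by rewrite N2 !inE eqxx !orbT.
have e2d : e q2 d2 by rewrite N2 !inE eqxx !orbT.
have e1x : e q1 x by rewrite esym.
have e2x : e q2 x by rewrite esym.
have ec1 : e c q1 by rewrite esym.
have ec2 : e c q2 by rewrite esym.
have ed1 : e d1 q1 by rewrite esym.
have ed2 : e d2 q2 by rewrite esym.
have nq21 : ~~ e q1 q2.
  by apply/negP => h; apply: (no_triangle eirr nz (a:=x) (b:=q1) (c:=q2)).
have ge3 q v : e x q -> e v q -> x != v -> 3 <= deg e v.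
  move=> xq vq xv; rewrite ltn_neqAle (deg_ge2 dn1 (deg_pos vq)) andbT.
  by apply: contraNneq xv => dv; apply/eqP; apply: (Hsh _ _ q).
have q1c : q1 != c by neq.
have q2c : q2 != c by neq.
have q1d : q1 != d1 by neq.
have q2d : q2 != d2 by neq.
have q1d2 : q1 != d2 by apply: contraNneq nq21 => ->.
have q2d1 : q2 != d1 by apply: contraNneq nq21 => ->.
have n1 : x != q1 by neq.
have n2 : x != q2 by neq.
do !split=> //.
- by apply/negP => h; apply: (no_triangle eirr nz (a:=c) (b:=d1) (c:=q1)).
- by apply/negP => h; apply: (no_triangle eirr nz (a:=c) (b:=d2) (c:=q2)).
- by rewrite esym Nx !inE !(eq_sym c) negb_or q1c.
- exact: (ge3 q1).
- exact: (ge3 q1).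
- exact: (ge3 q2).
Qed.

(* Here the path d2 - q2 - x - q1 can be contracted. *)
Lemma C4_apart : d1 != d2 -> ~~ e d1 d2 -> False.
Proof.
move=> nd12 ned.
have [[ex1 ex2 e1x e2x] [e1c e2c ec1 ec2] [e1d ed1 e2d ed2]
  [nx1 nx2 nxc [nxd1 nxd2 ncd1 ncd2]]
  [nq21 [q1c q2c q1d q2d] [q1d2 q2d1 ecd1 ecd2 ecx] [c3 d13 d23]]] := C4_facts.
have [tr H3 Hadj Hsh] := tg; have [nrx nry nxy] := trio_uniq tr.
have u2' : uniq [:: x; d2; c] by allneq.
have N2' v : e q2 v = (v \in [:: x; d2; c]) by rewrite N2 !inE [(v == c) || _]orbC.
have nd2c : d2 != c by rewrite eq_sym.
have nd2d1 : d2 != d1 by rewrite eq_sym.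
have ed2c : ~~ e d2 c by rewrite esym.
have ed21 : ~~ e d2 d1 by rewrite esym.
have [U D2 P Dd2 [Dc Nry]] := merge_exc esym eirr nz dn1 IH tg nq12 u1 u2' Nx N1 N2'
  nd2c nd2d1 ed2c ed21.
set e' := red e [:: x; q1; q2] d2 [:: c; d1] in D2 P Dd2 Nry.
have zB : d2 \notin [:: c; d1] by rewrite !inE negb_or nd2c.
have s' : symmetric e' by apply: red_sym.
have i' : irreflexive e' by apply: red_irr.
have sub u v : u != d2 -> v != d2 -> e' u v -> e u v.
  by move=> uc vc; rewrite /e' /red (negPf uc) (negPf vc) !orbF => /and3P[].
have [c' [uc Nc]] := deg3_other Dc ec1 ec2 nq12.
have [q1c' q2c'] : q1 != c' /\ q2 != c'.
  by move: uc; rewrite /= !inE !negb_or => /and3P[/andP[? ?] ? _].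
have ecc : e c c' by rewrite Nc !inE eqxx !orbT.
have ec'c : e c' c by rewrite esym.
have nc'x : c' != x by apply: contraNneq ecx => <-.
have nc'd2 : c' != d2 by apply: contraNneq ecd2 => <-.
have e'cd : e' c d2 by rewrite /e' /red eqxx !inE eqxx /= !orbT.
have e'cc : e' c c' by rewrite /e' /red ecc !inE !negb_or; apply/orP; left; allneq.
have N'c v : e' c v = (v \in [:: d2; c']).
  apply: deg_full.
  - by rewrite /= inE eq_sym nc'd2.
  - by rewrite /= e'cd e'cc.
  - by apply/eqP; rewrite eq_sym D2 !inE eqxx !orbT.
have noq2 : q2 \notin supp e'.
  by apply: red_supp; rewrite // !inE ?negb_or ?eqxx ?orbT // q2c.
have key r0 y0 : r0 \in [:: r; y] -> exc e' y0 r0 c -> False.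
  move=> r0ry; have Nr0 := Nry r0 r0ry.
  have d2r0 : deg e' r0 = 2.
    by apply/eqP; rewrite D2; move: r0ry; rewrite !inE => /orP[]->; rewrite ?orbT.
  have nr0d2 : r0 != d2 by apply: contra_eq_neq Dd2 => <-; rewrite d2r0.
  case=> [[S [s [t [h r0S cS nr0c [Nr Ncs sp]]]]]|[S [s [t [h r0S cS nr0c [Nr Ncs sp]]]]]].
    (* The common neighbours of [r0] and [c] are [d2] and [c']. Of its degree 4, [d2] keeps 2 in the
       core, so it is an old twin and [c'] hangs on its partner [t0]. A common neighbour [f] of [d2]
       and [t0] other than [d1] is joined to [d2] by an old edge, and [c c' t0 f d2 q2] is a
       6-cycle. *)
    have [s1 [t1 [h1 Es Et]]] : exists s1 t1, [/\ core e' y0 true S s1 t1, s1 = d2 & t1 = c'].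
      have /orP[/eqP Es|/eqP Et] : (d2 == s) || (d2 == t) by rewrite -Ncs.
        subst s; exists d2, t; split=> //.
        have := N'c t; rewrite Ncs eqxx orbT !inE.
        have [_ [nst _ _]] := core_in h.
        by move/(@Logic.eq_sym _ _ _); rewrite [t == d2]eq_sym (negPf nst) => /eqP.
      subst t; exists d2, s; split=> //; first exact: core_swap.
      have := N'c s; rewrite Ncs eqxx !inE.
      have [_ [nst _ _]] := core_in h.
      by move/(@Logic.eq_sym _ _ _); rewrite (negPf nst) => /eqP.
    subst s1 t1; have [[dS c'S _] [_ _ _]] := core_in h1.
    have st v : (v == s) || (v == t) = (v \in [:: d2; c']) by rewrite -Ncs N'c.
    have dg2 : dg e' S d2 = 2.
      move: Dd2; rewrite (spans_deg s' d2 sp) !dgU1; try by allneq.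
      by rewrite ![e' d2 _]s' Nr Ncs !st mem_head /=; clear; lia.
    have [S0 [t0 [ES h2 c'S0 Nc']]] := core_true_inv s' i' h1 dg2.
    have [S1 [p0 [q0 [ES0 h3 d2S1 t0S1 [nd2t0 _ Nd2 Nt0]]]]] := core_false_inv h2.
    have [[p0S q0S _] [np0 _ _]] := core_in h3.
    have subS v : v \in S1 -> v \in S by rewrite ES ES0 !inE => ->; rewrite !orbT.
    have [f [fS d2f t0f nfd]] : exists f, [/\ f \in S1, e' d2 f, e' t0 f & f != d1].
      case: (eqVneq p0 d1) => [E|n]; last first.
        by exists p0; rewrite Nd2 // Nt0 // eqxx; split.
      by exists q0; rewrite Nd2 // Nt0 // eqxx orbT; split=> //; rewrite -E eq_sym.
    have fSS := subS f fS.
    have t0S0 : t0 \in S0 by rewrite ES0 !inE eqxx orbT.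
    have t0S : t0 \in S by rewrite ES inE t0S0 orbT.
    have q2S : q2 \notin S by apply: contra noq2; apply: (core_supp s' i' h).
    have nfd2 : f != d2 by neq.
    have nt0d2 : t0 != d2 by rewrite eq_sym.
    have nfc : f != c by neq.
    have ed2f : e d2 f.
      move: d2f; rewrite /e' /red (negPf zB) andbF orbF.
      by case/orP=> [/and3P[]//|/andP[_]]; rewrite !inE (negPf nfc) (negPf nfd).
    have et0f : e t0 f by apply: sub.
    have ec't : e c' t0 by apply: sub => //; rewrite Nc' // eqxx.
    have nc't0 : c' != t0 by neq.
    have c'S1 : c' \notin S1 by apply: contra c'S0; rewrite ES0 !inE => ->; rewrite !orbT.
    have nfc' : f != c' by neq.
    apply: (negP (nz (s := [:: c; c'; t0; f; d2; q2]) _)) => //; split=> //.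
      by allneq.
    by rewrite /= ecc ec't et0f esym ed2f ed2 e2c.
  (* Here [d2] is a terminal of a finished stage, so it has degree 2 in the core and only [c] in
     addition, too little for degree 4. *)
  have [[sS tS _] [nst _ _]] := core_in h.
  have Et : t = d2.
    have := Ncs d2; rewrite e'cd eq_sym (negPf nr0d2) /=.
    by move/(@Logic.eq_sym _ _ _)/eqP.
  have dgt := core_dg s' i' h tS.
  have [_ [_ _ nyt]] := core_in h.
  move: dgt Dd2; rewrite eq_sym (negPf nyt) eqxx orbT -Et => /eqP dgt.
  rewrite (spans_deg s' t sp) !dgU1; try by allneq.
  rewrite dgt ![e' t _]s' Nr Ncs [t == s]eq_sym (negPf nst).
  have -> : t == c = false by apply/negbTE; neq.
  have -> : t == r0 = false by apply/negbTE; neq.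
  by rewrite eqxx.
case: P; apply: key; [exact: mem_head|by rewrite !inE eqxx orbT].
Qed.

Lemma path_next (f : rel T) a s b : path f a s -> b \in a :: s -> b != last a s ->
  exists w, f b w.
Proof.
elim: s a => [|w s IHs] a /=.
  by move=> _; rewrite inE => /eqP->; rewrite eqxx.
case/andP=> aw ps; rewrite inE => /orP[/eqP->|]; first by exists w.
exact: IHs.
Qed.

(* A third neighbour of [c] reaches [d1] or [d2] while avoiding the other one, which
   closes a zero cycle, unless [c] is a cut vertex. *)
Lemma C4_rung : e d1 d2 -> False.
Proof.
move=> ed12; have nd12 : d1 != d2 by neq.
have [[ex1 ex2 e1x e2x] [e1c e2c ec1 ec2] [e1d ed1 e2d ed2]
  [nx1 nx2 nxc [nxd1 nxd2 ncd1 ncd2]]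
  [nq21 [q1c q2c q1d q2d] [q1d2 q2d1 ecd1 ecd2 ecx] [c3 d13 d23]]] := C4_facts.
have [tr H3 Hadj Hsh] := tg; have [nrx nry nxy] := trio_uniq tr.
have [||c' cl ecc] := @deg_more T e [:: q1; q2] c; [by allneq|exact: c3|].
move: cl; rewrite !inE negb_or => /andP[c'q1 c'q2].
have ec'c : e c' c by rewrite esym.
have nc'c : c' != c by neq.
have nc'x : c' != x by apply: contraNneq ecx => <-.
pose F := [:: x; q1; q2; c].
have c'F : c' \notin F by rewrite !inE !negb_or; allneq.
pose G := [:: d1; d2].
(* Edges leaving [G] are dropped, so a walk along [f] ends as soon as it reaches [d1] or [d2] and
   cannot pass one on its way to the other. *)
pose f : rel T := fun u v => [&& e u v, u \notin G & v \notin F].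
pose K := [set v | connect f c' v].
have KF v : v \in K -> v \notin F.
  rewrite inE => /connectP[p fp ->]; elim/last_ind: p fp => [|p w _] //.
  by rewrite rcons_path last_rcons => /andP[_ /and3P[]].
have hit a b p q : e p a -> e q b -> e a b -> e p c -> e q c -> e x p -> e x q ->
    p \in F -> q \in F -> b \in G -> b \notin F -> p != q -> a != b -> a \in K -> False.
  move=> pa qb ab pc qc xp xq pF qF bG bF npq nab.
  rewrite inE => /connectP[s0 /shortenP[s fs us _] Ea].
  have px : e p x by rewrite esym.
  have npc : p != c by neq.
  have nqc : q != c by neq.
  have npx : p != x by neq.
  have nqx : q != x by neq.
  have sF v : v \in c' :: s -> v \notin F.
    move=> vs; apply: KF; rewrite inE; apply/connectP.
    case/splitPl: vs fs {us Ea} => s1 s2 <-; rewrite cat_path => /andP[f1 _].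
    by exists s1.
  have bs : b \notin c' :: s.
    apply/negP => bs; have [|w] := path_next fs bs; first by rewrite -Ea eq_sym.
    by rewrite /f bG andbF.
  pose A := [set v in c' :: s].
  have L : linked e A c' a (size s).
    exists s; split; [|by rewrite Ea|exact: us|by move=> v vs; rewrite in_set|by []].
    by apply: sub_path fs => u v /and3P[].
  have nA v : v \in F -> v \notin A by rewrite in_set; apply: contraL; apply: sF.
  have pA := nA p pF; have qA := nA q qF.
  have xA : x \notin A by apply: nA; rewrite !inE eqxx.
  have cA : c \notin A by apply: nA; rewrite !inE eqxx !orbT.
  have bA : b \notin A by rewrite in_set.
  have nbq : b != q by neq.
  have nbc : b != c by apply: contraNneq bF => ->; rewrite !inE eqxx !orbT.
  have ap : e a p by rewrite esym.
  have bq : e b q by rewrite esym.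
  (* The three detours from [a] back to [c'] have 2, 4 and 3 inner vertices and so exclude every
     residue. *)
  have H0 : (size s + 2).+1 %% 3 <> 0.
    apply: (nozero_close (w := [:: p; c]) nz L) => /=.
    - by rewrite ap pc ecc.
    - by rewrite inE npc.
    - by rewrite pA cA.
  have H1 : (size s + 4).+1 %% 3 <> 0.
    apply: (nozero_close (w := [:: p; x; q; c]) nz L) => /=.
    - by rewrite ap px xq qc ecc.
    - by rewrite !inE !negb_or npx npq npc nqc nxc eq_sym nqx.
    - by rewrite pA xA qA cA.
  have H2 : (size s + 3).+1 %% 3 <> 0.
    apply: (nozero_close (w := [:: b; q; c]) nz L) => /=.
    - by rewrite ab bq qc ecc.
    - by rewrite !inE !negb_or nbq nbc nqc.
    - by rewrite bA qA cA.
  by move: H0 H1 H2; clear; lia.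
have q1F : q1 \in F by rewrite !inE eqxx !orbT.
have q2F : q2 \in F by rewrite !inE eqxx !orbT.
have d1F : d1 \notin F by rewrite !inE !negb_or; allneq.
have d2F : d2 \notin F by rewrite !inE !negb_or; allneq.
have d1K : d1 \notin K.
  by apply/negP; apply: (hit d1 d2 q1 q2) => //; rewrite !inE eqxx orbT.
have d2K : d2 \notin K.
  by apply/negP; apply: (hit d2 d1 q2 q1) => //; rewrite 1?esym 1?eq_sym // !inE eqxx.
have cK : c \notin K by apply/negP => /KF; rewrite !inE eqxx !orbT.
have xK : x \notin K by apply/negP => /KF; rewrite !inE eqxx.
have closed u v : u \in K -> e u v -> v \in K \/ v = c.
  move=> uK uv; have uF := KF u uK.
  have uG : u \notin G.
    rewrite !inE negb_or; apply/andP.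
    by split; apply: contraTneq uK => ->.
  case: (boolP (v \in F)) => [|vF]; last first.
    have cu : connect f c' u by rewrite in_set in uK.
    left; rewrite in_set; apply: (connect_trans cu); apply: connect1.
    by rewrite /f uv uG vF.
  move: uF uG; rewrite !inE !negb_or => /and4P[u_x u_1 u_2 u_c] /andP[u_d1 u_d2].
  case/or4P=> /eqP E; subst v; [| | |by right]; move: uv; rewrite esym ?Nx ?N1 ?N2 !inE.
  - by rewrite (negPf u_1) (negPf u_2).
  - by rewrite (negPf u_x) (negPf u_c) (negPf u_d1).
  - by rewrite (negPf u_x) (negPf u_c) (negPf u_d2).
have c'K : c' \in K by rewrite inE connect0.
have cut S s a := @cut_vertex T e esym eirr nz dn1 IH r x y S c s a tr.
have inT v : deg e v == 2 -> [\/ v = r, v = x | v = y].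
  rewrite tr.2 !inE => /or3P[]/eqP->; [exact: Or31|exact: Or32|exact: Or33].
have xn v : v \in K -> v <> x by move=> vK E; rewrite E (negPf xK) in vK.
(* One side of [c] has at most one vertex of degree 2: [K] if it misses [r] or [y], and otherwise
   the rest, which contains only [x]. *)
case: (boolP (r \in K)) => rK; last first.
  apply: (cut K c' y) => //; first exact: deg_pos ec'c.
  move=> v vK /inT[E|/(xn v vK)//|//]; by rewrite E (negPf rK) in vK.
case: (boolP (y \in K)) => yK; last first.
  apply: (cut K c' r) => //; first exact: deg_pos ec'c.
  move=> v vK /inT[//|/(xn v vK)//|E]; by rewrite E (negPf yK) in vK.
apply: (cut (~: (c |: K)) x x) => //.
- by rewrite in_setC in_setU1 eqxx.
- by rewrite in_setC in_setU1 negb_or nxc.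
- exact: deg_pos ex1.
- move=> u v; rewrite in_setC in_setU1 negb_or => /andP[uc' uK] uv.
  case: (eqVneq v c) => [|vc]; first by right.
  left; rewrite in_setC in_setU1 negb_or vc; apply/negP => vK; rewrite esym in uv.
  by case: (closed v u vK uv) => [uK'|E]; [rewrite uK' in uK|rewrite E eqxx in uc'].
- move=> v; rewrite in_setC in_setU1 negb_or => /andP[vc vK] /inT[E|//|E].
    by rewrite E rK in vK.
  by rewrite E yK in vK.
Qed.
End Data.
End C4.

(** * Excluding $K_{2,3}$ through a vertex of degree 2 *)

Section K23.
Variables (T : finType) (e : rel T).
Hypotheses (esym : symmetric e) (eirr : irreflexive e) (nz : nozero e).
Hypotheses (dn1 : forall v, deg e v != 1) (IH : smaller_exc e).

Section Data.
Variables r x y q1 q2 c d : T.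
Hypothesis tg : tight e r x y.
Hypotheses (nq12 : q1 != q2) (u1 : uniq [:: x; c; d]).
Hypotheses (Nx : forall v, e x v = (v \in [:: q1; q2]))
  (N1 : forall v, e q1 v = (v \in [:: x; c; d]))
  (N2 : forall v, e q2 v = (v \in [:: x; c; d])).

Lemma deg2_apart w : w \in [:: r; y] ->
  [/\ w != x, w != q1, w != q2 & [/\ w != c, w != d, ~~ e w q1, ~~ e w q2 & deg e w = 2]].
Proof.
move=> wr; have [tr H3 Hadj Hsh] := tg; have [nrx nry nxy] := trio_uniq tr.
have [[ex1 ex2 e1x e2x] [e1c e2c ec1 ec2] [e1d ed1 e2d ed2] _ _] :=
  C4_facts esym eirr nz dn1 tg nq12 u1 u1 Nx N1 N2.
have dx : deg e x = 2 by apply: (trio_deg2 tr); rewrite !inE eqxx orbT.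
have dw : deg e w = 2.
  by apply: (trio_deg2 tr); move: wr; rewrite !inE => /orP[]->; rewrite ?orbT.
have n1 := tight_nbr tg wr ex1; have n2 := tight_nbr tg wr ex2.
split.
- by move: wr; rewrite !inE => /orP[]/eqP->; rewrite // eq_sym.
- by apply: contraNneq (Hadj _ _ dx dw) => ->.
- by apply: contraNneq (Hadj _ _ dx dw) => ->.
- split=> //.
  + by apply: contraNneq n1 => ->.
  + by apply: contraNneq n1 => ->.
Qed.

(** An edge from [c] to [d] replaces the path [c q1 x q2 d], and [c] keeps degree at least 3. If [d]
    and [r0] become twins, [r0] is adjacent to [c], although its neighbours are cubic. If they are
    adjacent, a path of residue 2 from [s] to [c] closes through [q1 d r0]. Root [d] would make [r]
    and [y] twins or adjacent. *)
Lemma K23_big : 4 <= deg e c -> False.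
Proof.
move=> c4; have [tr H3 Hadj Hsh] := tg; have [nrx nry nxy] := trio_uniq tr.
have [[ex1 ex2 e1x e2x] [e1c e2c ec1 ec2] [e1d ed1 e2d ed2]
  [nx1 nx2 nxc [nxd _ ncd _]]
  [nq21 [q1c q2c q1d q2d] [_ q2d1 ecd _ ecx] [_ d3 _]]] :=
  C4_facts esym eirr nz dn1 tg nq12 u1 u1 Nx N1 N2.
have ry : r \in [:: r; y] by rewrite mem_head.
have yy : y \in [:: r; y] by rewrite !inE eqxx orbT.
have uD : uniq [:: x; q1; q2] by allneq.
have [|||||||||||U D2 D4 P] := @red_exc T e esym eirr [:: x; q1; q2] c [:: d] x r y d nz IH uD.
- by [].
- by rewrite inE.
- by move=> b; rewrite inE => /eqP->.
- by move=> b; rewrite inE => /eqP->; allneq.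
- by left; allneq.
- move=> b; rewrite inE => /eqP->; exists [:: q1; x; q2]; split=> //=.
  + by rewrite ec1 e1x ex2 e2d.
  + by allneq.
  + by move=> v; rewrite !inE => /or3P[]->; rewrite ?orbT.
- by move=> b b'; rewrite !inE => /eqP-> /eqP->; rewrite eqxx.
- by rewrite mem_head.
- exact: deg_pos ex1.
- by exists c; [allneq|exact: deg_pos ec1].
- move=> v; rewrite !inE !negb_or => /and3P[vx v1 v2] v0.
  rewrite /= addn0 ![e v _]esym Nx N1 N2 !inE (negPf vx) (negPf v1) (negPf v2) /=.
  eqcase v r.
    have [_ _ _ [n1 n2 _ _ dr]] := deg2_apart ry.
    by subst v; rewrite (negPf n1) (negPf n2) dr.
  eqcase v y.
    have [_ _ _ [n1 n2 _ _ dr]] := deg2_apart yy.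
    by subst v; rewrite (negPf n1) (negPf n2) dr.
  have v3 : 3 <= deg e v by apply: (trio_ge3' dn1 tr).
  eqcase v c; first by subst v; rewrite (negPf ncd); split; move: c4; clear; lia.
  by case: (v == d) => /=; (split; [move: v3; clear; lia|try done; move: v3; clear; lia]).
set e' := red e _ _ _ in D2 D4 P.
have s' : symmetric e' by apply: red_sym.
have zB : c \notin [:: d] by rewrite inE.
have i' : irreflexive e' by apply: red_irr.
have Nry : {in [:: r; y], forall w, e' w =1 e w}.
  move=> w wry v; have [wx w1 w2 [wc wd nw1 nw2 dw]] := deg2_apart wry.
  rewrite /e' /red (negPf wc) !inE (negPf wd) andbF !orbF.
  have -> : [|| w == x, w == q1 | w == q2] = false by rewrite (negPf wx) (negPf w1) (negPf w2).
  case wv: (e w v) => //=; rewrite !negb_or; apply/and3P; split.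
  - apply: contraTneq wv => ->; rewrite esym Nx !inE negb_or; exact/andP.
  - by apply: contraTneq wv => ->.
  - by apply: contraTneq wv => ->.
have e'dc : e' d c by rewrite /e' /red eqxx !inE eqxx /= !orbT.
have dr : deg e r = 2 by apply: (trio_deg2 tr); rewrite !inE eqxx.
have dy : deg e y = 2 by apply: (trio_deg2 tr); rewrite !inE eqxx !orbT.
have q1s : q1 \notin supp e'.
  by apply: red_supp => //; rewrite !inE ?eqxx ?orbT.
have key r0 y0 : r0 \in [:: r; y] -> exc e' y0 r0 d -> False.
  move=> r0ry; have [_ r0q _ [n1 n2 n3 n4 dr0]] := deg2_apart r0ry.
  have Nr0 := Nry r0 r0ry.
  case=> [[S [s [t [h r0S dS _ [Nr Nd sp]]]]]|[S [s [t [h r0S dS _ [Nr Nd sp]]]]]].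
    have : e r0 c by rewrite -Nr0 Nr -Nd.
    by move/(H3 _ _ dr0) => E; rewrite E in c4.
  have Et : t = c.
    by move: e'dc; rewrite Nd eq_sym (negPf n1) => /eqP.
  have [_ L] := core_len s' h; rewrite Et in L.
  have L' : linked e S s c 2.
    apply: linked_rel L => u v uS vS; rewrite /e' /red !inE.
    have -> : u == d = false by apply/negbTE; neq.
    have -> : v == d = false by apply/negbTE; neq.
    by rewrite !andbF !orbF => /and3P[].
  have q1S : q1 \notin S by apply: contra q1s; apply: (core_supp s' i' h).
  have er0d : e r0 d by rewrite -Nr0 Nr eqxx.
  have er0s : e r0 s by rewrite -Nr0 Nr eqxx orbT.
  apply: (nozero_close (w := [:: q1; d; r0]) nz L') => //=.
  - by rewrite ec1 e1d esym er0d er0s.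
  - by rewrite !inE !negb_or q1d; allneq.
  - by rewrite q1S dS r0S.
case: P => [|| ex]; [exact: key|exact: key|].
case: ex => [[S [s [t [_ _ _ _ [Nr Ny _]]]]]|[S [s [t [_ _ _ _ [Nr _ _]]]]]].
  have ers : e r s by rewrite -Nry // Nr eqxx.
  have eys : e y s by rewrite -Nry // Ny eqxx.
  by rewrite (Hsh _ _ _ dr dy ers eys) eqxx in nry.
have := Hadj _ _ dr dy; by rewrite -Nry // Nr eqxx.
Qed.
End Data.
End K23.

Section K23cubic.
Variables (T : finType) (e : rel T).
Hypotheses (esym : symmetric e) (eirr : irreflexive e) (nz : nozero e).
Hypotheses (dn1 : forall v, deg e v != 1) (IH : smaller_exc e).

Section Data.
Variables r x y q1 q2 c d c' d' : T.
Hypothesis tg : tight e r x y.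
Hypotheses (nq12 : q1 != q2) (u1 : uniq [:: x; c; d]).
Hypotheses (Nx : forall v, e x v = (v \in [:: q1; q2]))
  (N1 : forall v, e q1 v = (v \in [:: x; c; d]))
  (N2 : forall v, e q2 v = (v \in [:: x; c; d])).
Hypotheses (uc : uniq [:: q1; q2; c']) (ud : uniq [:: q1; q2; d'])
  (Nc : forall v, e c v = (v \in [:: q1; q2; c']))
  (Nd : forall v, e d v = (v \in [:: q1; q2; d'])).

(* [D] induces K_{2,3} and meets the rest of the graph only in [c'] and [d']. *)
Let D := [:: x; q1; q2; c; d].

Lemma cubic_facts : [/\ uniq D, c' \notin D, d' \notin D, [/\ e c c', e c' c, e d d' & e d' d] &
  {in [:: r; y], forall w, w \notin D /\ deg e w = 2} /\
  forall v, v \notin D -> v != r -> v != y -> 0 < deg e v -> 3 <= deg e v].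
Proof.
have [tr H3 Hadj Hsh] := tg.
have [[ex1 ex2 e1x e2x] [e1c e2c ec1 ec2] [e1d ed1 e2d ed2]
  [nx1 nx2 nxc [nxd _ ncd _]]
  [nq21 [q1c q2c q1d q2d] [_ q2d1 ecd _ ecx] [_ d3 _]]] :=
  C4_facts esym eirr nz dn1 tg nq12 u1 u1 Nx N1 N2.
have [q1c' q2c'] : q1 != c' /\ q2 != c'.
  by move: uc; rewrite /= !inE !negb_or => /and3P[/andP[? ?] ? _].
have [q1d' q2d'] : q1 != d' /\ q2 != d'.
  by move: ud; rewrite /= !inE !negb_or => /and3P[/andP[? ?] ? _].
have ecc : e c c' by rewrite Nc !inE eqxx !orbT.
have edd : e d d' by rewrite Nd !inE eqxx !orbT.
have edc : ~~ e d c by rewrite esym.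
have edx : ~~ e d x by rewrite esym Nx !inE negb_or !(eq_sym d) q1d.
have nc'x : c' != x by apply: contraNneq ecx => <-.
have nd'x : d' != x by apply: contraNneq edx => <-.
have nc'd : c' != d by apply: contraNneq ecd => <-.
have nd'c : d' != c by apply: contraNneq edc => <-.
have nc'c : c' != c by neq.
have nd'd : d' != d by neq.
split; [by rewrite /D; allneq|by rewrite /D !inE !negb_or; allneq|
  by rewrite /D !inE !negb_or; allneq|by split; rewrite // esym|split].
- move=> w wr; have [w0 w1 w2 [w3 w4 _ _ dw]] :=
    deg2_apart esym eirr nz dn1 tg nq12 u1 Nx N1 N2 wr.
  by split=> //; rewrite /D !inE !negb_or; allneq.
- move=> v; rewrite /D inE negb_or => /andP[vx _] vr vy v0.
  exact: (trio_ge3' dn1 tr).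
Qed.

Lemma D_count v : v \notin D -> count (e v) D = (v == c') + (v == d').
Proof.
rewrite /D !inE !negb_or => /and5P[vx v1 v2 vc vd].
rewrite /= addn0 ![e v _]esym Nx N1 N2 Nc Nd !inE.
by rewrite (negPf vx) (negPf v1) (negPf v2) (negPf vc) (negPf vd) /= !add0n.
Qed.

Lemma D_nbr u v : u \notin D -> v \in D -> e u v -> (u == c') || (u == d').
Proof.
rewrite /D !inE !negb_or => /and5P[vx v1 v2 vc vd].
case/or4P=> [||| /orP[]] /eqP->; rewrite esym ?Nx ?N1 ?N2 ?Nc ?Nd !inE;
by rewrite ?(negPf vx) ?(negPf v1) ?(negPf v2) ?(negPf vc) ?(negPf vd) //= => ->; rewrite ?orbT.
Qed.

Lemma cubic_same : c' = d' -> False.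
Proof.
move=> Ecd; have [tr H3 Hadj Hsh] := tg.
have [uD c'D d'D [ecc ec'c edd ed'd] [ryD D3]] := cubic_facts.
have [[ex1 ex2 e1x e2x] _ _ _ [_ _ _ [c3 d3 _]]] :=
  C4_facts esym eirr nz dn1 tg nq12 u1 u1 Nx N1 N2.
apply: (@cut_vertex T e esym eirr nz dn1 IH r x y [set v in D] c' x x tr).
- by rewrite inE.
- by rewrite !inE eqxx.
- exact: deg_pos ex1.
- move=> u v; rewrite !in_set => uD' uv.
  case: (boolP (v \in D)) => [|vD]; [by left|right].
  rewrite esym in uv; have := D_nbr vD uD' uv; rewrite -Ecd orbb; exact/eqP.
- move=> v; rewrite in_set tr.2 !inE => vD /or3P[/eqP E|/eqP//|/eqP E].
    have [rD _] : r \notin D /\ deg e r = 2 by apply: ryD; rewrite mem_head.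
    by case/negP: rD; rewrite -E /D !inE.
  have [yD _] : y \notin D /\ deg e y = 2 by apply: ryD; rewrite !inE eqxx orbT.
  by case/negP: yD; rewrite -E /D !inE.
Qed.

(** An edge from [c'] to [d'] replaces the path [c' c q1 d d']. It restores the degrees of both
    ends, so only [r] and [y] can have degree 2. *)
Lemma cubic_apart : c' != d' -> ~~ e c' d' -> False.
Proof.
move=> ncd ned; have [tr H3 Hadj Hsh] := tg.
have [uD c'D d'D [ecc ec'c edd ed'd] [ryD D3]] := cubic_facts.
have [[ex1 ex2 e1x e2x] [e1c e2c ec1 ec2] [e1d ed1 e2d ed2] _ [_ [q1c _ q1d _] _ _]] :=
  C4_facts esym eirr nz dn1 tg nq12 u1 u1 Nx N1 N2.
have [_ _ ncd0] : [/\ x != c, x != d & c != d].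
  by move: u1; rewrite /= !inE !negb_or => /and3P[/andP[? ?] ? _]; split.
have [|||||||||||U _ _ _] := @red_exc T e esym eirr D c' [:: d'] x r y y nz IH uD.
- by [].
- by rewrite inE.
- by move=> b; rewrite inE => /eqP->.
- by move=> b; rewrite inE => /eqP->.
- by left.
- move=> b; rewrite inE => /eqP->; exists [:: c; q1; d]; split=> //=.
  + by rewrite ec'c ec1 e1d edd.
  + by allneq.
  + by move=> v; rewrite !inE => /or3P[]->; rewrite ?orbT.
- by move=> b b'; rewrite !inE => /eqP-> /eqP->; rewrite eqxx.
- by rewrite mem_head.
- exact: deg_pos ex1.
- by exists c' => //; exact: deg_pos ec'c.
- move=> v vD v0; rewrite D_count // !inE.
  eqcase v r.
    have [_ dr] : r \notin D /\ deg e r = 2 by apply: ryD; rewrite mem_head.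
    by subst v; rewrite dr /=; split=> //; clear; lia.
  eqcase v y.
    have [_ dr] : y \notin D /\ deg e y = 2 by apply: ryD; rewrite !inE eqxx orbT.
    by subst v; rewrite dr /=; split=> //; clear; lia.
  have v3 : 3 <= deg e v by apply: D3.
  by case: (v == c'); case: (v == d') => /=; (split; [move: v3; clear; lia|try done; move: v3; clear; lia]).
- by move: U; rewrite /= !inE eqxx andbF.
Qed.

(* If [c'] has degree 2 then [d'] is a cut vertex. *)
Lemma cubic_deg2 : e c' d' -> deg e c' = 2 -> False.
Proof.
move=> ecd dc; have [tr H3 Hadj Hsh] := tg.
have [uD c'D d'D [ecc ec'c edd ed'd] [ryD D3]] := cubic_facts.
have [[ex1 ex2 e1x e2x] _ _ _ _] :=
  C4_facts esym eirr nz dn1 tg nq12 u1 u1 Nx N1 N2.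
have nd'c : d' != c by move: d'D; rewrite /D !inE !negb_or => /and5P[].
have ncd' : c != d' by rewrite eq_sym.
have Nc' v : e c' v = (v \in [:: c; d']).
  apply: deg_full; rewrite /= ?dc //; first by rewrite inE ncd'.
  by rewrite ec'c ecd.
have nc'x : c' != x by move: c'D; rewrite inE negb_or => /andP[].
have d'3 : deg e d' = 3 by apply: (H3 c').
have nc'd : c' != d by move: c'D; rewrite /D !inE !negb_or => /and5P[].
have ndc' : d != c' by rewrite eq_sym.
have [||s sl ecs] := @deg_more T e [:: d; c'] d'; [by rewrite /= inE ndc'|by rewrite d'3|].
move: sl; rewrite !inE negb_or => /andP[nsd nsc].
have esd : e s d' by rewrite esym.
have nsd' : s != d' by neq.
have nc'd' : c' != d' by neq.
have sD : s \notin D.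
  apply/negP => sD; have := D_nbr d'D sD ecs.
  rewrite [d' == c']eq_sym (negPf nc'd') eqxx => _.
  move: sD ecs; rewrite /D !inE => /or4P[||| /orP[]] /eqP E; subst s; rewrite esym ?Nx ?N1 ?N2 ?Nc ?inE.
  - by move: d'D; rewrite /D !inE !negb_or => /and5P[_ /negPf-> /negPf->].
  - by move: d'D; rewrite /D !inE !negb_or => /and5P[/negPf-> _ _ /negPf-> /negPf->].
  - by move: d'D; rewrite /D !inE !negb_or => /and5P[/negPf-> _ _ /negPf-> /negPf->].
  - move: d'D; rewrite /D !inE !negb_or => /and5P[_ /negPf-> /negPf-> _ _].
    by rewrite eq_sym (negPf nc'd').
  - by rewrite eqxx in nsd.
have [a Ha] : exists a, forall v, v != x -> v != c' -> deg e v == 2 -> v = a.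
  have : c' \in [:: r; x; y] by rewrite -tr.2 dc.
  rewrite !inE (negPf nc'x) /= => /orP[/eqP E|/eqP E]; [exists y|exists r] => v vx vc;
    rewrite tr.2 !inE (negPf vx) /= => /orP[/eqP E'|/eqP E']; rewrite // E' -E eqxx // in vc.
apply: (@cut_vertex T e esym eirr nz dn1 IH r x y (~: (d' |: (c' |: [set v in D]))) d' s a tr).
- by rewrite in_setC in_setU1 eqxx.
- by rewrite in_setC !in_setU1 in_set; apply/norP; split=> //; apply/norP.
- exact: deg_pos esd.
- move=> u v; rewrite !in_setC !in_setU1 !in_set => /norP[udd /norP[uc' uD']] uv.
  case: (eqVneq v d') => [|vd]; [by right|left].
  apply/norP; split=> //; apply/norP; split.
    apply: contraTneq uv => ->; rewrite esym Nc' !inE negb_or udd andbT.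
    by move: uD'; rewrite /D !inE !negb_or => /and5P[].
  apply: contraL uv => vD; apply/negP => uv; have := D_nbr uD' vD uv.
  by rewrite (negPf udd) (negPf uc').
- move=> v; rewrite in_setC !in_setU1 in_set => /norP[vd /norP[vc vD]] dv.
  apply: Ha => //; by move: vD; rewrite inE negb_or => /andP[].
Qed.

(** When [D] is deleted, [c'] and [d'] keep degree at least 3, so only [r] and [y] can have degree
    2. *)
Lemma cubic_big : 4 <= deg e c' -> 4 <= deg e d' -> c' != d' -> False.
Proof.
move=> c4 d4 ncd; have [tr H3 Hadj Hsh] := tg.
have [uD c'D d'D [ecc ec'c edd ed'd] [ryD D3]] := cubic_facts.
have [[ex1 ex2 e1x e2x] _ _ _ _] :=
  C4_facts esym eirr nz dn1 tg nq12 u1 u1 Nx N1 N2.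
have [|||||U _ _ _] := @del_exc T e esym eirr nz IH D x r y y.
- by [].
- by rewrite mem_head.
- exact: deg_pos ex1.
- by exists c' => //; exact: deg_pos ec'c.
- move=> v vD v0; rewrite D_count // !inE.
  eqcase v c'.
    by subst v; rewrite (negPf ncd); split; move: c4; clear; lia.
  eqcase v d'.
    by subst v; split; move: d4; clear; lia.
  split; first exact: deg_ge2.
  move=> E; have : deg e v == 2 by rewrite E.
  rewrite tr.2 !inE => /or3P[->|/eqP Ex|->]; rewrite ?orbT //.
  by move: vD; rewrite Ex mem_head.
- by move: U; rewrite /= !inE eqxx andbF.
Qed.

(** Here [d'] is deleted along with [D], and the edge from [c'] to the third neighbour [d''] of [d']
    stands for the path [c' c q1 x q2 d d' d''] of length 7. In the balance only [c'] loses an edge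
    and joins [r] and [y] as a candidate for degree 2. *)
Lemma cubic_rung : deg e d' = 3 -> 3 <= deg e c' -> e c' d' -> False.
Proof.
move=> d'3 c'3 ecd; have [tr H3 Hadj Hsh] := tg; have [nrx nry nxy] := trio_uniq tr.
have [uD c'D d'D [ecc ec'c edd ed'd] [ryD D3]] := cubic_facts.
have [[ex1 ex2 e1x e2x] [e1c e2c ec1 ec2] [e1d ed1 e2d ed2]
  [nx1 nx2 nxc [nxd _ ncd _]]
  [nq21 [q1c q2c q1d q2d] [_ q2d1 necd _ ecx] [c3 d3 _]]] :=
  C4_facts esym eirr nz dn1 tg nq12 u1 u1 Nx N1 N2.
have edc : e d' c' by rewrite esym.
have nc'd' : c' != d' by neq.
have nc'd : c' != d by move: c'D; rewrite /D !inE !negb_or => /and5P[].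
have ndc' : d != c' by rewrite eq_sym.
have nd'c : d' != c by move: d'D; rewrite /D !inE !negb_or => /and5P[].
have [d'' [u3 Nd']] := deg3_other d'3 ed'd edc ndc'.
have [ndd'' nc'd''] : d != d'' /\ c' != d''.
  by move: u3; rewrite /= !inE !negb_or => /and3P[/andP[? ?] ? _].
have edd' : e d' d'' by rewrite Nd' !inE eqxx !orbT.
have ed'' : e d'' d' by rewrite esym.
have nd'd'' : d' != d'' by neq.
have necd'' : ~~ e c' d''.
  by apply/negP => h; apply: (no_triangle eirr nz (a:=c') (b:=d'') (c:=d')).
have d''D : d'' \notin D.
  apply/negP => dD.
  move: dD edd'; rewrite /D !inE => /or4P[||| /orP[]] /eqP E; rewrite E esym ?Nx ?N1 ?N2 ?Nc ?inE.
  - by move: d'D; rewrite /D !inE !negb_or => /and5P[_ /negPf-> /negPf->].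
  - by move: d'D; rewrite /D !inE !negb_or => /and5P[/negPf-> _ _ /negPf-> /negPf->].
  - by move: d'D; rewrite /D !inE !negb_or => /and5P[/negPf-> _ _ /negPf-> /negPf->].
  - move: d'D; rewrite /D !inE !negb_or => /and5P[_ /negPf-> /negPf-> _ _].
    by rewrite eq_sym (negPf nc'd').
  - by rewrite E eqxx in ndd''.
pose D' := d' :: D.
have uD' : uniq D' by rewrite cons_uniq d'D uD.
have c'D' : c' \notin D' by rewrite inE negb_or nc'd' c'D.
have d''D' : d'' \notin D' by rewrite inE negb_or eq_sym nd'd'' d''D.
have uB : uniq [:: d''] by [].
have zB : c' \notin [:: d''] by rewrite inE.
have zNB : {in [:: d''], forall b, ~~ e c' b} by move=> b; rewrite inE => /eqP->.
have BD : {in [:: d''], forall b, b \notin D'} by move=> b; rewrite inE => /eqP->.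
have [||||||U D2 D4 P] := @red_exc T e esym eirr D' c' [:: d''] x r y c' nz IH uD' uB zB zNB BD (or_introl c'D').
- move=> b; rewrite inE => /eqP->; exists [:: c; q1; x; q2; d; d']; split=> //=.
  + by rewrite ec'c ec1 e1x ex2 e2d edd edd'.
  + have := uD'; rewrite /D' /D /= !inE !negb_or.
    move=> /andP[/and5P[? ? ? ? ?] /and5P[/and4P[? ? ? ?] /and3P[? ? ?] /andP[? ?] ? _]].
    by allneq.
  + by move=> v; rewrite !inE; do ![case/orP]; move=> ->; rewrite ?orbT.
- by move=> b b'; rewrite !inE => /eqP-> /eqP->; rewrite eqxx.
- by rewrite !inE eqxx orbT.
- exact: deg_pos ex1.
- by exists c' => //; exact: deg_pos ec'c.
- move=> v; rewrite [v \in D']in_cons => /norP[vd' vD] v0.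
  have -> : count (e v) D' = e v d' + count (e v) D by [].
  rewrite D_count // (negPf vd') addn0 [e v d']esym Nd' !inE.
  have -> : v == d = false by move: vD; rewrite /D !inE !negb_or => /and5P[_ _ _ _ /negPf].
  rewrite /= muln1.
  eqcase v c'.
    by subst v; rewrite (negPf nc'd'') !orbT; split=> //; move: c'3; clear; lia.
  eqcase v r.
    have [_ dr] : r \notin D /\ deg e r = 2 by apply: ryD; rewrite mem_head.
    by subst v; rewrite dr; split=> //; clear; lia.
  eqcase v y.
    have [_ dr] : y \notin D /\ deg e y = 2 by apply: ryD; rewrite !inE eqxx orbT.
    by subst v; rewrite dr; split=> //; clear; lia.
  have v3 : 3 <= deg e v by apply: D3.
  by case: (v == d'') => /=; (split; [move: v3; clear; lia|try done; move: v3; clear; lia]).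
set e' := red e _ _ _ in D2 D4 P.
have s' : symmetric e' by apply: red_sym.
have i' : irreflexive e' by apply: red_irr.
have sub u v : u != c' -> v != c' -> e' u v -> e u v.
  by move=> uc0 vc; rewrite /e' /red (negPf uc0) (negPf vc) !orbF => /and3P[].
have e'cd : e' c' d'' by rewrite /e' /red eqxx mem_head orbT.
have subc v : v != d'' -> e' c' v -> e c' v.
  move=> vd; rewrite /e' /red; case/or3P=> [/and3P[]//|/andP[_]|/andP[_]]; rewrite inE.
    by rewrite (negPf vd).
  by rewrite (negPf nc'd'').
have noS v : v \in D' -> v \notin supp e'.
  move=> vD'; apply: red_supp => //; first by apply: contraTneq vD' => ->.
  by rewrite inE; apply: contraTneq vD' => ->.
have dr : deg e r = 2 by apply: (trio_deg2 tr); rewrite !inE eqxx.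
have dy : deg e y = 2 by apply: (trio_deg2 tr); rewrite !inE eqxx !orbT.
move: (U); rewrite /= !inE !negb_or => /and3P[/andP[_ nrc'] nyc' _].
have notc w : w \in [:: r; y] -> w != c'.
  by rewrite !inE => /orP[]/eqP->.
have share w w' v : w \in [:: r; y] -> w' \in [:: r; y] -> w != w' -> v != c' ->
    e' w v -> e' w' v -> False.
  move=> wr wr' nww vc wv w'v.
  have [_ dw] := ryD w wr; have [_ dw'] := ryD w' wr'.
  case/eqP: nww; apply: (Hsh _ _ v) => //; apply: sub => //; exact: notc.
have key r0 y0 : r0 \in [:: r; y] -> y0 \in [:: r; y] -> r0 != y0 -> exc e' y0 r0 c' -> False.
  move=> r0ry y0ry nry0 ex; have nr0c := notc _ r0ry; have ny0c := notc _ y0ry.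
  case: ex => [[S [s [t [h r0S cS _ [Nr Nc' sp]]]]]|[S [s [t [h r0S cS _ [Nr Nc' sp]]]]]];
    have [[sS tS _] [nst _ _]] := core_in h.
  - have d'S : d' \notin S.
      by apply/negP => /(core_supp s' i' h); apply/negP/noS; rewrite mem_head.
    have nsc : s != c' by neq.
    have ntc : t != c' by neq.
    (* Either the root [y0] is adjacent to both terminals and so has a common neighbour with [r0],
       or the terminals are joined by a path of residue 0, which closes through [d' c']. *)
    have [_ [[ys yt]|L]] := core_len s' h.
      by apply: (share r0 y0 s r0ry y0ry nry0 nsc _ ys); rewrite Nr eqxx.
    have go a b : linked e' S a b 0 -> b = d'' -> a != b -> e' c' a -> False.
      move=> L0 Eb nab ca; rewrite Eb in nab.
      have eca : e c' a by apply: subc.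
      have L1 : linked e S a b 0.
        apply: linked_rel L0 => u v uS vS; apply: sub; neq.
      apply: (nozero_close (w := [:: d'; c']) nz L1) => //=.
      + by rewrite Eb ed'' edc eca.
      + by rewrite inE eq_sym nc'd'.
      + by rewrite d'S cS.
    have := e'cd; rewrite Nc' => /orP[/eqP E|/eqP E].
      by apply: (go t s (linked_sym s' L)); rewrite 1?eq_sym // Nc' eqxx orbT.
    by apply: (go s t L); rewrite // Nc' eqxx.
  - have d'S : d' \notin S.
      by apply/negP => /(core_supp s' i' h); apply/negP/noS; rewrite mem_head.
    have nsc : s != c' by neq.
    have ntc : t != c' by neq.
    have [_ L] := core_len s' h.
    have L1 : linked e S s t 2.
      apply: linked_rel L => u v uS vS; apply: sub; neq.
    have er0s : e r0 s by apply: sub; rewrite // Nr eqxx orbT.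
    have ntr0 : t != r0 by neq.
    have nd'c' : d' != c' by rewrite eq_sym.
    have r0d' : r0 != d'.
      by apply/eqP => E; have [_] := ryD r0 r0ry; rewrite E d'3.
    have d'r0 : d' != r0 by rewrite eq_sym.
    have nc'r0 : c' != r0 by rewrite eq_sym.
    (* According to whether [d''] is [r0] or [t], the path of residue 2 between [s] and [t] closes
       through [c' d' r0] or [d' c' r0]. *)
    have := e'cd; rewrite Nc' => /orP[/eqP E|/eqP E].
      have ect : e c' t by apply: subc; rewrite ?E // Nc' eqxx orbT.
      apply: (nozero_close (w := [:: c'; d'; r0]) nz L1) => //=.
      + by rewrite esym ect ecd -E edd' E er0s.
      + by rewrite !inE !negb_or nc'd' nc'r0 d'r0.
      + by rewrite cS d'S r0S.
    have ecr : e c' r0 by apply: subc; rewrite ?E 1?eq_sym // Nc' eqxx.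
    apply: (nozero_close (w := [:: d'; c'; r0]) nz L1) => //=.
    + by rewrite -E ed'' edc ecr er0s.
    + by rewrite !inE !negb_or nd'c' d'r0 nc'r0.
    + by rewrite d'S cS r0S.
have ry : r \in [:: r; y] by rewrite mem_head.
have yy : y \in [:: r; y] by rewrite !inE eqxx orbT.
have nyr : y != r by rewrite eq_sym.
case: P => [ex|ex|ex]; [exact: (key y r)|exact: (key r y)|].
case: ex => [[S [s [t [h _ _ _ [Nr Ny _]]]]]|[S [s [t [_ _ _ _ [Nr _ _]]]]]].
  have [_ [nst _ _]] := core_in h.
  case: (eqVneq s c') => [E|nsc].
    by apply: (share r y t) => //; rewrite ?Nr ?Ny ?eqxx ?orbT // -E eq_sym.
  by apply: (share r y s) => //; rewrite ?Nr ?Ny ?eqxx.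
have := Hadj _ _ dr dy; have -> // : e r y by apply: sub; rewrite // Nr eqxx.
Qed.
End Data.
End K23cubic.

Section Classify.
Variables (T : finType) (e : rel T).
Hypotheses (esym : symmetric e) (eirr : irreflexive e) (nz : nozero e).
Hypotheses (dn1 : forall v, deg e v != 1) (IH : smaller_exc e).

Lemma trio_mid r x y u : trio e r x y -> deg e u = 2 -> exists r' y', trio e r' u y'.
Proof.
move=> tr du; have : u \in [:: r; x; y] by rewrite -tr.2 du.
rewrite !inE => /or3P[]/eqP->.
- by exists y, x; apply: trio_rot (trio_rot tr).
- by exists r, y.
- by exists x, r; apply: trio_rot tr.
Qed.

Lemma tight_mid r x y u : tight e r x y -> deg e u = 2 -> exists r' y', tight e r' u y'.
Proof.
by move=> [tr h1 h2 h3] du; have [r' [y' tr']] := trio_mid tr du; exists r', y'.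
Qed.

Lemma tight_false r x y : tight e r x y -> False.
Proof.
move=> tg; have [v [dv [q1 [q2 [c [v1 v2 nq [ncv c1 c2]]]]]]] :=
  tight_C4 esym eirr nz dn1 IH tg.
have [r' [y' tg']] := tight_mid tg dv; move: r' y' v tg' dv v1 v2 ncv => {tg}.
clear r x y; move=> r y x tg dx ex1 ex2 ncx.
have [tr H3 Hadj Hsh] := tg.
have Nx u : e x u = (u \in [:: q1; q2]).
  by apply: deg_full; rewrite /= ?dx ?ex1 ?ex2 //= inE nq.
have e1x : e q1 x by rewrite esym.
have e2x : e q2 x by rewrite esym.
have e1c : e q1 c by rewrite esym.
have e2c : e q2 c by rewrite esym.
have nxc : x != c by rewrite eq_sym.
have [d1 [u1 N1]] := deg3_other (H3 _ _ dx ex1) e1x e1c nxc.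
have [d2 [u2 N2]] := deg3_other (H3 _ _ dx ex2) e2x e2c nxc.
case: (eqVneq d1 d2) => [E|nd12]; last first.
  case: (boolP (e d1 d2)) => [ed|ned].
    exact: (C4_rung esym eirr nz dn1 IH tg nq u1 u2 Nx N1 N2 ed).
  exact: (C4_apart esym eirr nz dn1 IH tg nq u1 u2 Nx N1 N2 nd12 ned).
subst d2; move: d1 u1 u2 N1 N2 => d u1 _ N1 N2.
have u1' : uniq [:: x; d; c].
  by move: u1; rewrite /= !inE !negb_or => /and3P[/andP[? ?] ? _]; allneq.
have N1' v : e q1 v = (v \in [:: x; d; c]) by rewrite N1 !inE [(v == c) || _]orbC.
have N2' v : e q2 v = (v \in [:: x; d; c]) by rewrite N2 !inE [(v == c) || _]orbC.
case: (leqP 4 (deg e c)) => [c4|c4].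
  exact: (K23_big esym eirr nz dn1 IH tg nq u1 Nx N1 N2 c4).
case: (leqP 4 (deg e d)) => [d4|d4].
  exact: (K23_big esym eirr nz dn1 IH tg nq u1' Nx N1' N2' d4).
have [_ [_ _ ec1 ec2] [_ ed1 _ ed2] _ [_ _ _ [c3 d3 _]]] :=
  C4_facts esym eirr nz dn1 tg nq u1 u1 Nx N1 N2.
have {c4}c3 : deg e c = 3 by apply/eqP; rewrite eqn_leq c3 andbT -ltnS.
have {d4}d3 : deg e d = 3 by apply/eqP; rewrite eqn_leq d3 andbT -ltnS.
have [c' [uc Nc]] := deg3_other c3 ec1 ec2 nq.
have ed2' : e d q2 by rewrite esym N2 !inE eqxx !orbT.
have [d' [ud Nd]] := deg3_other d3 ed1 ed2' nq.
case: (eqVneq c' d') => [E|ncd].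
  exact: (cubic_same esym eirr nz dn1 IH tg nq u1 Nx N1 N2 uc ud Nc Nd E).
case: (boolP (e c' d')) => [ecd|necd]; last first.
  exact: (cubic_apart esym eirr nz dn1 IH tg nq u1 Nx N1 N2 uc ud Nc Nd ncd necd).
have edc : e d' c' by rewrite esym.
have C2 := cubic_deg2 esym eirr nz dn1 IH tg nq u1 Nx N1 N2 uc ud Nc Nd ecd.
have D2 := cubic_deg2 esym eirr nz dn1 IH tg nq u1' Nx N1' N2' ud uc Nd Nc edc.
have c'3 : 3 <= deg e c'.
  by rewrite ltn_neqAle eq_sym (deg_ge2 dn1 (deg_pos ecd)) andbT; apply/eqP.
have d'3 : 3 <= deg e d'.
  by rewrite ltn_neqAle eq_sym (deg_ge2 dn1 (deg_pos edc)) andbT; apply/eqP.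
case: (leqP 4 (deg e d')) => [d4|d4]; last first.
  have {}d4 : deg e d' = 3 by apply/eqP; rewrite eqn_leq d'3 andbT -ltnS.
  exact: (cubic_rung esym eirr nz dn1 IH tg nq u1 Nx N1 N2 uc ud Nc Nd d4 c'3 ecd).
case: (leqP 4 (deg e c')) => [c4|c4]; last first.
  have {}c4 : deg e c' = 3 by apply/eqP; rewrite eqn_leq c'3 andbT -ltnS.
  exact: (cubic_rung esym eirr nz dn1 IH tg nq u1' Nx N1' N2' ud uc Nd Nc c4 d'3 edc).
exact: (cubic_big esym eirr nz dn1 IH tg nq u1 Nx N1 N2 uc ud Nc Nd c4 d4 ncd).
Qed.

Lemma trio_exc r x y : trio e r x y -> exists r p q, exc e r p q.
Proof.
move=> tr; have [nrx nry nxy] := trio_uniq tr.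
have trx := trio_rot tr; have try := trio_rot trx.
case: (boolP (e x y)) => [h|nexy]; first exact: (deg2_adjacent esym eirr nz dn1 IH tr h).
case: (boolP (e y r)) => [h|neyr]; first exact: (deg2_adjacent esym eirr nz dn1 IH trx h).
case: (boolP (e r x)) => [h|nerx]; first exact: (deg2_adjacent esym eirr nz dn1 IH try h).
have Hadj u v : deg e u = 2 -> deg e v = 2 -> ~~ e u v.
  move=> /eqP; rewrite tr.2 => hu /eqP; rewrite tr.2 => hv.
  move: hu hv; rewrite !inE => /or3P[]/eqP-> /or3P[]/eqP->; rewrite ?eirr //; by rewrite esym.
have ind a b c : trio e a b c -> indep e a b c.
  move=> t; have d u : u \in [:: a; b; c] -> deg e u = 2 by apply: trio_deg2.
  by rewrite /indep !Hadj //; apply: d; rewrite !inE eqxx ?orbT.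
have tw a b c : trio e a b c -> twins e b c -> exists r p q, exc e r p q.
  move=> t tw; have db : deg e b = 2 by apply: (trio_deg2 t); rewrite !inE eqxx orbT.
  have [p [q [npq Nb]]] := deg2_ends db.
  apply: (deg2_twins esym eirr nz dn1 IH t (ind _ _ _ t) npq Nb).
  by move=> u; rewrite -tw Nb.
have [t1|nt1] := boolP [forall u, e x u == e y u].
  by apply: (tw _ _ _ tr) => u; apply/eqP; move/forallP: t1.
have [t2|nt2] := boolP [forall u, e y u == e r u].
  by apply: (tw _ _ _ trx) => u; apply/eqP; move/forallP: t2.
have [t3|nt3] := boolP [forall u, e r u == e x u].
  by apply: (tw _ _ _ try) => u; apply/eqP; move/forallP: t3.
have toF a b : ~~ [forall u, e a u == e b u] -> ~ twins e a b /\ ~ twins e b a.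
  by move=> h; split=> tw'; case/negP: h; apply/forallP => u; rewrite tw'.
have [n1 n1'] := toF _ _ nt1; have [n2 n2'] := toF _ _ nt2; have [n3 n3'] := toF _ _ nt3.
have Htw u v : deg e u = 2 -> deg e v = 2 -> u != v -> ~ twins e u v.
  move=> /eqP; rewrite tr.2 => hu /eqP; rewrite tr.2 => hv.
  by move: hu hv; rewrite !inE => /or3P[]/eqP-> /or3P[]/eqP->; rewrite ?eqxx.
have D2 a b c u : trio e a b c -> u \in [:: a; b; c] -> deg e u = 2 by apply: trio_deg2.
have tws a b c : trio e a b c -> [/\ ~ twins e a b, ~ twins e a c & ~ twins e b c].
  move=> t; have [nab nac nbc] := trio_uniq t.
  by split; apply: Htw => //; apply: (D2 _ _ _ _ t); rewrite !inE eqxx ?orbT.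
exfalso.
have H3 u v : deg e u = 2 -> e u v -> deg e v = 3.
  move=> du uv; apply/eqP; rewrite eqn_leq; apply/andP; split; last first.
    have vu : e v u by rewrite esym.
    rewrite ltn_neqAle eq_sym (deg_ge2 dn1 (deg_pos vu)) andbT.
    by apply/eqP => dv; have := Hadj u v du dv; rewrite uv.
  rewrite leqNgt; apply/negP => v4; have [a [c t]] := trio_mid tr du.
  have [b [nvb Nu]] := deg2_other du uv; have [w1 w2 w3] := tws _ _ _ t.
  have nbv : b != v by rewrite eq_sym.
  apply: (big_nbr esym eirr nz dn1 IH t (ind _ _ _ t) w1 w2 w3 nbv _ v4).
  by move=> w; rewrite Nu !inE orbC.
apply: (@tight_false r x y); split=> //.
have sh a b c q : trio e a b c -> e b q -> e a q -> False.
  move=> t; have [w1 w2 w3] := tws _ _ _ t.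
  exact: (shared_nbr esym eirr nz dn1 IH t (ind _ _ _ t) w1 w2 w3 H3).
move=> u v w /eqP; rewrite tr.2 => hu /eqP; rewrite tr.2 => hv.
move: hu hv; rewrite !inE => /or3P[]/eqP-> /or3P[]/eqP-> // h1 h2; exfalso.
- exact: (sh _ _ _ w tr h2 h1).
- exact: (sh _ _ _ w try h1 h2).
- exact: (sh _ _ _ w tr h1 h2).
- exact: (sh _ _ _ w trx h2 h1).
- exact: (sh _ _ _ w try h2 h1).
- exact: (sh _ _ _ w trx h1 h2).
Qed.
End Classify.

(** * Classification *)

Lemma deg2_exc (T : finType) (e : rel T) x :
  symmetric e -> irreflexive e -> nozero e -> (forall v, deg e v != 1) ->
  smaller_exc e -> deg e x = 2 -> #|[set v | deg e v == 2]| <= 3 ->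
  exists r p q, exc e r p q.
Proof.
move=> esym eirr nz dn1 IH dx; set A := [set v | _] => A3.
have AE v : (deg e v == 2) = (v \in enum A) by rewrite mem_enum inE.
have xA : x \in enum A by rewrite -AE dx.
have uA : uniq (enum A) by apply: enum_uniq.
rewrite cardE in A3.
case: (enum A) AE xA uA A3 => [//|a [|b [|c [|]]]] // AE xA uA _.
- exfalso; apply: (few_deg2 esym eirr nz dn1 IH (x := a) (y := a)) => [v|].
    by rewrite AE !inE => ->.
  by apply/eqP; rewrite AE mem_head.
- exfalso; apply: (few_deg2 esym eirr nz dn1 IH (x := a) (y := b)) => [v|].
    by rewrite AE.
  by apply/eqP; rewrite AE mem_head.
- by apply: (@trio_exc T e esym eirr nz dn1 IH a b c).
Qed.

(** Without a vertex of degree 2, an edge is deleted. This does not shrink the support, hence the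
    inner induction on the number of edges. Afterwards at most the two ends of the edge have degree
    2, one vertex short of an exceptional graph. *)
Theorem nozero_exc (T : finType) (e : rel T) :
  symmetric e -> irreflexive e -> nozero e -> (forall v, deg e v != 1) ->
  (exists v, 0 < deg e v) -> #|[set v | deg e v == 2]| <= 3 ->
  exists r p q, exc e r p q.
Proof.
move: {2}#|supp e| (leqnn #|supp e|) => n; elim: n.+1 {-2}n (ltnSn n) e => // {}n IHn m mn e em.
(* The outer hypothesis depends on the graph only through the size of its support, so it remains
   available after edge deletions. *)
have sm (e0 : rel T) : #|supp e0| = #|supp e| -> smaller_exc e0.
  move=> E0 e1 s1 i1 z1 d1 v1 c1; rewrite E0 => lt1.
  apply: (IHn #|supp e1|) => //; apply: leq_trans lt1 _; apply: leq_trans em _.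
  by rewrite -ltnS.
suff gen k (e0 : rel T) v0 : #|supp e0| = #|supp e| ->
    symmetric e0 -> irreflexive e0 -> nozero e0 -> (forall v, deg e0 v != 1) ->
    0 < deg e0 v0 -> #|[set v | deg e0 v == 2]| <= 3 ->
    #|[set w : T * T | e0 w.1 w.2]| < k -> exists r p q, exc e0 r p q.
  move=> es ei enz edn [v0 ev0] e3.
  exact: (gen _ e v0 erefl es ei enz edn ev0 e3 (ltnSn _)).
elim: k e0 v0 => // k IHk e0 v0 E0 esym eirr nz dn1 dv0 A3 el.
case: (pickP [pred v | deg e0 v == 2]) => [x /eqP dx|no2].
  exact: deg2_exc esym eirr nz dn1 (sm _ E0) dx A3.
have ge3 w z : e0 w z -> 3 <= deg e0 w.
  move=> wz; rewrite ltn_neqAle eq_sym.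
  by have := no2 w => /= ->; rewrite (deg_ge2 dn1 (deg_pos wz)).
have [z v0z] : exists z, e0 v0 z.
  by move: dv0; rewrite /deg card_gt0 => /set0Pn[z]; rewrite inE; exists z.
have zv0 : e0 z v0 by rewrite esym.
pose e1 : rel T := fun a b => [&& e0 a b, (a, b) != (v0, z) & (a, b) != (z, v0)].
have nvz : v0 != z by neq.
have s1 : symmetric e1.
  by move=> a b; rewrite /e1 esym !xpair_eqE; case: (a == v0) (a == z) (b == v0) (b == z) => [] [] [] [].
have i1 : irreflexive e1 by move=> a; rewrite /e1 eirr.
have z1 : nozero e1.
  move=> s [h1 h2 h3]; apply: nz; split=> //; apply: sub_cycle h3 => a b.
  by case/and3P.
have dl a b : e0 a b -> e0 b a -> a != b -> (forall w, e1 a w = e0 a w && (w != b)) ->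
    deg e0 a = (deg e1 a).+1.
  move=> ab ba nab H; rewrite /deg (cardsD1 b [set u | e0 a u]) inE ab add1n; congr _.+1.
  by apply: eq_card => u; rewrite !inE H andbC.
have d1 : deg e0 v0 = (deg e1 v0).+1.
  apply: (dl _ z) => // w; rewrite /e1 !xpair_eqE eqxx (negPf nvz) /= andbT.
  by [].
have d2 : deg e0 z = (deg e1 z).+1.
  apply: (dl _ v0) => //; first by rewrite eq_sym.
  by move=> w; rewrite /e1 !xpair_eqE eqxx [z == v0]eq_sym (negPf nvz) /=.
have d3 w : w != v0 -> w != z -> deg e1 w = deg e0 w.
  by move=> n1 n2; apply: eq_card => u; rewrite !inE /e1 !xpair_eqE (negPf n1) (negPf n2) !andbT.
have d1' : 2 <= deg e1 v0 by have := ge3 _ _ v0z; rewrite d1.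
have d2' : 2 <= deg e1 z by have := ge3 _ _ zv0; rewrite d2.
have D2 w : deg e1 w == 2 -> w \in [:: v0; z].
  rewrite !inE; case: (eqVneq w v0) => //= n1; case: (eqVneq w z) => //= n2.
  by rewrite d3 // => dw; have := no2 w; rewrite /= dw.
have A1 : #|[set v | deg e1 v == 2]| <= 2.
  apply: leq_trans (card_size [:: v0; z]); apply: subset_leq_card.
  by apply/subsetP=> v; rewrite inE => /D2.
have [r [p [q ex]]] : exists r p q, exc e1 r p q.
  apply: (IHk e1 v0 _ s1 i1 z1) => //.
  - rewrite -E0; apply: eq_card => w.
    have degP (f : rel T) : (w \in supp f) = (0 < deg f w).
      rewrite inE /deg card_gt0; apply/existsP/set0Pn => -[u]; rewrite ?inE => h; exists u => //.
      by rewrite inE.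
    rewrite !degP; case: (eqVneq w v0) => [->|n1]; first by rewrite d1 (ltnW d1').
    case: (eqVneq w z) => [->|n2]; first by rewrite d2 (ltnW d2').
    by rewrite d3.
  - move=> v; case: (eqVneq v v0) => [->|n1]; first by rewrite neq_ltn d1' orbT.
    case: (eqVneq v z) => [->|n2]; first by rewrite neq_ltn d2' orbT.
    by rewrite d3.
  - exact: ltnW.
  - exact: leq_trans A1 _.
  - rewrite -ltnS; apply: leq_trans el; rewrite ltnS.
    apply: proper_card; apply/properP; split.
      by apply/subsetP=> w; rewrite !inE => /and3P[].
    by exists (v0, z); rewrite !inE //= /e1 eqxx andbF.
have [U DU _] := exc_deg s1 i1 ex.
suff : 3 <= 2 by [].
apply: (uniq_leq_size U (s2 := [:: v0; z])) => w; rewrite -DU; exact: D2.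
Qed.

(** * Numberings of the construction *)

Definition bounded (n : nat) (E : rel nat) : Prop := forall i j, E i j -> (i < n) && (j < n).

Section NatGraphs.
Variables (n : nat) (E : rel nat).
Hypotheses (bE : bounded n E).
Implicit Types i j x y w : nat.

Lemma bounded_out i j : (n <= i) || (n <= j) -> E i j = false.
Proof. by case Eij: (E i j) => //; move/bE: Eij; lia. Qed.

Lemma path3_old x y i j : i < n -> j < n -> add_path3 n E x y i j = E i j.
Proof. by rewrite /add_path3 /sedge; case: (E i j) => //=; lia. Qed.

Lemma path3_fst x y i : x < n -> y < n -> i < n ->
  (add_path3 n E x y i n = (i == x)) * (add_path3 n E x y n i = (i == x)).
Proof.
by move=> xn yn ni; rewrite /add_path3 /sedge !bounded_out ?leqnn ?orbT //; split; lia.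
Qed.

Lemma path3_snd x y i : x < n -> y < n -> i < n ->
  (add_path3 n E x y i n.+1 = (i == y)) * (add_path3 n E x y n.+1 i = (i == y)).
Proof.
by move=> xn yn ni; rewrite /add_path3 /sedge !bounded_out ?leqnSn ?orbT //; split; lia.
Qed.

Lemma path3_new x y : x < n -> y < n ->
  (add_path3 n E x y n n.+1 * add_path3 n E x y n.+1 n *
   ~~ add_path3 n E x y n n * ~~ add_path3 n E x y n.+1 n.+1)%type.
Proof.
by move=> xn yn; rewrite /add_path3 /sedge !bounded_out ?leqnn ?leqnSn //; do !split; lia.
Qed.

Lemma path3_bounded x y : x < n -> y < n -> bounded n.+2 (add_path3 n E x y).
Proof.
move=> xn yn i j; rewrite /add_path3 /sedge.
by case/or4P=> [/bE|||]; lia.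
Qed.

Lemma twin_old w i j : i < n -> j < n -> add_twin n E w i j = E i j.
Proof. by rewrite /add_twin; case: (E i j) => //=; lia. Qed.

Lemma twin_new w i : symmetric E ->  i < n ->
  (add_twin n E w i n = E i w) * (add_twin n E w n i = E i w) * (~~ add_twin n E w n n).
Proof.
move=> sE ni; have out j : E j n = false by rewrite bounded_out ?leqnn ?orbT.
have out' j : E n j = false by rewrite bounded_out ?leqnn.
by rewrite /add_twin !out !out' !andbF eqxx /= ?orbF [E w i]sE.
Qed.

Lemma twin_bounded w : bounded n.+1 (add_twin n E w).
Proof. by move=> i j; rewrite /add_twin; case/or3P=> [/bE|/andP[/eqP-> /bE]|/andP[/eqP-> /bE]]; lia. Qed.

Lemma C4_old x y i j : i < n -> j < n -> add_C4 n E x y i j = E i j.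
Proof. by rewrite /add_C4 /sedge; case: (E i j) => //=; lia. Qed.

Lemma C4_bounded x y : x < n -> y < n -> bounded n.+4 (add_C4 n E x y).
Proof.
move=> xn yn i j; rewrite /add_C4 /sedge.
by case/orP=> [/bE|]; lia.
Qed.

(* The internal vertices of the new 4-cycle are [n], ..., [n + 3], of which [n] and
   [n + 2] are attached to the old graph. *)
Lemma C4_out x y i : x < n -> y < n -> i < n ->
  (add_C4 n E x y i n = (i == x)) * (add_C4 n E x y n i = (i == x)) *
  (add_C4 n E x y i n.+2 = (i == y)) * (add_C4 n E x y n.+2 i = (i == y)) *
  (add_C4 n E x y i n.+1 = false) * (add_C4 n E x y n.+1 i = false) *
  (add_C4 n E x y i n.+3 = false) * (add_C4 n E x y n.+3 i = false).
Proof.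
move=> xn yn ni; rewrite /add_C4 /sedge !bounded_out ?orbT //=; try lia.
by do !split; lia.
Qed.

Lemma C4_in x y i j : x < n -> y < n -> i < 4 -> j < 4 ->
  add_C4 n E x y (n + i) (n + j) = odd (i + j).
Proof.
move=> xn yn i4 j4; rewrite /add_C4 /sedge bounded_out ?leq_addr //=.
by case: i i4 => [|[|[|[|i]]]] //; case: j j4 => [|[|[|[|j]]]] //= _ _; lia.
Qed.
End NatGraphs.

Lemma sedge_sym a b : symmetric (sedge a b).
Proof. by move=> u v; rewrite /sedge orbC; congr (_ || _); rewrite andbC. Qed.

Lemma path3_sym n E x y : symmetric E -> symmetric (add_path3 n E x y).
Proof. by move=> sE u v; rewrite /add_path3 sE; congr [|| _, _, _ | _]; apply: sedge_sym. Qed.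

Lemma C4_sym n E x y : symmetric E -> symmetric (add_C4 n E x y).
Proof.
by move=> sE u v; rewrite /add_C4 sE; congr [|| _, _, _, _, _, _ | _]; apply: sedge_sym.
Qed.

Lemma twin_sym n E w : symmetric E -> symmetric (add_twin n E w).
Proof. by move=> sE u v; rewrite /add_twin sE; congr (_ || _); rewrite orbC. Qed.

Section Numbering.
Variables (T : finType) (e : rel T).
Hypotheses (esym : symmetric e) (eirr : irreflexive e).

Definition numbers (V : {set T}) (n : nat) (E : rel nat) (f : T -> nat) : Prop :=
  [/\ {in V &, injective f}, {in V, forall v, f v < n},
      forall k, k < n -> exists2 v, v \in V & f v = k &
      {in V &, forall u v, e u v = E (f u) (f v)}].

Definition extend (f : T -> nat) (w : T) (n : nat) : T -> nat :=
  fun v => if v == w then n else f v.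

Lemma numbers_extend V n E E' f w : numbers V n E f -> w \notin V ->
  (forall i j, i < n -> j < n -> E' i j = E i j) ->
  {in V, forall v, (E' (f v) n = e v w) * (E' n (f v) = e v w)} -> ~~ E' n n ->
  numbers (w |: V) n.+1 E' (extend f w n).
Proof.
move=> [fi fb fs fe] wV EE En Enn.
have nw v : v \in V -> (v == w) = false by move=> vV; apply/negbTE; neq.
split.
- move=> u v; rewrite !in_setU1 /extend => /orP[/eqP->|uV] /orP[/eqP->|vV] //.
  + by rewrite eqxx nw // => E0; have := fb v vV; rewrite -E0 ltnn.
  + by rewrite eqxx nw // => E0; have := fb u uV; rewrite E0 ltnn.
  + by rewrite !nw //; apply: fi.
- move=> v; rewrite in_setU1 /extend => /orP[/eqP->|vV]; first by rewrite eqxx.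
  by rewrite nw // ltnS ltnW // fb.
- move=> k; rewrite ltnS leq_eqVlt => /orP[/eqP->|kn].
    by exists w; rewrite ?setU11 // /extend eqxx.
  have [v vV <-] := fs k kn; exists v; first by rewrite in_setU1 vV orbT.
  by rewrite /extend nw.
- move=> u v; rewrite !in_setU1 /extend => /orP[/eqP->|uV] /orP[/eqP->|vV].
  + by rewrite eqxx eirr (negPf Enn).
  + by rewrite eqxx nw // En // esym.
  + by rewrite eqxx nw // En.
  + by rewrite !nw // EE ?fb // fe.
Qed.

Lemma numbers_ndeg V n E f v : numbers V n E f -> v \in V -> ndeg n E (f v) = dg e V v.
Proof.
move=> [fi fb fs fe] vV; rewrite /ndeg /dg.
have P : perm_eq (iota 0 n) [seq f u | u <- enum V].
  apply: uniq_perm; first exact: iota_uniq.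
    by rewrite map_inj_in_uniq ?enum_uniq // => a b; rewrite !mem_enum; apply: fi.
  move=> k; rewrite mem_iota /= add0n; apply/idP/mapP => [/fs[u uV <-]|[u]].
    by exists u; rewrite ?mem_enum.
  by rewrite mem_enum => uV ->; apply: fb.
rewrite (permP P) count_map -sum1_count big_mkcond big_enum /=.
by apply: eq_bigr => u uV; rewrite fe //; case: (E _ _).
Qed.

Lemma numbers_ndeg2 V n E f v : numbers V n E f -> v \in V ->
  ndeg2 n E (f v) = (dg e V v == 2).
Proof.
move=> nu vV; rewrite /ndeg2 (numbers_ndeg nu vV).
by case: nu => _ fb _ _; rewrite fb.
Qed.
End Numbering.

(** * Cores as stages of the construction *)

Section Stage.
Variables (T : finType) (e : rel T).
Hypotheses (esym : symmetric e) (eirr : irreflexive e).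
Variable r : T.

(** Boundedness and symmetry are carried along because they are needed to evaluate the next
    extension and [excg] does not record them. *)
Definition stage (V : {set T}) : Prop := exists n E f,
  [/\ numbers e V n E f, bounded n E, symmetric E & excg (f r) n E].

Definition good_pair (V : {set T}) (x y : T) : Prop :=
  [/\ r \in V, x \in V, y \in V, [/\ r != x, r != y & x != y] &
      [/\ dg e V r = 2, dg e V x = 2 & dg e V y = 2]].

Lemma good_adm V n E f x y : numbers e V n E f -> good_pair V x y -> adm n E (f r) (f x) (f y).
Proof.
move=> nu [rV xV yV [rx ry xy] [dr dx dy]]; have [fi _ _ _] := nu.
split; try by rewrite (numbers_ndeg2 nu) // ?dr ?dx ?dy.
by split; [apply: contra_neq rx|apply: contra_neq ry|apply: contra_neq xy]; apply: fi.
Qed.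

Lemma extend_at (f : T -> nat) w k : extend f w k w = k.
Proof. by rewrite /extend eqxx. Qed.

Lemma extend_out (f : T -> nat) w k v : v != w -> extend f w k v = f v.
Proof. by rewrite /extend => /negPf->. Qed.

Lemma stage_path V x y u v : stage V -> good_pair V x y -> ~~ e x y ->
  u \notin V -> v \notin V -> u != v -> e u v ->
  {in V, forall w, e u w = (w == x)} -> {in V, forall w, e v w = (w == y)} ->
  stage (v |: (u |: V)).
Proof.
move=> [n [E [f [nu bE sE ex]]]] gp nexy uV vV nuv euv Nu Nv.
have [rV xV yV [rx ry xy] _] := gp; have [fi fb fs fe] := nu.
have fxn := fb x xV; have fyn := fb y yV.
have nur : r != u by neq.
have nvr : r != v by neq.
pose E' := add_path3 n E (f x) (f y).
have [[[P1 P2] P3] P4] := path3_new bE fxn fyn.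
have n1 : numbers e (u |: V) n.+1 E' (extend f u n).
  apply: (numbers_extend esym eirr nu) => //.
    by move=> i j ni nj; rewrite /E' path3_old.
  move=> w wV; have fwn := fb w wV.
  rewrite /E' !(path3_fst bE fxn fyn fwn) esym Nu // (inj_in_eq fi) //.
have nvu : v \notin u |: V by rewrite in_setU1 negb_or eq_sym nuv.
have n2 : numbers e (v |: (u |: V)) n.+2 E' (extend (extend f u n) v n.+1).
  apply: (numbers_extend esym eirr n1) => //.
  move=> w; rewrite in_setU1 => /orP[/eqP->|wV].
    by rewrite extend_at /E' P1 P2 euv.
  have fwn := fb w wV; rewrite extend_out; last by neq.
  by rewrite /E' !(path3_snd bE fxn fyn fwn) esym Nv // (inj_in_eq fi).
exists n.+2, E', (extend (extend f u n) v n.+1); split=> //.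
- exact: path3_bounded.
- exact: path3_sym.
- rewrite !extend_out //; apply: excg_path => //; first exact: good_adm nu gp.
  by rewrite -fe.
Qed.

Lemma stage_twin V x y w : stage V -> good_pair V x y -> e x y ->
  w \notin V -> {in V, forall v, e w v = e x v} -> stage (w |: V).
Proof.
move=> [n [E [f [nu bE sE ex]]]] gp exy wV Nw.
have [rV xV yV [rx ry xy] _] := gp; have [fi fb fs fe] := nu.
have fxn := fb x xV.
have nwr : r != w by neq.
exists n.+1, (add_twin n E (f x)), (extend f w n); split.
- apply: (numbers_extend esym eirr nu) => //.
  + by move=> i j ni nj; rewrite twin_old.
  + move=> v vV; have fvn := fb v vV.
    by rewrite !(twin_new bE (f x) sE fvn) esym Nw // esym fe.
  + by rewrite (twin_new bE (f x) sE fxn).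
- exact: twin_bounded.
- exact: twin_sym.
- rewrite extend_out //; apply: (excg_twin ex (good_adm nu gp)); last by left.
  by rewrite -fe.
Qed.

Lemma stage_C4 V x y a b c d : stage V -> good_pair V x y -> e x y ->
  a \notin V -> b \notin V -> c \notin V -> d \notin V -> uniq [:: a; b; c; d] ->
  {in V, forall w, e a w = (w == x)} -> {in V, forall w, e b w = false} ->
  {in V, forall w, e c w = (w == y)} -> {in V, forall w, e d w = false} ->
  e a b -> e b c -> e c d -> e d a -> ~~ e a c -> ~~ e b d ->
  stage (d |: (c |: (b |: (a |: V)))).
Proof.
move=> [n [E [f [nu bE sE ex]]]] gp exy aV bV cV dV.
rewrite /= !inE !negb_or => /and4P[/and3P[nab nac nad] /andP[nbc nbd] ncd _].
move=> Na Nb Nc Nd eab ebc ecd eda neac nebd.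
have [rV xV yV [rx ry xy] _] := gp; have [fi fb fs fe] := nu.
have fxn := fb x xV; have fyn := fb y yV.
pose E' := add_C4 n E (f x) (f y).
have I i j : i < 4 -> j < 4 -> E' (n + i) (n + j) = odd (i + j) by apply: C4_in.
have En : n = n + 0 by rewrite addn0.
have En1 : n.+1 = n + 1 by rewrite addn1.
have En2 : n.+2 = n + 2 by rewrite addn2.
have En3 : n.+3 = n + 3 by rewrite addn3.
have I00 : ~~ E' n n by rewrite En I.
have I11 : ~~ E' n.+1 n.+1 by rewrite En1 I.
have I22 : ~~ E' n.+2 n.+2 by rewrite En2 I.
have I33 : ~~ E' n.+3 n.+3 by rewrite En3 I.
have I01 : (E' n n.+1 = true) * (E' n.+1 n = true) by rewrite En1 {1 4}En !I.
have I02 : (E' n n.+2 = false) * (E' n.+2 n = false) by rewrite En2 {1 4}En !I.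
have I03 : (E' n n.+3 = true) * (E' n.+3 n = true) by rewrite En3 {1 4}En !I.
have I12 : (E' n.+1 n.+2 = true) * (E' n.+2 n.+1 = true) by rewrite En2 En1 !I.
have I13 : (E' n.+1 n.+3 = false) * (E' n.+3 n.+1 = false) by rewrite En3 En1 !I.
have I23 : (E' n.+2 n.+3 = true) * (E' n.+3 n.+2 = true) by rewrite En3 En2 !I.
pose f1 := extend f a n; pose f2 := extend f1 b n.+1.
pose f3 := extend f2 c n.+2; pose f4 := extend f3 d n.+3.
have n1 : numbers e (a |: V) n.+1 E' f1.
  apply: (numbers_extend esym eirr nu) => //.
    by move=> i j ni nj; rewrite /E' C4_old.
  by move=> w wV; rewrite /E' !(C4_out bE fxn fyn (fb w wV)) esym Na // (inj_in_eq fi).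
have nb : b \notin a |: V by rewrite in_setU1 negb_or eq_sym nab.
have n2 : numbers e (b |: (a |: V)) n.+2 E' f2.
  apply: (numbers_extend esym eirr n1) => //.
  move=> w; rewrite in_setU1 => /orP[/eqP->|wV]; first by rewrite /f1 extend_at !I01 eab.
  rewrite /f1 extend_out; last by neq.
  by rewrite /E' !(C4_out bE fxn fyn (fb w wV)) esym Nb.
have nc : c \notin b |: (a |: V) by allneq.
have n3 : numbers e (c |: (b |: (a |: V))) n.+3 E' f3.
  apply: (numbers_extend esym eirr n2) => //.
  move=> w; rewrite !in_setU1 => /or3P[/eqP->|/eqP->|wV].
  - by rewrite /f2 extend_at !I12 ebc.
  - by rewrite /f2 extend_out // /f1 extend_at !I02 (negPf neac).
  - rewrite /f2 extend_out; last by neq.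
    rewrite /f1 extend_out; last by neq.
    by rewrite /E' !(C4_out bE fxn fyn (fb w wV)) esym Nc // (inj_in_eq fi).
have nd : d \notin c |: (b |: (a |: V)) by allneq.
exists n.+4, E', f4; split.
- apply: (numbers_extend esym eirr n3) => //.
  move=> w; rewrite !in_setU1 => /or4P[/eqP->|/eqP->|/eqP->|wV].
  - by rewrite /f3 extend_at !I23 ecd.
  - by rewrite /f3 extend_out // /f2 extend_at !I13 (negPf nebd).
  - by rewrite /f3 extend_out // /f2 extend_out // /f1 extend_at !I03 esym eda.
  - rewrite /f3 extend_out; last by neq.
    rewrite /f2 extend_out; last by neq.
    rewrite /f1 extend_out; last by neq.
    by rewrite /E' !(C4_out bE fxn fyn (fb w wV)) esym Nd.
- exact: C4_bounded.
- exact: C4_sym.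
- rewrite /f4 extend_out; last by neq.
  rewrite /f3 extend_out; last by neq.
  rewrite /f2 extend_out; last by neq.
  rewrite /f1 extend_out; last by neq.
  apply: (excg_C4 ex (good_adm nu gp)); by rewrite -fe.
Qed.

Lemma K23_bounded : bounded 5 K23.
Proof. by move=> i j; rewrite /K23; lia. Qed.

Lemma K23_sym : symmetric K23.
Proof. by move=> i j; rewrite /K23 orbC. Qed.

Lemma stage_K23 p q x y : p != q -> r != p -> r != q -> e r p -> e r q -> ~~ e p q ->
  x \notin [set p; q; r] -> y \notin [set p; q; r] -> x != y -> ~~ e x y ->
  {in [set p; q; r], forall v, e x v = (v == p) || (v == q)} ->
  {in [set p; q; r], forall v, e y v = (v == p) || (v == q)} ->
  stage (y |: (x |: (r |: (q |: (p |: set0))))).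
Proof.
move=> npq nrp nrq erp erq nepq; rewrite !inE !negb_or.
move=> /andP[/andP[xp xq] xr] /andP[/andP[yp yq] yr] nxy nexy Nx Ny.
have npr : p != r by rewrite eq_sym.
have nqr : q != r by rewrite eq_sym.
have npx : p != x by rewrite eq_sym.
have nqx : q != x by rewrite eq_sym.
have nrx : r != x by rewrite eq_sym.
have nry : r != y by rewrite eq_sym.
have epr : e p r by rewrite esym.
have eqr : e q r by rewrite esym.
have exp : e x p by rewrite Nx ?inE ?eqxx.
have exq : e x q by rewrite Nx ?inE ?eqxx ?orbT.
have exr : e x r = false by rewrite Nx ?inE ?eqxx ?orbT // (negPf nrp) (negPf nrq).
have eyp : e y p by rewrite Ny ?inE ?eqxx.
have eyq : e y q by rewrite Ny ?inE ?eqxx ?orbT.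
have eyr : e y r = false by rewrite Ny ?inE ?eqxx ?orbT // (negPf nrp) (negPf nrq).
(* The vertices are numbered one at a time from the empty set, [p] and [q] getting 0 and 1 because
   these are the vertices of degree 3 in [K23]. *)
pose f0 : T -> nat := fun=> 0.
have n0 : numbers e set0 0 K23 f0 by split=> // v; rewrite inE.
have n1 : numbers e (p |: set0) 1 K23 (extend f0 p 0).
  by apply: (numbers_extend esym eirr n0); rewrite ?inE // => v; rewrite inE.
have n2 : numbers e (q |: (p |: set0)) 2 K23 (extend (extend f0 p 0) q 1).
  apply: (numbers_extend esym eirr n1) => //; first by allneq.
  move=> v; rewrite !inE orbF => /eqP->; rewrite extend_at (negPf nepq); by split.
pose f2 := extend (extend f0 p 0) q 1; rewrite -/f2 in n2.
have f2q : f2 q = 1 by rewrite /f2 extend_at.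
have f2p : f2 p = 0 by rewrite /f2 extend_out // extend_at.
have n3 : numbers e (r |: (q |: (p |: set0))) 3 K23 (extend f2 r 2).
  apply: (numbers_extend esym eirr n2) => //; first by allneq.
  by move=> v; rewrite !inE orbF => /orP[]/eqP->; rewrite ?f2p ?f2q ?epr ?eqr; split.
pose f3 := extend f2 r 2; rewrite -/f3 in n3.
have f3r : f3 r = 2 by rewrite /f3 extend_at.
have f3q : f3 q = 1 by rewrite /f3 extend_out.
have f3p : f3 p = 0 by rewrite /f3 extend_out.
have n4 : numbers e (x |: (r |: (q |: (p |: set0)))) 4 K23 (extend f3 x 3).
  apply: (numbers_extend esym eirr n3) => //; first by allneq.
  by move=> v; rewrite !inE orbF => /or3P[]/eqP->; rewrite ?f3p ?f3q ?f3r esym ?exp ?exq ?exr; split.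
pose f4 := extend f3 x 3; rewrite -/f4 in n4.
have f4x : f4 x = 3 by rewrite /f4 extend_at.
have f4r : f4 r = 2 by rewrite /f4 extend_out.
have f4q : f4 q = 1 by rewrite /f4 extend_out.
have f4p : f4 p = 0 by rewrite /f4 extend_out.
exists 5, K23, (extend f4 y 4); split.
- apply: (numbers_extend esym eirr n4) => //; first by allneq.
  by move=> v; rewrite !inE orbF => /or4P[]/eqP->;
    rewrite ?f4p ?f4q ?f4r ?f4x ?(negPf nexy) // esym ?eyp ?eyq ?eyr; split.
- exact: K23_bounded.
- exact: K23_sym.
- by rewrite extend_out // f4r; apply: excg_base.
Qed.

Lemma core_good_pair S p q : core e r false S p q -> good_pair S p q.
Proof.
move=> h; have [[pS qS rS] [npq nrp nrq]] := core_in h.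
have D v vS := core_dg esym eirr h (vS : v \in S).
split=> //; split; apply/eqP.
- by have := D r rS; rewrite eqxx.
- by have := D p pS; rewrite eq_sym (negPf nrp) eqxx.
- by have := D q qS; rewrite eq_sym (negPf nrq) eqxx orbT.
Qed.

(** A started stage becomes a graph of the sequence only with its twins, and these interleave
    differently with the steps of the definition. After a pendant, one twin and the pendant form the
    path of length 3, and the other twin copies the first. After [core_C4], the path consists of the
    inner vertices [x], [y], and the twins complete [a], [c] to the 4-cycle. *)
Lemma core_stage b S p q : core e r b S p q ->
  if b then forall x y, x \notin S -> y \notin S -> x != y -> ~~ e x y ->
    {in S, forall v, e x v = (v == p) || (v == q)} ->
    {in S, forall v, e y v = (v == p) || (v == q)} -> stage (x |: (y |: S))
  else stage S.
Proof.
elim=> {b S p q}.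
- move=> p q n1 n2 n3 e1 e2 e3 x y xS yS nxy exy Nx Ny.
  have -> : x |: (y |: [set p; q; r]) = y |: (x |: (r |: (q |: (p |: set0)))).
    apply/setP=> v; rewrite !inE orbF.
    by case: (v == x) (v == y) (v == p) (v == q) (v == r) => [] [] [] [] [].
  exact: (stage_K23 n1 n2 n3 e1 e2 e3).
- by move=> S p q x y h IH xS yS nxy exy Nx Ny; apply: IH.
- move=> S p q y h IH yS Ny x1 y1 x1S y1S nx1 ex1 Nx1 Ny1.
  have gp := core_good_pair h; have [rS pS qS [nrp nrq npq] [dr dp dq]] := gp.
  have nepq : ~~ e p q by have [S0 [s [t [_ _ _ _ [_ ? _ _]]]]] := core_false_inv h.
  move: x1S y1S; rewrite !in_setU1 !negb_or => /andP[nx1y x1S] /andP[ny1y y1S].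
  have sub v : v \in S -> v \in y |: S by move=> vS; rewrite in_setU1 vS orbT.
  have yV : y \in y |: S by rewrite setU11.
  have ex1y : e x1 y by rewrite Nx1 // eqxx orbT.
  have ey1y : e y1 y by rewrite Ny1 // eqxx orbT.
  have Nx1' : {in S, forall v, e x1 v = (v == p)}.
    move=> v vS; rewrite Nx1 ?sub //.
    by have -> : v == y = false by [apply/negbTE; neq]; rewrite orbF.
  have st := stage_path IH gp nepq x1S yS nx1y ex1y Nx1' Ny.
  have -> : x1 |: (y1 |: (y |: S)) = y1 |: (y |: (x1 |: S)).
    by apply/setP=> v; rewrite !inE; case: (v == x1) (v == y1) (v == y) => [] [] [].
  have nrx1 : r != x1 by neq.
  have nry : r != y by neq.
  apply: (@stage_twin _ x1 y) => //.
  + split; [by allneq|by allneq|by allneq|by split|].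
    rewrite !dgU1; try by allneq.
    split.
    * by rewrite dr !(esym r) Ny // Nx1' // (negPf nrp) (negPf nrq).
    * by rewrite ex1y eirr (dg_mem1 pS Nx1').
    * by rewrite eirr esym ex1y (dg_mem1 qS Ny).
  + by allneq.
  + move=> v; rewrite !in_setU1 => /or3P[/eqP->|/eqP->|vS].
    * by rewrite ey1y ex1y.
    * by rewrite esym (negPf ex1) eirr.
    * by rewrite Nx1 ?Ny1 ?sub.
- move=> S p q x h IH xS Nx x1 y1 x1S y1S nx1 ex1 Nx1 Ny1.
  have gp := core_good_pair h; have [rS pS qS [nrp nrq npq] [dr dp dq]] := gp.
  have nepq : ~~ e p q by have [S0 [s [t [_ _ _ _ [_ ? _ _]]]]] := core_false_inv h.
  move: x1S y1S; rewrite !in_setU1 !negb_or => /andP[nx1x x1S] /andP[ny1x y1S].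
  have sub v : v \in S -> v \in x |: S by move=> vS; rewrite in_setU1 vS orbT.
  have xV : x \in x |: S by rewrite setU11.
  have ex1x : e x1 x by rewrite Nx1 // eqxx.
  have exx1 : e x x1 by rewrite esym.
  have ey1x : e y1 x by rewrite Ny1 // eqxx.
  have nxx1 : x != x1 by rewrite eq_sym.
  have Nx1' : {in S, forall v, e x1 v = (v == q)}.
    move=> v vS; rewrite Nx1 ?sub //.
    by have -> : v == x = false by [apply/negbTE; neq].
  have st := stage_path IH gp nepq xS x1S nxx1 exx1 Nx Nx1'.
  have -> : x1 |: (y1 |: (x |: S)) = y1 |: (x1 |: (x |: S)).
    by rewrite setUCA.
  have nrx1 : r != x1 by neq.
  have nrx : r != x by neq.
  apply: (@stage_twin _ x1 x) => //.
  + split; [by allneq|by allneq|by allneq|by split|].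
    rewrite !dgU1; try by allneq.
    split.
    * by rewrite dr !(esym r) Nx // Nx1' // (negPf nrp) (negPf nrq).
    * by rewrite ex1x eirr (dg_mem1 qS Nx1').
    * by rewrite eirr exx1 (dg_mem1 pS Nx).
  + by allneq.
  + move=> v; rewrite !in_setU1 => /or3P[/eqP->|/eqP->|vS].
    * by rewrite esym (negPf ex1) eirr.
    * by rewrite ey1x ex1x.
    * by rewrite Nx1 ?Ny1 ?sub.
- move=> S p q x y a c h IH xS yS aS cS.
  rewrite /= !inE !negb_or => /and4P[/and3P[nxy nxa nxc] /andP[nya nyc] nac _].
  move=> Nx Ny Na Nc exy eax ecy neay necx neac b d bV dV nbd nebd Nb Nd.
  have gp := core_good_pair h; have [rS pS qS [nrp nrq npq] [dr dp dq]] := gp.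
  have nepq : ~~ e p q by have [S0 [s [t [_ _ _ _ [_ ? _ _]]]]] := core_false_inv h.
  move: bV dV; rewrite !in_setU1 !negb_or => /and5P[nbx nby nba nbc bS] /and5P[ndx ndy nda ndc dS].
  have st := stage_path IH gp nepq xS yS nxy exy Nx Ny.
  have nrx : r != x by neq.
  have nry : r != y by neq.
  have sub v : v \in S -> v \in x |: (y |: (a |: (c |: S))).
    by move=> vS; rewrite !in_setU1 vS !orbT.
  have VN u v : u \in S \/ u = x \/ u = y ->
      e v u = (u == a) || (u == c) -> e v u = false.
    move=> uS ->; apply/norP; case: uS => [uS|[->|->]] //; split; neq.
  have inV u : u \in S \/ u = x \/ u = y -> u \in x |: (y |: (a |: (c |: S))).
    by rewrite !in_setU1; case=> [->|[->|->]]; rewrite ?eqxx ?orbT.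
  have eba : e b a by rewrite Nb ?eqxx // !in_setU1 eqxx !orbT.
  have ebc : e b c by rewrite Nb ?eqxx ?orbT // !in_setU1 eqxx !orbT.
  have eda : e d a by rewrite Nd ?eqxx // !in_setU1 eqxx !orbT.
  have edc : e d c by rewrite Nd ?eqxx ?orbT // !in_setU1 eqxx !orbT.
  have -> : b |: (d |: (x |: (y |: (a |: (c |: S))))) = d |: (c |: (b |: (a |: (y |: (x |: S))))).
    apply/setP=> v; rewrite !inE.
    by case: (v == a) (v == b) (v == c) (v == d) (v == x) (v == y) => [] [] [] [] [] [].
  apply: (@stage_C4 _ x y) => //.
  + split; [by allneq|by allneq|by allneq|by split|].
    rewrite !dgU1; try by allneq.
    split.
    * by rewrite dr !(esym r) Nx // Ny // (negPf nrp) (negPf nrq).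
    * by rewrite exy eirr (dg_mem1 pS Nx).
    * by rewrite eirr esym exy (dg_mem1 qS Ny).
  + by allneq.
  + by allneq.
  + by allneq.
  + by allneq.
  + by allneq.
  + move=> v; rewrite !in_setU1 => /or3P[/eqP->|/eqP->|vS].
    * by rewrite (negPf neay) [y == x]eq_sym (negPf nxy).
    * by rewrite eax eqxx.
    * by rewrite Na //; symmetry; apply/negbTE; neq.
  + by move=> v; rewrite !in_setU1 => vV; apply: VN; [|apply: Nb; apply: inV];
      case/or3P: vV => [/eqP->|/eqP->|vS]; auto.
  + move=> v; rewrite !in_setU1 => /or3P[/eqP->|/eqP->|vS].
    * by rewrite ecy eqxx.
    * by rewrite (negPf necx) (negPf nxy).
    * by rewrite Nc //; symmetry; apply/negbTE; neq.
  + by move=> v; rewrite !in_setU1 => vV; apply: VN; [|apply: Nd; apply: inV];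
      case/or3P: vV => [/eqP->|/eqP->|vS]; auto.
  + by rewrite esym.
  + by rewrite esym.
Qed.
End Stage.

Lemma stage_exceptional (T : finType) (e : rel T) r x y :
  stage e r setT -> good_pair e r setT x y -> exceptional_root e r.
Proof.
move=> [n [E [f [nu bE sE ex]]]] gp; have [fi fb fs fe] := nu.
exists n, E, f; split=> //; last by exists (f x), (f y); apply: good_adm nu gp.
split.
- by move=> u v; apply: fi; rewrite inE.
- by move=> u; apply: fb; rewrite inE.
- by move=> k /fs[v _ <-]; exists v.
- by move=> u v; apply: fe; rewrite inE.
Qed.

Lemma exc_exceptional (T : finType) (e : rel T) r x y :
  symmetric e -> irreflexive e -> (forall v, 2 <= deg e v) -> exc e r x y ->
  exceptional e.
Proof.
move=> esym eirr d2 ex; exists r; have [U D _] := exc_deg esym eirr ex.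
have full (V : {set T}) : spans e V -> V = setT.
  move=> sp; apply/setP => v; rewrite inE.
  have : 0 < deg e v by apply: leq_trans (d2 v).
  by rewrite /deg card_gt0 => /set0Pn[u]; rewrite inE; apply: sp.
have gp : good_pair e r setT x y.
  move: U; rewrite /= !inE !negb_or => /and3P[/andP[? ?] ? _].
  split; rewrite ?inE //; split; rewrite -deg_dg; apply/eqP; rewrite D !inE eqxx ?orbT //.
apply: stage_exceptional gp.
case: ex => [/exc_twin_core[S h sp]|[S [s [t [h xS yS nxy [Nx Ny sp]]]]]].
  by rewrite -(full _ sp); apply: (core_stage esym eirr h).
rewrite -(full _ sp) setUCA.
have [[sS tS _] _] := core_in h.
have nest : ~~ e s t by have [S0 [s0 [t0 [_ _ _ _ [_ ? _ _]]]]] := core_false_inv h.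
apply: (stage_path esym eirr (core_stage esym eirr h) (core_good_pair esym eirr h)) => //.
- by rewrite Nx eqxx.
- by move=> v vS; rewrite Nx; have -> : v == y = false by apply/negbTE; neq.
- by move=> v vS; rewrite Ny; have -> : v == x = false by apply/negbTE; neq.
Qed.

(** * Cores contain no cycle of length 0 modulo 3 *)

Section CoreNozero.
Variables (T : finType) (e : rel T).
Hypotheses (esym : symmetric e) (eirr : irreflexive e).
Implicit Types (S : {set T}) (r p q u v w a : T).

Definition nozero_in S : Prop :=
  forall s, is_cycle e s -> {subset s <= S} -> ~~ (3 %| size s).

Lemma linked_self S u k : linked e S u u k -> k = 0 %[mod 3].
Proof.
case=> [[|v s] [_ /= l us _ <-]] //; move: us; rewrite /= => /andP[].
by rewrite -{1}l mem_last.
Qed.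

Lemma linked_new S w v k : w \notin S -> v \in S -> linked e (w |: S) w v k ->
  exists a j, [/\ e w a, a \in S, linked e S a v j & k = j.+1 %[mod 3]].
Proof.
move=> wS vS [[|a s] [h1 /= h2 h3 h4 h5]]; first by rewrite h2 vS in wS.
case/andP: h1 => wa pa; case/andP: h3 => wn ua.
have sub : {subset a :: s <= S}.
  move=> x xs; have : x \in w |: S by apply: h4; rewrite inE xs orbT.
  by rewrite in_setU1 => /orP[/eqP E|//]; rewrite -E xs in wn.
exists a, (size s); split=> //; first by apply: sub; rewrite mem_head.
by exists s.
Qed.

(* A path of [w |: S] between vertices of [S] that visits [w] enters and leaves it
   through distinct neighbours. *)
Lemma linked_old S w u v k : w \notin S -> u \in S -> v \in S -> u != v ->
  linked e (w |: S) u v k -> linked e S u v k \/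
  exists a b i j, [/\ e a w, e w b, linked e (S :\ v) u a i, linked e (S :\ u) b v j
                    & k = (i + j).+2 %[mod 3]].
Proof.
move=> wS uS vS nuv [s [h1 h2 h3 h4 h5]].
case: (boolP (w \in s)) => [ws|ws]; last first.
  left; exists s; split=> // x xs; have := h4 x xs; rewrite in_setU1 => /orP[/eqP E|//].
  move: xs; rewrite E inE => /orP[/eqP E'|E']; first by rewrite E' uS in wS.
  by rewrite E' in ws.
right; case/splitPr: ws h1 h2 h3 h4 h5 => s1 s2.
rewrite cat_path last_cat => /andP[p1 /= /andP[aw p2]] l2 u3 h4.
case: s2 p2 l2 u3 h4 => [|b s2] /=; first by move=> _ E; rewrite -E (negPf wS) in vS.
case/andP=> wb p2 l2 /andP[un]; rewrite cat_uniq => /and3P[us1 hs].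
rewrite cons_uniq => /andP[wn us2] h4; rewrite size_cat /= => h5.
have vs2 : v \in b :: s2 by rewrite -l2 mem_last.
move: un; rewrite mem_cat !inE !negb_or => /and4P[us1' uw ub us2'].
have s1S x : x \in s1 -> (x \in S) && (x != v).
  move=> xs; have nxw : x != w.
    by apply: contraNneq hs => E; apply/hasP; exists w; rewrite ?mem_head // -E.
  have xv : x != v.
    apply: contraNneq hs => E; apply/hasP; exists v; last by rewrite -E.
    by rewrite in_cons vs2 orbT.
  rewrite xv andbT; have := h4 x; rewrite in_setU1 (negPf nxw) /=; apply.
  by rewrite inE mem_cat xs !orbT.
have s2S x : x \in b :: s2 -> (x \in S) && (x != u).
  move=> xs; have nxw : x != w by apply: contraNneq wn => <-.
  have xu : x != u.
    by apply: contraTneq xs => ->; rewrite inE negb_or ub.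
  rewrite xu andbT; have := h4 x; rewrite in_setU1 (negPf nxw) /=; apply.
  by rewrite inE mem_cat in_cons xs !orbT.
exists (last u s1), b, (size s1), (size s2); split=> //.
- exists s1; split=> //; first by rewrite /= us1' us1.
  move=> x; rewrite inE in_setD1 => /orP[/eqP->|/s1S/andP[-> ->//]].
  by rewrite uS nuv.
- by exists s2; split=> // x /s2S/andP[xS xu]; rewrite in_setD1 xu xS.
- by rewrite -h5 addnS addnS.
Qed.

Lemma nozero_add S w : w \notin S -> nozero_in S ->
  (forall a b k, a \in S -> b \in S -> e w a -> e w b -> a != b -> linked e S a b k ->
     k.+2 %% 3 <> 0) -> nozero_in (w |: S).
Proof.
move=> wS nz H s cs sS; case ws: (w \in s); last first.
  apply: nz => // x xs; have := sS x xs; rewrite in_setU1 => /orP[/eqP E|//].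
  by rewrite -E xs in ws.
have [s3 us cy] := cs; have [i s' Er] := rot_to ws.
rewrite -(size_rot i) Er.
have s3' : 3 <= size (w :: s') by rewrite -Er size_rot.
have us' : uniq (w :: s') by rewrite -Er rot_uniq.
have : cycle e (w :: s') by rewrite -Er rot_cycle.
case: s' Er s3' us' => [//|a t] Er s3' /andP[ws' /andP[at' ut]].
rewrite [cycle _ _]/= rcons_path => /and3P[wa pt lw].
have lt : last a t \in t by case: (t) s3' => // b t' _; apply: (mem_last b t').
have sub : {subset a :: t <= S}.
  move=> x xs; have : x \in w |: S.
    by apply: sS; rewrite -(mem_rot i) Er inE xs orbT.
  by rewrite in_setU1 => /orP[/eqP E|//]; rewrite -E xs in ws'.
have L : linked e S a (last a t) (size t).
  by exists t; split=> //; apply/andP.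
have nal : a != last a t by apply: contraNneq at' => ->.
apply/negP => d3; apply: (H _ _ _ _ _ wa _ nal L).
- by apply: sub; rewrite mem_head.
- by apply: sub; rewrite inE lt orbT.
- by rewrite esym.
- by move: d3 => /=; rewrite /dvdn => /eqP.
Qed.

Lemma nozero_pendant S w q : w \notin S -> nozero_in S ->
  {in S, forall v, e w v = (v == q)} -> nozero_in (w |: S).
Proof.
move=> wS nz N; apply: nozero_add => // a b k aS bS; rewrite !N // => /eqP-> /eqP->.
by rewrite eqxx.
Qed.

Lemma nozero_add2 S w p q : w \notin S -> p \in S -> q \in S -> nozero_in S ->
  {in S, forall v, e w v = (v == p) || (v == q)} ->
  (forall k, linked e S p q k -> k.+2 %% 3 <> 0) -> nozero_in (w |: S).
Proof.
move=> wS pS qS nz N H; apply: nozero_add => // a b k aS bS.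
rewrite !N // => /orP[]/eqP-> /orP[]/eqP->; rewrite ?eqxx // => _ L; first exact: H.
by apply: H; apply: linked_sym.
Qed.

(** Absence of zero cycles is not inductive by itself. A twin closes a terminal path of length [k]
    to a cycle of length [k + 2], so residue 1 must be excluded for [b] true. A pendant adds 1 to
    [k], and the path step closes a cycle of length [k + 3], so residue 0 must be excluded for [b]
    false. *)
Lemma core_nozero r b S p q : core e r b S p q -> nozero_in S /\
  forall k, linked e S p q k -> if b then k %% 3 <> 1 else k %% 3 <> 0.
Proof.
elim=> {b S p q}.
- move=> p q npq nrp nrq erp erq nepq.
  have nz : nozero_in [set p; q; r].
    have -> : [set p; q; r] = q |: (r |: [set p]).
      by apply/setP=> v; rewrite !inE; case: (v == p) (v == q) (v == r) => [] [] [].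
    have nz1 : nozero_in [set p].
      move=> s [s3 us _] sub; suff : size s <= 1 by move: s3; clear; lia.
      by apply: (uniq_leq_size us (s2 := [:: p])) => x /sub; rewrite !inE.
    have nz2 : nozero_in (r |: [set p]).
      apply: (nozero_pendant (q := p)) => //; first by rewrite inE.
      by move=> v; rewrite inE => /eqP->; rewrite eqxx.
    apply: (nozero_pendant (q := r)) => //; first by allneq.
    move=> v; rewrite !inE => /orP[]/eqP->; first by rewrite esym erq eqxx.
    by rewrite esym (negPf nepq) eq_sym (negPf nrp).
  split=> // k.
  have -> : [set p; q; r] = q |: (r |: [set p]).
    by apply/setP=> v; rewrite !inE; case: (v == p) (v == q) (v == r) => [] [] [].
  move/(linked_sym esym)/linked_new => [||a [j [qa aS L Ek]]]; [by allneq|by mem|].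
  have Ea : a = r.
    move: aS qa; rewrite !inE => /orP[]/eqP-> //; by rewrite esym (negPf nepq).
  subst a; case/linked_new: L => [||a [i [_ aS' L E2]]]; [by allneq|by mem|].
  move: aS' L; rewrite inE => /eqP-> /linked_self.
  by move: Ek E2; clear; lia.
- move=> S p q x y h [nz P] xS yS nxy exy Nx Ny.
  have [[pS qS rS] [npq _ _]] := core_in h.
  have nz1 : nozero_in (x |: S).
    by apply: (nozero_add2 xS pS qS nz Nx) => k /P; clear; lia.
  have yS1 : y \notin x |: S by allneq.
  have Ny1 : {in x |: S, forall v, e y v = (v == p) || (v == q)}.
    move=> v; rewrite in_setU1 => /orP[/eqP->|]; last exact: Ny.
    by rewrite esym (negPf exy); symmetry; apply/norP; split; neq.
  rewrite setUCA; split.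
    apply: (nozero_add2 yS1 _ _ nz1 Ny1) => [||k]; [by mem|by mem|].
    (* A path from [p] to [q] that uses the first twin [x] enters and leaves it by [p] and [q]
       themselves, so it has length 2. *)
    case/linked_old=> // [/P|[a [b [i [j [ax xb L1 L2 Ek]]]]]]; first by clear; lia.
    have /andP[_ aS] := linked_in L1; have /andP[bS _] := linked_in L2.
    move: aS bS; rewrite !in_setD1 => /andP[aq aS] /andP[bp bS].
    have Ea : a = p by move: ax; rewrite esym Nx // (negPf aq) orbF => /eqP.
    have Eb : b = q by move: xb; rewrite Nx // (negPf bp) => /eqP.
    subst a b; move: (linked_self L1) (linked_self L2) Ek; clear; lia.
  move=> k L; have xS1 : x \in x |: S by rewrite setU11.
  have [a [j [ya aS' L1 Ek]]] := linked_new yS1 xS1 (linked_sym esym L).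
  have naS : a != x by apply: contraTneq ya => ->; rewrite esym.
  have aS : a \in S by move: aS'; rewrite in_setU1 (negPf naS).
  have [b [i [xb bS L2 E2]]] := linked_new xS aS (linked_sym esym L1).
  move: ya xb; rewrite Ny // Nx //.
  have Pab : forall i0, linked e S a b i0 -> (a, b) = (p, q) \/ (a, b) = (q, p) -> i0 %% 3 <> 1.
    move=> i0 L0 [[Ea Eb]|[Ea Eb]]; subst a b; first exact: P.
    by apply: P; apply: linked_sym.
  case/orP=> /eqP Ea /orP[]/eqP Eb.
  + by subst a b; move: (linked_self L2) Ek E2; clear; lia.
  + have := Pab i (linked_sym esym L2); rewrite Ea Eb => /(_ (or_introl erefl)).
    by move: Ek E2; clear; lia.
  + have := Pab i (linked_sym esym L2); rewrite Ea Eb => /(_ (or_intror erefl)).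
    by move: Ek E2; clear; lia.
  + by subst a b; move: (linked_self L2) Ek E2; clear; lia.
- move=> S p q y h [nz P] yS Ny.
  have [[pS qS rS] [npq _ _]] := core_in h.
  split; first exact: nozero_pendant nz Ny.
  move=> k /(linked_sym esym)/linked_new => /(_ yS pS)[a [j [ya aS L E]]].
  move: ya L; rewrite Ny // => /eqP-> /(linked_sym esym)/P.
  by move: E; clear; lia.
- move=> S p q y h [nz P] yS Ny.
  have [[pS qS rS] [npq _ _]] := core_in h.
  split; first exact: nozero_pendant nz Ny.
  move=> k /linked_new => /(_ yS qS)[a [j [ya aS L E]]].
  move: ya L; rewrite Ny // => /eqP-> /P.
  by move: E; clear; lia.
- move=> S p q x y a c h [nz P] xS yS aS cS.
  rewrite /= !inE !negb_or => /and4P[/and3P[nxy nxa nxc] /andP[nya nyc] nac _].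
  move=> Nx Ny Na Nc exy eax ecy neay necx neac.
  have [[pS qS rS] [npq _ _]] := core_in h.
  (* In this order [x], [a] and [c] are pendants when they are added, and only [y] closes cycles. *)
  pose S1 := x |: S; pose S2 := y |: S1; pose S3 := a |: S2.
  have -> : x |: (y |: (a |: (c |: S))) = c |: S3.
    apply/setP=> v; rewrite !inE.
    by case: (v == x) (v == y) (v == a) (v == c) => [] [] [] [].
  have yS1 : y \notin S1 by rewrite /S1; allneq.
  have aS2 : a \notin S2 by rewrite /S2 /S1; allneq.
  have cS3 : c \notin S3 by rewrite /S3 /S2 /S1; allneq.
  have qS1 : q \in S1 by rewrite in_setU1 qS orbT.
  have xS1 : x \in S1 by rewrite setU11.
  have yS2 : y \in S2 by rewrite setU11.
  have Ny1 : {in S1, forall v, e y v = (v == q) || (v == x)}.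
    move=> v; rewrite in_setU1 => /orP[/eqP->|vS]; first by rewrite esym exy eqxx orbT.
    by rewrite Ny //; have -> : v == x = false by [apply/negbTE; neq]; rewrite orbF.
  have Na2 : {in S2, forall v, e a v = (v == x)}.
    move=> v; rewrite !in_setU1 => /or3P[/eqP->|/eqP->|vS].
    - by rewrite (negPf neay) eq_sym (negPf nxy).
    - by rewrite eax eqxx.
    - by rewrite Na //; symmetry; apply/negbTE; neq.
  have Nc3 : {in S3, forall v, e c v = (v == y)}.
    move=> v; rewrite !in_setU1 => /or4P[/eqP->|/eqP->|/eqP->|vS].
    - by rewrite esym (negPf neac) eq_sym (negPf nya).
    - by rewrite ecy eqxx.
    - by rewrite (negPf necx) (negPf nxy).
    - by rewrite Nc //; symmetry; apply/negbTE; neq.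
  have Lqx k : linked e S1 q x k -> exists j, k = j.+1 %[mod 3] /\ j %% 3 <> 0.
    case/(linked_sym esym)/linked_new => // b [j [xb bS L E]].
    by move: xb L; rewrite Nx // => /eqP-> /P Hj; exists j.
  have nz1 : nozero_in S1 by exact: nozero_pendant nz Nx.
  have nz2 : nozero_in S2.
    apply: (nozero_add2 yS1 qS1 xS1 nz1 Ny1) => k /Lqx[j [E Hj]].
    by move: E Hj; clear; lia.
  have nz3 : nozero_in S3 by exact: nozero_pendant nz2 Na2.
  split; first exact: nozero_pendant nz3 Nc3.
  have aS3 : a \in S3 by rewrite setU11.
  move=> k /(linked_sym esym)/(linked_new cS3 aS3)[b [j [cb bS L E]]].
  move: cb L; rewrite Nc3 // => /eqP-> /(linked_sym esym)/(linked_new aS2 yS2)[d [i [ad dS L E2]]].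
  move: ad L; rewrite Na2 // => /eqP-> /(linked_sym esym)/(linked_new yS1 xS1)[f [l [yf fS L E3]]].
  move: yf L; rewrite Ny1 // => /orP[]/eqP->.
    by move/Lqx=> [m [E4 Hm]]; move: E E2 E3 E4 Hm; clear; lia.
  by move/linked_self; move: E E2 E3; clear; lia.
Qed.

Lemma exc_nozero r p q : exc e r p q -> nozero e.
Proof.
have fin (V : {set T}) : spans e V -> nozero_in V -> nozero e.
  move=> sp nz s cs; apply: nz => // x xs; have [_ _ cy] := cs.
  by apply: (sp x (next s x)); apply: next_cycle.
case=> [/exc_twin_core[S h sp]|[S [s [t [h xS yS nxy [Nx Ny sp]]]]]].
  by apply: fin sp _; have [] := core_nozero h.
have [[sS tS rS] [nst _ _]] := core_in h; have [nz P] := core_nozero h.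
have pV : p \notin q |: S by rewrite in_setU1 negb_or nxy.
have NyS : {in S, forall v, e q v = (v == t)}.
  by move=> v vS; rewrite Ny; have -> : v == p = false by apply/negbTE; neq.
have NxS : {in q |: S, forall v, e p v = (v == q) || (v == s)} by move=> v _; rewrite Nx.
apply: fin sp _; apply: (nozero_add2 pV _ _ _ NxS) => [|||k L].
- by rewrite setU11.
- by rewrite in_setU1 sS orbT.
- exact: nozero_pendant nz NyS.
- have [a [j [qa aS L' E]]] := linked_new yS sS L.
  move: qa L'; rewrite NyS // => /eqP-> /(linked_sym esym)/P.
  by move: E; clear; lia.
Qed.
End CoreNozero.

(** * The graphs of the sequence, read on ordinals *)

Definition on_ord (N : nat) (E : rel nat) : rel 'I_N := fun u v => E u v.
Arguments on_ord : clear implicits.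

Section OnOrd.
Variables (N n : nat) (E : rel nat).
Hypotheses (bE : bounded n E) (sE : symmetric E) (iE : irreflexive E) (nN : n <= N).
Let e := on_ord N E.

Lemma on_ord_sym : symmetric e. Proof. by move=> u v; apply: sE. Qed.

Lemma on_ord_irr : irreflexive e. Proof. by move=> u; apply: iE. Qed.

Lemma on_ord_deg (v : 'I_N) : deg e v = ndeg n E v.
Proof.
have -> : deg e v = \sum_(0 <= i < N) E v i.
  by rewrite deg_dg /dg big_mkord; apply: eq_bigl => u; rewrite inE.
rewrite (big_cat_nat (n := n)) //=.
have -> : \sum_(n <= i < N) E v i = 0.
  rewrite big_nat_cond big1 // => i; rewrite andbT => /andP[ni _].
  by rewrite (bounded_out bE) // ni orbT.
have Ei : iota 0 n = index_iota 0 n by rewrite /index_iota subn0.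
rewrite addn0 /ndeg -sum1_count Ei [RHS]big_mkcond.
by apply: eq_bigr => i _; case: (E v i).
Qed.

(** The root and an admissible pair exhaust the three vertices of degree 2, so the choice of the
    pair in the definition is determined up to order. *)
Lemma adm_exc (r0 p q : 'I_N) x y : exc e r0 p q -> adm n E r0 x y ->
  exists x0 y0 : 'I_N, [/\ val x0 = x, val y0 = y & exc e r0 x0 y0].
Proof.
move=> ex [_ /andP[xn dx] /andP[yn dy] [nrx nry nxy]].
have [U D _] := exc_deg on_ord_sym on_ord_irr ex.
pose x0 := Ordinal (leq_trans xn nN); pose y0 := Ordinal (leq_trans yn nN).
have x0D : x0 \in [:: r0; p; q] by rewrite -D on_ord_deg.
have y0D : y0 \in [:: r0; p; q] by rewrite -D on_ord_deg.
exists x0, y0; split=> //.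
have nx : x0 != r0 by rewrite eq_sym.
have ny : y0 != r0 by rewrite eq_sym.
have nxy0 : x0 != y0 by [].
move: x0D y0D; rewrite !inE (negPf nx) (negPf ny) /=.
move=> /orP[]/eqP Ex /orP[]/eqP Ey; try by rewrite Ex Ey eqxx in nxy0.
  by rewrite Ex Ey.
by rewrite Ex Ey; apply: exc_swap on_ord_sym on_ord_irr _ _ _ ex.
Qed.
End OnOrd.

Lemma excg_K23 r N : ndeg2 5 K23 r -> 5 <= N ->
  exists r0 p q : 'I_N, val r0 = r /\ exc (on_ord N K23) r0 p q.
Proof.
move=> hr N5.
pose o k (Hk : k < 5) : 'I_N := Ordinal (leq_trans Hk N5).
have go (a b c : 'I_N) : val a \in [:: 2; 3; 4] -> val b \in [:: 2; 3; 4] ->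
    val c \in [:: 2; 3; 4] -> uniq [:: val a; val b; val c] ->
    exc (on_ord N K23) a b c.
  move=> ha hb hc /=; rewrite !inE !negb_or => /and3P[/andP[nab nac] nbc _]; left.
  pose z0 := o 0 isT; pose z1 := o 1 isT.
  have hi (k : 'I_N) : val k \in [:: 2; 3; 4] ->
      [/\ on_ord N K23 k z0, on_ord N K23 k z1, k != z0 & k != z1].
    by rewrite /on_ord /K23 -!val_eqE /= !inE => /or3P[]/eqP->.
  have low (k l : 'I_N) : val k \in [:: 2; 3; 4] -> val l \in [:: 2; 3; 4] -> ~~ on_ord N K23 k l.
    by rewrite /on_ord /K23 !inE => /or3P[]/eqP-> /or3P[]/eqP->.
  have [a0 a1 na0 na1] := hi a ha; have [b0 b1 nb0 nb1] := hi b hb.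
  have [c0 c1 nc0 nc1] := hi c hc.
  have sK : symmetric (on_ord N K23) by apply/on_ord_sym/K23_sym.
  have iK : irreflexive (on_ord N K23) by move=> k; rewrite /on_ord /K23; clear; lia.
  have h : core (on_ord N K23) a true [set z0; z1; a] z0 z1.
    by apply: core_base => //; rewrite sK.
  have Nk (k : 'I_N) : val k \in [:: 2; 3; 4] ->
      {in [set z0; z1; a], forall v, on_ord N K23 k v = (v == z0) || (v == z1)}.
    move=> hk v; have [k0 k1 _ _] := hi k hk.
    rewrite !inE => /orP[/orP[]|]/eqP->; rewrite ?eqxx ?orbT ?k0 ?k1 //.
    by rewrite (negPf na0) (negPf na1); apply: negbTE; apply: low.
  apply: (core_exc_twin sK iK); first apply: (core_twins h (x := b) (y := c)).
  - by rewrite !inE !negb_or nb0 nb1 eq_sym -val_eqE.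
  - by rewrite !inE !negb_or nc0 nc1 eq_sym -val_eqE.
  - by rewrite -val_eqE.
  - exact: low.
  - exact: Nk.
  - exact: Nk.
  - move=> u v; rewrite /on_ord => uv.
    have u5 : u < 5 by move: uv; rewrite /K23; clear; lia.
    move: ha hb hc nab nac nbc u5; rewrite !inE -!val_eqE /=; clear; lia.
have r5 : r < 5 by case/andP: hr.
case: r hr r5 => [|[|[|[|[|r]]]]] // _ _.
- by exists (o 2 isT), (o 3 isT), (o 4 isT); split=> //; apply: go.
- by exists (o 3 isT), (o 2 isT), (o 4 isT); split=> //; apply: go.
- by exists (o 4 isT), (o 2 isT), (o 3 isT); split=> //; apply: go.
Qed.

Section Steps.
Variables (N n : nat) (E : rel nat) (r x y : 'I_N).
Hypotheses (bE : bounded n E) (sE : symmetric E) (iE : irreflexive E).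
Let e := on_ord N E.
Hypothesis ex : exc e r x y.

Lemma core_bound b (S : {set 'I_N}) s t : core e r b S s t -> {in S, forall v : 'I_N, v < n}.
Proof.
move=> h v /(core_supp (on_ord_sym sE) (on_ord_irr iE) h)/suppP[u].
by move/bE/andP=> [].
Qed.

(** A nonadjacent pair excludes [exc_adj]. The finished stage then serves as core, with the two
    inner vertices of the path as its adjacent pair. *)
Lemma path_exc : n.+1 < N -> x < n -> y < n -> ~~ E x y ->
  exists p q, exc (on_ord N (add_path3 n E x y)) r p q.
Proof.
move=> n1N xn yn nexy; set E' := add_path3 n E x y.
pose u := Ordinal (ltnW n1N); pose v := Ordinal n1N.
case: ex => [/exc_twin_core|[S [s [t [h xS yS nxy [Nx Ny sp]]]]]]; last first.
  by move: nexy; rewrite -[E x y]/(e x y) Nx eqxx.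
case=> S h sp; have low := core_bound h.
have [[xS yS rS] [nxy _ _]] := core_in h.
exists u, v; right; exists S, x, y; split.
- apply: core_ext h _ => i j iS jS; rewrite /on_ord /E' path3_old //; exact: low.
- by apply/negP => /low /=; rewrite ltnn.
- by apply/negP => /low /=; clear; lia.
- by rewrite -val_eqE /=; clear; lia.
- split.
  + move=> w; rewrite /on_ord /E' /add_path3 /sedge (bounded_out bE) ?leqnn // -!val_eqE /=.
    by move: xn yn; clear; lia.
  + move=> w; rewrite /on_ord /E' /add_path3 /sedge (bounded_out bE) ?leqnSn // -!val_eqE /=.
    by move: xn yn; clear; lia.
  + move=> a b; rewrite /on_ord /E' /add_path3 !in_setU1 => /orP[/sp->|ab].
      by rewrite !orbT.
    have : [|| val a == x, val a == y, val a == n | val a == n.+1].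
      by move: ab; rewrite /sedge /=; clear; lia.
    by rewrite -!val_eqE /=; case/or4P=> [/eqP/val_inj->|/eqP/val_inj->|->|->];
      rewrite ?xS ?yS ?orbT.
Qed.

(** The partner [y] becomes a pendant of the core at [t], and [x] with its copy [u] are the new
    twins on [s] and [y]. *)
Lemma twin_exc : n < N -> E x y -> exists p q, exc (on_ord N (add_twin n E x)) r p q.
Proof.
move=> nN exy; set E' := add_twin n E x.
have [xn yn] := andP (bE exy).
pose u := Ordinal nN.
have sE' : symmetric (on_ord N E') by apply/on_ord_sym/twin_sym.
have iE' : irreflexive (on_ord N E').
  move=> k; rewrite /on_ord /E' /add_twin iE /=; apply/negbTE/negP.
  by case/orP=> /andP[/eqP-> /bE]; rewrite ltnn andbF.
have [_ _ /(_ exy)] := exc_adjE (on_ord_sym sE) ex.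
case=> S [s [t [h xS yS nxy [Nx Ny sp]]]]; have low := core_bound h.
have [[sS tS rS] [nst nrs nrt]] := core_in h.
have uS : u \notin S by apply/negP => /low /=; rewrite ltnn.
have uxn : u != x by rewrite -val_eqE /=; move: xn; clear; lia.
have uyn : u != y by rewrite -val_eqE /=; move: yn; clear; lia.
have old (i j : 'I_N) : i < n -> j < n -> on_ord N E' i j = on_ord N E i j.
  by move=> ni nj; rewrite /on_ord /E' twin_old.
have new (i : 'I_N) : i < n -> on_ord N E' u i = on_ord N E i x.
  by move=> ni; rewrite /on_ord /E' !(twin_new bE).
have h1 : core (on_ord N E') r true (y |: S) s y.
  apply: core_pendr => //.
    by apply: core_ext h _ => i j /low ni /low nj; rewrite old.
  move=> w wS; have := low w wS; move=> wn; rewrite old // Ny.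
  by have -> : w == x = false by apply/negbTE; neq.
exists x, u; left; apply: (core_exc_twin sE' iE' (S := x |: (u |: (y |: S)))).
  apply: core_twins h1 _ _ _ _ _ _.
  - by rewrite in_setU1 negb_or nxy.
  - by rewrite in_setU1 negb_or uyn.
  - by rewrite eq_sym.
  - by rewrite sE' new // (on_ord_irr iE).
  - move=> w; rewrite in_setU1 => /orP[/eqP->|wS].
      by rewrite old // Nx eqxx orbT.
    by rewrite old // ?low // Nx orbC.
  - move=> w; rewrite in_setU1 => /orP[/eqP->|wS].
      by rewrite new // on_ord_sym // Nx eqxx orbT.
    by rewrite new // ?low // on_ord_sym // Nx orbC.
move=> a b; rewrite /on_ord /E' /add_twin => /or3P[/sp|/andP[A _]|/andP[_ xa]].
- by rewrite !in_setU1 => /or3P[->|->|->]; rewrite ?orbT.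
- by rewrite !in_setU1 -[a == u]val_eqE /= A orbT.
- move: xa; rewrite (sE x) => /sp.
  by rewrite !in_setU1 => /or3P[->|->|->]; rewrite ?orbT.
Qed.

(** The old pair [x], [y] moves into the core, [a] and [c] are the new terminals, and the opposite
    vertices [b] and [d] of the 4-cycle are the twins. *)
Lemma C4_exc : n.+3 < N -> E x y -> exists p q, exc (on_ord N (add_C4 n E x y)) r p q.
Proof.
move=> nN exy; set E' := add_C4 n E x y.
have [xn yn] := andP (bE exy).
have o k : k < 4 -> n + k < N by move: nN; clear; lia.
pose a : 'I_N := Ordinal (o 0 isT); pose b : 'I_N := Ordinal (o 1 isT).
pose c : 'I_N := Ordinal (o 2 isT); pose d : 'I_N := Ordinal (o 3 isT).
have sE' : symmetric (on_ord N E') by apply/on_ord_sym/C4_sym.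
have iE' : irreflexive (on_ord N E').
  by move=> k; rewrite /on_ord /E' /add_C4 iE /sedge /=; move: xn yn; clear; lia.
have [_ _ /(_ exy)] := exc_adjE (on_ord_sym sE) ex.
case=> S [s [t [h xS yS nxy [Nx Ny sp]]]]; have low := core_bound h.
have [[sS tS rS] [nst nrs nrt]] := core_in h.
have old (i j : 'I_N) : i < n -> j < n -> on_ord N E' i j = on_ord N E i j.
  by move=> ni nj; rewrite /on_ord /E' C4_old.
have out k (Hk : k < 4) : Ordinal (o k Hk) \notin S.
  by apply/negP => /low /=; clear; lia.
have [[nxa nxc nxb nxd] [nya nyc nyb nyd] [nac nab nad] [ncb ncd nbd]] :
    [/\ [/\ x != a, x != c, x != b & x != d], [/\ y != a, y != c, y != b & y != d],
        [/\ a != c, a != b & a != d] & [/\ c != b, c != d & b != d]].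
  by rewrite -!val_eqE /=; move: xn yn; clear; do !split; lia.
have inn i j (Hi : i < 4) (Hj : j < 4) :
    on_ord N E' (Ordinal (o i Hi)) (Ordinal (o j Hj)) = odd (i + j).
  by rewrite /on_ord /E' /= (C4_in bE).
have ext (v : 'I_N) : v < n -> [/\ on_ord N E' a v = (v == x), on_ord N E' b v = false,
    on_ord N E' c v = (v == y) & on_ord N E' d v = false].
  move=> vn; rewrite /on_ord /E' -!val_eqE /= addn0 addn1 addn2 addn3.
  by split; rewrite (C4_out bE).
have h1 : core (on_ord N E') r true (x |: (y |: (a |: (c |: S)))) a c.
  apply: (core_C4 (S := S) (p := s) (q := t)) => //.
  - by apply: core_ext h _ => i j /low ni /low nj; rewrite old.
  - exact: out.
  - exact: out.
  - by allneq.
  - move=> v vS; rewrite old // ?low // Nx; have -> : v == y = false by apply/negbTE; neq.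
    by [].
  - move=> v vS; rewrite old // ?low // Ny; have -> : v == x = false by apply/negbTE; neq.
    by [].
  - by move=> v vS; have [-> _ _ _] := ext v (low v vS); apply/negbTE; neq.
  - by move=> v vS; have [_ _ -> _] := ext v (low v vS); apply/negbTE; neq.
  - by rewrite old.
  - by have [-> _ _ _] := ext x xn; rewrite eqxx.
  - by have [_ _ -> _] := ext y yn; rewrite eqxx.
  - by have [-> _ _ _] := ext y yn; rewrite eq_sym.
  - by have [_ _ -> _] := ext x xn.
  - by rewrite inn.
exists b, d; left.
apply: (core_exc_twin sE' iE' (S := b |: (d |: (x |: (y |: (a |: (c |: S))))))).
  have Nb k (Hk : k < 4) : odd k -> {in x |: (y |: (a |: (c |: S))), forall v,
      (forall v : 'I_N, v < n -> on_ord N E' (Ordinal (o k Hk)) v = false) ->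
      on_ord N E' (Ordinal (o k Hk)) v = (v == a) || (v == c)}.
    move=> ok v vV H; have vac : v < n -> (v == a) || (v == c) = false.
      by move=> vn; rewrite -!val_eqE /=; move: vn; clear; lia.
    move: vV; rewrite !in_setU1 => /or4P[/eqP->|/eqP->|/eqP->|/orP[/eqP->|vS]].
    - by rewrite H // -!val_eqE /=; move: xn; clear; lia.
    - by rewrite H // -!val_eqE /=; move: yn; clear; lia.
    - by rewrite inn addn0 ok eqxx.
    - by rewrite inn addn2 /= negbK ok eqxx orbT.
    - by rewrite vac ?H ?low.
  apply: core_twins h1 _ _ _ _ _ _.
  - by rewrite !in_setU1 !negb_or ![b == _]eq_sym nxb nyb nab ncb out.
  - by rewrite !in_setU1 !negb_or ![d == _]eq_sym nxd nyd nad ncd out.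
  - by [].
  - by rewrite inn.
  - by move=> v vV; apply: Nb => // w /ext[].
  - by move=> v vV; apply: Nb => // w /ext[].
move=> i j ij; case: (ltnP i n) => [ni|ni]; last first.
  have : (i == a) || (i == b) || (i == c) || (i == d).
    rewrite -!val_eqE /=; move: ij; rewrite /on_ord /E'.
    case/(C4_bounded bE xn yn)/andP=> i4 _; move: ni i4; clear; lia.
  by rewrite !in_setU1; case: (i == a) (i == b) (i == c) (i == d) => [] [] [] []; rewrite ?orbT.
case: (ltnP j n) => [nj|nj].
  move: ij; rewrite old // => /sp.
  by rewrite !in_setU1 => /or3P[->|->|->]; rewrite ?orbT.
have : (i == x) || (i == y).
  have Eij : E i j = false by rewrite (bounded_out bE) // nj orbT.
  move: ij ni nj xn yn; rewrite /on_ord /E' /add_C4 Eij.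
  rewrite -!val_eqE /sedge /=; clear; lia.
by rewrite !in_setU1; case/orP=> ->; rewrite ?orbT.
Qed.
End Steps.

(** Ordinals from [n] on are isolated. Quantifying over all [N] with [n <= N] lets the hypothesis
    for one graph of the sequence be used on a type with room for the next. *)
Lemma excg_exc r n E : excg r n E -> [/\ bounded n E, symmetric E, irreflexive E &
  forall N, n <= N -> exists r0 p q : 'I_N, val r0 = r /\ exc (on_ord N E) r0 p q].
Proof.
elim=> {n E}.
- move=> hr; split; [exact: K23_bounded|exact: K23_sym| |].
    by move=> k; rewrite /K23; clear; lia.
  by move=> N N5; apply: excg_K23.
- move=> n E x y _ [bE sE iE IH] ad nexy.
  have [_ /andP[xn _] /andP[yn _] [_ _ nxy]] := ad.
  split; [exact: path3_bounded|exact: path3_sym| |].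
    by move=> k; rewrite /add_path3 iE /sedge; move: xn yn nxy; clear; lia.
  move=> N nN; have nN' : n <= N by move: nN; clear; lia.
  have [r0 [p [q [Er ex]]]] := IH N nN'; rewrite -Er in ad.
  have [x0 [y0 [Ex Ey ex']]] := adm_exc bE sE iE nN' ex ad.
  rewrite -{}Ex -{}Ey in xn yn nexy *.
  have [p' [q' H]] := path_exc bE sE iE ex' nN xn yn nexy.
  by exists r0, p', q'.
- move=> n E x y w _ [bE sE iE IH] ad exy hw.
  have [_ /andP[xn _] /andP[yn _] [_ _ nxy]] := ad.
  split; [exact: twin_bounded|exact: twin_sym| |].
    move=> k; rewrite /add_twin iE /=; apply/negbTE/negP.
    by case/orP=> /andP[/eqP-> /bE]; rewrite ltnn andbF.
  move=> N nN; have nN' : n <= N by move: nN; clear; lia.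
  have [r0 [p [q [Er ex]]]] := IH N nN'; rewrite -Er in ad.
  have [x0 [y0 [Ex Ey ex']]] := adm_exc bE sE iE nN' ex ad.
  have [p' [q' H]] : exists p q, exc (on_ord N (add_twin n E w)) r0 p q.
    rewrite -{}Ex -{}Ey in exy hw *; case: hw => ->; first exact: twin_exc exy.
    have ex2 := exc_swap (on_ord_sym sE) (on_ord_irr iE) ex'.
    by apply: (twin_exc bE sE iE ex2 nN); rewrite sE.
  by exists r0, p', q'.
- move=> n E x y _ [bE sE iE IH] ad exy.
  have [_ /andP[xn _] /andP[yn _] [_ _ nxy]] := ad.
  split; [exact: C4_bounded|exact: C4_sym| |].
    by move=> k; rewrite /add_C4 iE /sedge; move: xn yn; clear; lia.
  move=> N nN; have nN' : n <= N by move: nN; clear; lia.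
  have [r0 [p [q [Er ex]]]] := IH N nN'; rewrite -Er in ad.
  have [x0 [y0 [Ex Ey ex']]] := adm_exc bE sE iE nN' ex ad.
  rewrite -{}Ex -{}Ey in exy *.
  have [p' [q' H]] := C4_exc bE sE iE ex' nN exy.
  by exists r0, p', q'.
Qed.

Lemma exceptional_nozero (T : finType) (e : rel T) : exceptional e -> nozero e.
Proof.
case=> r [n [E [f [[fi fb fs fe] /excg_exc[bE sE iE H] _]]]].
have [r0 [p [q [_ ex]]]] := H n (leqnn n).
have nz := exc_nozero (on_ord_sym sE) ex.
pose g u : 'I_n := Ordinal (fb u).
have gi : injective g by move=> u v [/fi].
move=> s [s3 us cs]; rewrite -(size_map g); apply: nz; split.
- by rewrite size_map.
- by rewrite map_inj_uniq.
- by rewrite cycle_map; apply: sub_cycle cs => u v; rewrite fe.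
Qed.

Theorem theorem1p4 (T : finType) (e : rel T) :
  simple_graph e ->
  0 < #|T| ->
  (forall v : T, 2 <= deg e v) ->
  #|[set v : T | deg e v == 2]| <= 3 ->
  (exists s : seq T, is_cycle e s /\ 3 %| size s) <-> ~ exceptional e.
Proof.
move=> [esym eirr] /card_gt0P[v0 _] d2 few; split.
  by move=> [s [cs d3]] /exceptional_nozero/(_ s cs); rewrite d3.
move=> nex; apply: NNPP => none; apply: nex.
have nz : nozero e by move=> s cs; apply/negP => d3; apply: none; exists s.
have dn1 v : deg e v != 1 by rewrite neq_ltn d2 orbT.
have pos : exists v, 0 < deg e v by exists v0; apply: leq_trans (d2 v0).
have [r [p [q ex]]] := nozero_exc esym eirr nz dn1 pos few.
exact: exc_exceptional ex.
Qed.
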